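(* Let $(\mathbf{c},\mathbf{d},\mathbf{Q})$ be a geometric Forward-Reverse Brascamp--Lieb datum. Let $f_i : E_i \to [0,+\infty)$, $1\le i\le k$, and $g_j : E^j \to [0,+\infty)$, $1\le j\le m$, be non-negative integrable functions such that $$\prod_{i=1}^k f_i(\pi_{E_i}x)^{c_i} \le \prod_{j=1}^m g_j(\pi_{E^j}\mathbf{Q}x)^{d_j}, \qquad \forall\, x\in E_0.$$ Then $$\prod_{i=1}^k \big((e^{t\Delta_{E_i}}f_i)(\pi_{E_i}x)\big)^{c_i} \le \prod_{j=1}^m \big((e^{t\Delta_{E^j}}g_j)(\pi_{E^j}\mathbf{Q}x)\big)^{d_j}, \qquad \forall\, x\in E_0,\ t>0.$$
   Context: A Euclidean space is a finite dimensional real Hilbert space $V$ with its inner product $\langle\cdot,\cdot\rangle_V$ and its Lebesgue measure (the one induced by the inner product). Direct sums carry the inner product making the summands orthogonal. For self-adjoint linear maps $A,B$ on $V$, $A\ge B$ means that $A-B$ is positive semidefinite; $A^*$ denotes the adjoint. Let $E_1,\dots,E_k$ and $E^1,\dots,E^m$ be Euclidean spaces, $E_0=\oplus_{i=1}^k E_i$, $E^0=\oplus_{j=1}^m E^j$, and let $\pi_{E_i}:E_0\to E_i$, $\pi_{E^j}:E^0\to E^j$ be the orthogonal projections. A Forward-Reverse Brascamp--Lieb datum is a triple $(\mathbf{c},\mathbf{d},\mathbf{Q})$ where $\mathbf{Q}:E_0\to E^0$ is linear, and $\mathbf{c}=(c_i)_{1\le i\le k}$, $\mathbf{d}=(d_j)_{1\le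 j\le m}$ are collections of positive numbers with $\sum_{i=1}^k c_i\dim(E_i)=\sum_{j=1}^m d_j\dim(E^j)$. Put $\Lambda_{\mathbf{c}}=\sum_{i=1}^k c_i\pi_{E_i}^*\pi_{E_i}$ and $\Lambda_{\mathbf{d}}=\sum_{j=1}^m d_j\pi_{E^j}^*\pi_{E^j}$ (block diagonal maps with blocks $c_i\,\mathrm{id}_{E_i}$, resp. $d_j\,\mathrm{id}_{E^j}$). The set $\Pi(\mathrm{id}_{E_1},\dots,\mathrm{id}_{E_k})$ consists of the self-adjoint positive semidefinite linear maps $\Sigma$ on $E_0$ with $\pi_{E_i}\Sigma\pi_{E_i}^*=\mathrm{id}_{E_i}$ for all $i$; similarly $\Pi(\mathrm{id}_{E^1},\dots,\mathrm{id}_{E^m})$ consists of the self-adjoint positive semidefinite linear maps $S$ on $E^0$ with $\pi_{E^j}S\pi_{E^j}^*=\mathrm{id}_{E^j}$ for all $j$. The datum is called geometric if $\mathbf{Q}^*\Lambda_{\mathbf{d}}\mathbf{Q}\le\Lambda_{\mathbf{c}}$ and there exists $\Sigma\in\Pi(\mathrm{id}_{E_1},\dots,\mathrm{id}_{E_k})$ such that $\mathbf{Q}\Sigma\mathbf{Q}^*\in\Pi(\mathrm{id}_{E^1},\dots,\mathrm{id}_{E^m})$. The heat semigroup on a Euclidean space $V$ is $(e^{t\Delta_V}f)(x)=\int_V f(y)\,(4\pi t)^{-\dim V/2}e^{-|x-y|_V^2/(4t)}\,dy$ for $t>0$. *)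

(* Defs.v *)
From HB Require Import structures.
From mathcomp Require Import all_boot all_order all_algebra.
From mathcomp Require Import all_classical all_reals all_analysis.
Import Order.TTheory GRing.Theory Num.Theory.
Import numFieldNormedType.Exports.

Set Implicit Arguments.
Unset Strict Implicit.
Unset Printing Implicit Defensive.

Local Open Scope classical_set_scope.
Local Open Scope ring_scope.

(* For theta = idfun, {dot V for theta} is the type of symmetric positive
   definite bilinear forms on V. The dimension 0 is allowed. *)
Record euclidean (R : realType) := Euclidean {
  euclidean_sort :> vectType R;
  euclidean_dot : {dot euclidean_sort for idfun} }.

Definition inner (R : realType) (V : euclidean R) (x y : V) : R :=
  euclidean_dot V x y.

Section Inner.
Context {R : realType} {V : euclidean R}.
Implicit Types x y z : V.

Lemma innerC x y : inner x y = inner y x.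
Proof. by rewrite /inner hermC expr0 mul1r. Qed.

Lemma innerDl x y z : inner (x + y) z = inner x z + inner y z.
Proof. exact: linearDl. Qed.

Lemma innerZl a x z : inner (a *: x) z = a * inner x z.
Proof. exact: linearZl_LR. Qed.

Lemma innerDr x y z : inner z (x + y) = inner z x + inner z y.
Proof. by rewrite innerC innerDl !(innerC z). Qed.

Lemma innerZr a x z : inner z (a *: x) = a * inner z x.
Proof. by rewrite innerC innerZl (innerC z). Qed.

Lemma inner_gt0 x : x != 0 -> 0 < inner x x.
Proof. exact: neq0_dnorm_gt0. Qed.

Lemma inner_sumr (I : Type) (r : seq I) (P : pred I) (F : I -> V) z :
  inner z (\sum_(i <- r | P i) F i) = \sum_(i <- r | P i) inner z (F i).
Proof. exact: linear_sumr. Qed.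

Lemma inner_suml (I : Type) (r : seq I) (P : pred I) (F : I -> V) z :
  inner (\sum_(i <- r | P i) F i) z = \sum_(i <- r | P i) inner (F i) z.
Proof. exact: linear_sumlz. Qed.

Lemma inner_eqP x y : (forall z, inner z x = inner z y) -> x = y.
Proof.
move=> xy; apply/eqP; rewrite -subr_eq0; apply/negP => /negP/inner_gt0.
by rewrite innerDr -scaleN1r innerZr xy mulN1r subrr ltxx.
Qed.

Lemma onb_vspace (W : {vspace V}) : exists s : seq V,
  [/\ size s = \dim W, << s >>%VS = W & orthonormal (euclidean_dot V) s].
Proof.
have [n] := ubnP (\dim W); elim: n W => // n IH W; rewrite ltnS => dW.
have [->|W0] := eqVneq W 0%VS.
  by exists [::]; rewrite dimv0 span_nil.
have v0 : vpick W != 0 by rewrite vpick0.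
pose u := (Num.sqrt (inner (vpick W) (vpick W)))^-1 *: vpick W.
have uu : inner u u = 1.
  rewrite innerZl innerZr mulrA -expr2 exprVn sqr_sqrtr ?ltW ?inner_gt0//.
  by rewrite mulVf// gt_eqF// inner_gt0.
have uW : u \in W by rewrite memvZ// memv_pick.
have dW1 : (\dim W).-1 = \dim (W :&: orthov (euclidean_dot V) <[u]>)%VS.
  apply: eq_dim_orthov1; apply/mem_orthovPn; exists u => //.
  by rewrite [X in X != _]uu oner_neq0.
have dW0 : (0 < \dim W)%N by rewrite lt0n dimv_eq0.
have [|s [ss sW sO]] := IH (W :&: orthov (euclidean_dot V) <[u]>)%VS.
  by rewrite -dW1 prednK.
have us v : v \in s -> inner u v = 0.
  move=> vs; rewrite innerC; apply/eqP.
  rewrite -[X in is_true X]mem_orthov1.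
  have : v \in (W :&: orthov (euclidean_dot V) <[u]>)%VS.
    by rewrite -sW memv_span.
  by rewrite memv_cap => /andP[].
exists (u :: s); split => /=.
- by rewrite ss -dW1 prednK.
- apply/eqP; rewrite span_cons sW eqEdim; apply/andP; split.
    by rewrite subv_add -memvE uW capvSl.
  rewrite dimv_disjoint_sum; last first.
    apply/eqP; rewrite -subv0; apply/subvP => w.
    rewrite memv_cap => /andP[/vlineP[a ->]]; rewrite memv_cap => /andP[_].
    rewrite mem_orthov1 -[X in X == 0]/(inner (a *: u) u) innerZl uu mulr1.
    by move=> /eqP ->; rewrite scale0r mem0v.
  have u0 : u != 0.
    apply/eqP => u0; move: uu; rewrite u0 /inner linear0l => /eqP.
    by rewrite eq_sym oner_eq0.
  by rewrite -dW1 dim_vline u0 add1n prednK.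
- move: sO; rewrite /orthonormal /= => /andP[-> ->]; rewrite !andbT.
  rewrite -[X in X == 1]/(inner u u) uu eqxx /=.
  by apply/allP => v /us /eqP.
Qed.

Lemma onb_exists : exists b : (dim V).-tuple V, orthonormal (euclidean_dot V) b.
Proof.
have [s [ss _ sO]] := onb_vspace fullv.
have sP : size s == dim V by rewrite ss dimvf.
by exists (Tuple sP).
Qed.
End Inner.

Section Onb.
Context {R : realType} (V : euclidean R).

Definition onb : (dim V).-tuple V := xchoose (@onb_exists R V).

Lemma onb_orthonormal : orthonormal (euclidean_dot V) onb.
Proof. exact: (xchooseP (@onb_exists R V)). Qed.

Lemma onbE (i j : 'I_(dim V)) : inner (tnth onb i) (tnth onb j) = (i == j)%:R.
Proof.
have := onb_orthonormal; rewrite /orthonormal => /andP[/allP n1 n0].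
have [->|] := eqVneq i j; first exact/eqP/n1/mem_tnth.
wlog ij : i j / (i < j)%N => [H|_].
  rewrite neq_ltn => /orP[ij|ij]; first by rewrite H// neq_ltn ij.
  by rewrite innerC H// neq_ltn ij.
have step (s : seq V) p q : pair_ortho_rec (euclidean_dot V) s ->
    (p < q < size s)%N -> inner (nth 0 s p) (nth 0 s q) = 0.
  elim: s p q => [|v s IH] p q /=; first by rewrite ltn0 andbF.
  move=> /andP[/andP[/allP vs _] so]; case: p q => [|p] [|q]//= pq.
    exact/eqP/vs/mem_nth.
  exact: IH.
by rewrite !(tnth_nth 0) step// ij/= size_tuple.
Qed.

(* The linear isometry from R^n, n = dim V, onto V given by an orthonormal
   basis. Another choice of basis changes it by an orthogonal map of R^n. *)
Definition of_coord (y : (dim V).-tuple R) : V :=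
  \sum_(i < dim V) tnth y i *: tnth onb i.

Definition to_coord (x : V) : (dim V).-tuple R :=
  [tuple inner x (tnth onb i) | i < dim V].

Lemma of_coordK : cancel of_coord to_coord.
Proof.
move=> y; apply: eq_from_tnth => i; rewrite tnth_mktuple /of_coord inner_suml.
rewrite (bigD1 i)//= innerZl onbE eqxx mulr1 big1 ?addr0// => j ji.
by rewrite innerZl onbE (negbTE ji) mulr0.
Qed.

Lemma onb_free : free onb.
Proof.
apply/freeP => c c0 i.
have := of_coordK [tuple c i | i < dim V]; rewrite /of_coord.
under eq_bigr do rewrite tnth_mktuple (tnth_nth 0).
rewrite c0 => /(congr1 (fun y => tnth y i)); rewrite !tnth_mktuple => <-.
exact: linear0l.
Qed.

Lemma to_coordK : cancel to_coord of_coord.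
Proof.
move=> x.
have xO : x \in << onb >>%VS.
  suff -> : << onb >>%VS = fullv by rewrite memvf.
  apply/eqP; rewrite eqEdim subvf/= dimvf.
  by have /eqP -> := onb_free; rewrite size_tuple.
have : x = of_coord [tuple coord onb i x | i < dim V].
  rewrite [LHS](coord_span xO); apply: eq_bigr => i _.
  by rewrite tnth_mktuple (tnth_nth 0).
by move=> ->; rewrite of_coordK.
Qed.

End Onb.

Section Adjoint.
Context {R : realType} {U V : euclidean R}.

Definition adjoint_fun (f : 'Hom(U, V)) (y : V) : U :=
  \sum_(i < dim U) inner (f (tnth (onb U) i)) y *: tnth (onb U) i.

Let adjoint_fun_is_linear (f : 'Hom(U, V)) : linear (adjoint_fun f).
Proof.
move=> a y z; rewrite /adjoint_fun scaler_sumr -big_split /=.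
by apply: eq_bigr => i _; rewrite innerDr innerZr scalerDl scalerA.
Qed.

HB.instance Definition _ (f : 'Hom(U, V)) :=
  GRing.isLinear.Build R V U _ (adjoint_fun f) (adjoint_fun_is_linear f).

Definition adjoint (f : 'Hom(U, V)) : 'Hom(V, U) := linfun (adjoint_fun f).

Lemma adjointE (f : 'Hom(U, V)) x y : inner (f x) y = inner x (adjoint f y).
Proof.
rewrite lfunE /= /adjoint_fun inner_sumr -{1}(to_coordK x) /of_coord.
rewrite linear_sum inner_suml; apply: eq_bigr => i _.
by rewrite linearZ/= innerZl tnth_mktuple innerZr mulrC.
Qed.

End Adjoint.

Section Loewner.
Context {R : realType} {V : euclidean R}.
Implicit Types A B : 'End(V).

Definition psd A : Prop :=
  adjoint A = A /\ forall x : V, 0 <= inner x (A x).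

Definition loewner_le A B : Prop := psd (B - A).

End Loewner.

Section DirectSum.
Context {R : realType} {k : nat} (E : 'I_k -> euclidean R).

(* The external direct sum: families (x_i) with x_i in E_i. *)
Definition dsum_type : Type := {dffun forall i : 'I_k, E i}.

HB.instance Definition _ := Choice.on dsum_type.

Implicit Types x y z : dsum_type.

Definition dsum_zero : dsum_type := [ffun i => 0 : E i].
Definition dsum_opp x : dsum_type := [ffun i => - x i].
Definition dsum_add x y : dsum_type := [ffun i => x i + y i].
Definition dsum_scale (a : R) x : dsum_type := [ffun i => a *: x i].

Let dsum_addA : associative dsum_add.
Proof. by move=> x y z; apply/ffunP => i; rewrite !ffunE addrA. Qed.
Let dsum_addC : commutative dsum_add.
Proof. by move=> x y; apply/ffunP => i; rewrite !ffunE addrC. Qed.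
Let dsum_add0 : left_id dsum_zero dsum_add.
Proof. by move=> x; apply/ffunP => i; rewrite !ffunE add0r. Qed.
Let dsum_addN : left_inverse dsum_zero dsum_opp dsum_add.
Proof. by move=> x; apply/ffunP => i; rewrite !ffunE addNr. Qed.

HB.instance Definition _ :=
  GRing.isZmodule.Build dsum_type dsum_addA dsum_addC dsum_add0 dsum_addN.

Let dsum_scaleA a b x : dsum_scale a (dsum_scale b x) = dsum_scale (a * b) x.
Proof. by apply/ffunP => i; rewrite !ffunE scalerA. Qed.
Let dsum_scale1 : left_id 1 dsum_scale.
Proof. by move=> x; apply/ffunP => i; rewrite !ffunE scale1r. Qed.
Let dsum_scaleDr : right_distributive dsum_scale +%R.
Proof. by move=> a x y; apply/ffunP => i; rewrite !ffunE scalerDr. Qed.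
Let dsum_scaleDl x : {morph dsum_scale^~ x : a b / a + b}.
Proof. by move=> a b; apply/ffunP => i; rewrite !ffunE scalerDl. Qed.

HB.instance Definition _ := GRing.Zmodule_isLmodule.Build R dsum_type
  dsum_scaleA dsum_scale1 dsum_scaleDr dsum_scaleDl.

Lemma dsum_PE a x y i : (a *: x + y) i = a *: x i + y i.
Proof. by rewrite !ffunE. Qed.

Import VectorInternalTheory.

Let dsum_vect_iso : Vector.axiom (\sum_(i < k) dim (E i)) dsum_type.
Proof.
pose fr (x : dsum_type) := \mxrow_(i < k) v2r (x i).
exists fr.
  have subZ a (M : 'rV_(\sum_(i < k) dim (E i))) i :
    submxrow (a *: M) i = a *: submxrow M i by apply/rowP => j; rewrite !mxE.
  move=> a x y; apply/mxrowP => i.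
  by rewrite submxrowD subZ !mxrowK dsum_PE semilinearP semilinearP.
exists (fun r => [ffun i => r2v (submxrow r i) : E i] : dsum_type) => [x|r].
  by apply/ffunP => i; rewrite ffunE mxrowK v2rK.
by apply/mxrowP => i; rewrite mxrowK ffunE r2vK.
Qed.

HB.instance Definition _ :=
  Lmodule_hasFinDim.Build R dsum_type dsum_vect_iso.

Definition dsum_dot x y : R := \sum_(i < k) inner (x i) (y i).

Let dsum_dotC x y : dsum_dot x y = dsum_dot y x.
Proof. by apply: eq_bigr => i _; rewrite innerC. Qed.

Let dsum_dotPl y a x x' :
  dsum_dot (a *: x + x') y = a * dsum_dot x y + dsum_dot x' y.
Proof.
rewrite /dsum_dot mulr_sumr -big_split; apply: eq_bigr => i _.
by rewrite dsum_PE innerDl innerZl.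
Qed.

Let dsum_dot_bilinear : bilinear_for *%R (idfun \; *%R) dsum_dot.
Proof.
split=> [y a x x'|y a x x']; first exact: dsum_dotPl.
by rewrite dsum_dotC dsum_dotPl !(dsum_dotC y).
Qed.

Let dsum_dot_sym x y : dsum_dot x y = (-1) ^+ false * idfun (dsum_dot y x).
Proof. by rewrite expr0 mul1r dsum_dotC. Qed.

Let dsum_dot_gt0 x : x != 0 -> 0 < dsum_dot x x.
Proof.
move=> x0; have [i xi0] : exists i, x i != 0.
  apply: contrapT => /forallNP x0'; move/eqP: x0; apply; apply/ffunP => i.
  by rewrite ffunE; apply/eqP/negPn/negP; exact: x0'.
rewrite /dsum_dot (bigD1 i)//= ltr_pwDl ?inner_gt0//.
apply: sumr_ge0 => j _; have [->|/inner_gt0/ltW//] := eqVneq (x j) 0.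
by rewrite /inner linear0l.
Qed.

HB.instance Definition _ := bilinear_isBilinear.Build R
  dsum_type dsum_type R *%R (idfun \; *%R) dsum_dot dsum_dot_bilinear.
HB.instance Definition _ := isHermitianSesquilinear.Build R
  dsum_type false idfun dsum_dot dsum_dot_sym.
HB.instance Definition _ := isDotProduct.Build R dsum_type dsum_dot
  dsum_dot_gt0.

Definition dsum : euclidean R :=
  @Euclidean R dsum_type (dsum_dot : {dot dsum_type for idfun}).

Definition dsum_coord (i : 'I_k) (x : dsum) : E i := (x : dsum_type) i.

Let dsum_coord_linear i : linear (@dsum_coord i).
Proof. by move=> a x y; rewrite /dsum_coord dsum_PE. Qed.

HB.instance Definition _ i :=
  GRing.isLinear.Build R dsum (E i) _ (@dsum_coord i) (dsum_coord_linear i).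

Definition dsum_proj (i : 'I_k) : 'Hom(dsum, E i) := linfun (@dsum_coord i).

Lemma dsum_projE i (x : dsum) : dsum_proj i x = (x : dsum_type) i.
Proof. by rewrite lfunE. Qed.

End DirectSum.

Section LebesgueTuple.
Context {R : realType}.
Local Notation RT := (measurableTypeR R).

Definition cons_tuple n (p : RT * n.-tuple RT) : n.+1.-tuple RT :=
  [the n.+1.-tuple RT of p.1 :: p.2].

Lemma measurable_cons_tuple n : measurable_fun setT (@cons_tuple n).
Proof. exact: measurable_cons. Qed.

Let uncons_tuple n (y : n.+1.-tuple RT) : RT * n.-tuple RT :=
  (thead y, [tuple of behead y]).

Let measurable_uncons_tuple n : measurable_fun setT (@uncons_tuple n).
Proof.
apply/measurable_fun_pair; first exact: measurable_tnth.
exact: measurable_behead.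
Qed.

Let cons_tupleK n : cancel (@cons_tuple n) (@uncons_tuple n).
Proof.
by move=> [x y]; rewrite /uncons_tuple theadE; congr pair; exact: val_inj.
Qed.

Section Step.
Context {n : nat} (mu : {sigma_finite_measure set (n.-tuple RT) -> \bar R}).

Definition lebesgue_step : set (n.+1.-tuple RT) -> \bar R :=
  pushforward (lebesgue_measure \x mu)%E (@cons_tuple n).

HB.instance Definition _ := Measure.copy lebesgue_step
  (measure_function_pushforward__canonical__measure_function_Measure
     (lebesgue_measure \x mu)%E (@measurable_cons_tuple n)).

Let lebesgue_step_sigma_finite : sigma_finite setT lebesgue_step.
Proof.
have /sigma_finiteP[F [TF ndF Foo]] := sigma_finiteT (@lebesgue_measure R).
have /sigma_finiteP[G [TG ndG Goo]] := sigma_finiteT mu.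
exists (fun i => @uncons_tuple n @^-1` (F i `*` G i)).
  rewrite -preimage_bigcup; apply/seteqP; split => //= y _.
  have [i _ Fi] : (\bigcup_i F i) (thead y) by rewrite -TF.
  have [j _ Gj] : (\bigcup_i G i) [tuple of behead y] by rewrite -TG.
  exists (maxn i j) => //; split => /=.
    by move: Fi; exact/subsetPset/ndF/leq_maxl.
  by move: Gj; exact/subsetPset/ndG/leq_maxr.
move=> i; have [mF muF] := Foo i; have [mG muG] := Goo i; split.
  rewrite -[X in measurable X]setTI; apply: measurable_uncons_tuple => //.
  exact: measurableX.
rewrite /lebesgue_step /pushforward -comp_preimage.
rewrite (_ : _ \o _ = id) ?preimage_id; last first.
  by apply/funext => p; exact: cons_tupleK.
by rewrite product_measure1E// lte_mul_pinfty// ge0_fin_numE.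
Qed.

HB.instance Definition _ := Measure_isSigmaFinite.Build _ _ _ lebesgue_step
  lebesgue_step_sigma_finite.

End Step.

(* Lebesgue measure on the Borel sets of R^n, by iterated products; it is the
   unit point mass for n = 0. *)
Fixpoint lebesgue_tuple (n : nat) :
    {sigma_finite_measure set (n.-tuple RT) -> \bar R} :=
  match n with
  | 0 => \d_([tuple] : 0.-tuple RT)
  | n'.+1 => lebesgue_step (lebesgue_tuple n')
  end.

Lemma lebesgue_tuple_box n (A : 'I_n -> set RT) :
  (forall i, measurable (A i)) ->
  lebesgue_tuple n [set y | forall i, A i (tnth y i)] =
  (\prod_(i < n) lebesgue_measure (A i))%E.
Proof.
elim: n A => [|n IH] A mA.
  by rewrite big_ord0 /= diracE mem_set//= => -[].
rewrite big_ord_recl -IH//= /lebesgue_step /pushforward.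
rewrite -product_measure1E//; last first.
  rewrite (_ : [set y | _] = \bigcap_(i in [set: 'I_n])
      ((fun y : n.-tuple RT => tnth y i) @^-1` A (lift ord0 i))); last first.
    by apply/seteqP; split => y /= Ay i => [_|]; exact: Ay.
  apply: fin_bigcap_measurable => // i _.
  by rewrite -[X in measurable X]setTI; exact: measurable_tnth.
congr product_measure1; apply/seteqP; split => -[x y] /= Axy.
  split; first exact: (Axy ord0).
  by move=> i; have := Axy (lift ord0 i); rewrite tnthS.
move=> i; case: (unliftP ord0 i) => [j|] ->; last exact: Axy.1.
by rewrite tnthS; exact: Axy.2.
Qed.

End LebesgueTuple.

Section Lebesgue.
Context {R : realType}.

(* V with the sigma-algebra transported by the isometry from R^n, i.e. its
   Borel sets. *)
Definition euclidean_borel (V : euclidean R) : Type := V.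

Definition euclidean_display : measure_display.
Proof. exact: default_measure_display. Qed.

Section BorelSpace.
Context (V : euclidean R).

HB.instance Definition _ := Choice.on (euclidean_borel V).
HB.instance Definition _ :=
  isPointed.Build (euclidean_borel V) (0 : V).

Definition borel_of_coord (y : (dim V).-tuple (measurableTypeR R)) :
    euclidean_borel V :=
  of_coord y.

Definition euclidean_measurable : set (set (euclidean_borel V)) :=
  [set A | measurable (borel_of_coord @^-1` A)].

Let meas0 : euclidean_measurable set0.
Proof. by rewrite /euclidean_measurable /= preimage_set0. Qed.

Let measC A : euclidean_measurable A -> euclidean_measurable (~` A).
Proof. by rewrite /euclidean_measurable /= preimage_setC => /measurableC. Qed.

Let meas_bigcup (F : (set (euclidean_borel V))^nat) :
  (forall i, euclidean_measurable (F i)) -> euclidean_measurable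
    (\bigcup_i F i).
Proof.
by move=> mF; rewrite /euclidean_measurable /= preimage_bigcup;
  exact: bigcupT_measurable.
Qed.

HB.instance Definition _ := @isMeasurable.Build euclidean_display
  (euclidean_borel V) euclidean_measurable meas0 measC meas_bigcup.

Lemma measurable_of_coord : measurable_fun setT borel_of_coord.
Proof. by move=> _ A mA; rewrite setTI. Qed.

Definition euclidean_lebesgue : set (euclidean_borel V) -> \bar R :=
  pushforward (lebesgue_tuple (dim V)) borel_of_coord.

HB.instance Definition _ := Measure.copy euclidean_lebesgue
  (measure_function_pushforward__canonical__measure_function_Measure
     (lebesgue_tuple (dim V)) measurable_of_coord).

End BorelSpace.
Arguments euclidean_lebesgue : clear implicits.

Section HeatFlow.
Context (V : euclidean R).

(* Integrability of a Lebesgue measurable function: measurability in the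
   library is with respect to the Borel sets, and the functions measurable for
   the completion are those almost everywhere equal to a Borel function. *)
Definition lebesgue_integrable (f : V -> R) : Prop :=
  exists2 h : euclidean_borel V -> R,
    (euclidean_lebesgue V).-integrable setT (EFin \o h) &
    {ae euclidean_lebesgue V, forall x, f x = h x}.

(* For f >= 0 the library integral is the supremum of the integrals of the
   simple Borel functions below the integrand, which is the Lebesgue integral
   also when the integrand is only Lebesgue measurable. *)
Definition heat_flow (t : R) (f : V -> R) (x : V) : R :=
  \int[euclidean_lebesgue V]_y
    (f y * ((4 * pi * t) `^ (- (dim V)%:R / 2)
            * expR (- inner (x - y) (x - y) / (4 * t)))).

End HeatFlow.
End Lebesgue.
Arguments euclidean_lebesgue {R} V _ : assert.

Section Datum.
Context {R : realType} {k m : nat}.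

(* Lambda_c, the sum of the c_i pi_{E_i}^* pi_{E_i}. *)
Definition block_scalar {n} (E : 'I_n -> euclidean R) (c : 'I_n -> R) :
    'End(dsum E) :=
  \sum_(i < n) c i *: (adjoint (dsum_proj E i) \o dsum_proj E i)%VF.

(* Membership in the set Pi(id_{E_1}, ..., id_{E_n}). *)
Definition coupling_id {n} (E : 'I_n -> euclidean R) (S : 'End(dsum E)) :
    Prop :=
  psd S /\ forall i, (dsum_proj E i \o S \o adjoint (dsum_proj E i))%VF = \1%VF.

Record FRBL_datum (E : 'I_k -> euclidean R) (F : 'I_m -> euclidean R) :=
  FRBLDatum {
    FRBL_c : 'I_k -> R;
    FRBL_d : 'I_m -> R;
    FRBL_Q : 'Hom(dsum E, dsum F);
    FRBL_c_gt0 : forall i, 0 < FRBL_c i;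
    FRBL_d_gt0 : forall j, 0 < FRBL_d j;
    FRBL_dim : \sum_(i < k) FRBL_c i * (dim (E i))%:R
             = \sum_(j < m) FRBL_d j * (dim (F j))%:R }.

Context (E : 'I_k -> euclidean R) (F : 'I_m -> euclidean R).

Definition FRBL_geometric (D : FRBL_datum E F) : Prop :=
  let Q := FRBL_Q D in
  loewner_le (adjoint Q \o block_scalar F (FRBL_d D) \o Q)%VF
             (block_scalar E (FRBL_c D)) /\
  exists S : 'End(dsum E),
    coupling_id S /\ coupling_id (Q \o S \o adjoint Q)%VF.

End Datum.

(* Main.v *)
(* Maximum principle for the heat flow. Each f_i is replaced by a smaller
   bounded upper semicontinuous function with bounded support, each g_j by a
   larger lower semicontinuous one, so that the hypothesis survives. With
   H_i = e^{t Delta} f_i and G_j = eps + e^{t Delta} g_j, the ratio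
     e^{- eta t} prod_i H_i(x_i)^{c_i} / prod_j G_j((Qx)_j)^{d_j}
   is upper semicontinuous on [0, T] x E_0, at most 1 at t = 0 and small at
   infinity. If it exceeded 1, it would have a maximum with t > 0. Let v and w
   collect the gradients of the log H_i and log G_j there. The first order
   condition is Lambda_c v = Q^* Lambda_d w. Writing Sigma as a sum of
   v_l v_l^*, the second order conditions along the v_l add up to Laplacians,
   as Sigma and Q Sigma Q^* have identity diagonal blocks; with the heat
   equation this gives eta <= <Lambda_c v, v> - <Lambda_d w, w>. But
   Q^* Lambda_d Q <= Lambda_c and the first order condition force
   <Lambda_c v, v> <= <Lambda_d w, w>. *)
From HB Require Import structures.
Require Import Defs.
From mathcomp Require Import all_boot all_order all_algebra.
From mathcomp Require Import ring lra finmap.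
From mathcomp Require Import all_classical all_reals all_analysis measurable_realfun.
Import Order.TTheory GRing.Theory Num.Theory.
Import numFieldNormedType.Exports.

Set Implicit Arguments.
Unset Strict Implicit.
Unset Printing Implicit Defensive.

Local Open Scope classical_set_scope.
Local Open Scope ring_scope.

(** * The Gaussian kernel *)

(** The hypothesis holds at every point, and mollifying the data need not preserve it; hence the
    one-sided changes of the [f_i] and [g_j]. Upper semicontinuous minorants and lower
    semicontinuous majorants are what regularity of finite Borel measures supplies, and they also
    make the ratio upper semicontinuous down to t = 0, so that a maximum exists although the initial
    data may be discontinuous. The constant eps keeps the denominator away from 0 where the [g_j]
    vanish, and eta makes the contradiction at a maximum strict. The [g_j] are also truncated in
    height and support: this is harmless because Q^* Lambda_d Q <= Lambda_c confines (Qx)_j as long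
    as every x_i lies in the support of the lowered [f_i]. Derivatives of the heat flow are replaced
    by second order expansions with cubic remainder, obtained by writing the kernel at a nearby
    point as the kernel at the base point times an explicit exponential. *)

Section LebesgueTupleIntegral.
Context {R : realType}.
Local Notation RT := (measurableTypeR R).

Lemma measurable_prod_tnth n (h : 'I_n -> RT -> R) :
  (forall i, measurable_fun setT (h i)) ->
  measurable_fun setT (fun y : n.-tuple RT => \prod_(i < n) h i (tnth y i)).
Proof.
move=> mh; apply: measurable_prod => i _.
by apply: measurableT_comp => //; exact: measurable_tnth.
Qed.

(** Tonelli splits off the first coordinate, following the recursion of [lebesgue_tuple]; in
    dimension 0 the measure is a point mass and the product is empty. Serves to normalise the heat
    kernel through one-dimensional normal densities. *)
Lemma lebesgue_tuple_prod1 n (h : 'I_n -> RT -> R) :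
  (forall i, measurable_fun setT (h i)) -> (forall i x, 0 <= h i x) ->
  (forall i, (\int[lebesgue_measure]_x (h i x)%:E = 1)%E) ->
  (\int[lebesgue_tuple n]_y (\prod_(i < n) h i (tnth y i))%:E = 1)%E.
Proof.
elim: n h => [|n IH] h mh h0 h1.
  rewrite integral_dirac//; last first.
    by apply/measurable_EFinP; exact: measurable_prod_tnth.
  by rewrite diracT mul1e big_ord0.
have mP : measurable_fun setT
    (fun y : n.+1.-tuple RT => \prod_(i < n.+1) h i (tnth y i)).
  exact: measurable_prod_tnth.
transitivity (\int[(@lebesgue_measure R \x lebesgue_tuple n)%E]_z
    (\prod_(i < n.+1) h i (tnth (Defs.cons_tuple z : n.+1.-tuple RT) i))%:E)%E.
  rewrite (ge0_integral_pushforward (@measurable_cons_tuple R n))//=.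
  - exact/measurable_EFinP.
  - by move=> y _; rewrite lee_fin prodr_ge0.
rewrite fubini_tonelli1//=.
- rewrite -[RHS](h1 ord0); apply: eq_integral => x _; rewrite /fubini_F /=.
  under eq_integral => y _.
    rewrite big_ord_recl/= (_ : tnth _ ord0 = x)//.
    under eq_bigr do rewrite tnthS.
    rewrite EFinM; over.
  rewrite ge0_integralZl//=; last 3 first.
  + by apply/measurable_EFinP;
      apply: (@measurable_prod_tnth n (fun i => h (lift ord0 i))).
  + by move=> y _; rewrite lee_fin prodr_ge0.
  + by rewrite lee_fin.
  rewrite (_ : (\int[_]__ _)%E = 1%E) ?mule1//.
  rewrite -[RHS](IH (fun i => h (lift ord0 i)))//.
- apply/measurable_EFinP => /=.
  by apply: (measurableT_comp mP); exact: measurable_cons_tuple.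
- by move=> x; rewrite lee_fin prodr_ge0.
Qed.

End LebesgueTupleIntegral.

Section EuclideanBorel.
Context {R : realType} {V : euclidean R}.
Implicit Types (x y z w : V) (t : R).
Local Notation BV := (euclidean_borel V).

Lemma measurable_fun_of_coord d (T : measurableType d) (h : BV -> T) :
  measurable_fun setT (h \o @borel_of_coord R V) -> measurable_fun setT h.
Proof.
by move=> mh _ A mA; have := mh measurableT A mA; rewrite !setTI.
Qed.

Lemma measurable_inner w : measurable_fun setT (inner w : BV -> R).
Proof.
apply: measurable_fun_of_coord.
rewrite (_ : _ \o _ = fun c : (dim V).-tuple (measurableTypeR R) =>
    \sum_(i < dim V) tnth c i * inner w (tnth (onb V) i)); last first.
  apply/funext => c /=; rewrite inner_sumr.
  by apply: eq_bigr => i _; rewrite innerZr.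
apply: measurable_sum => i; apply: measurable_funM => //.
exact: measurable_tnth.
Qed.

Lemma inner_onb x y :
  inner x y = \sum_(i < dim V) inner x (tnth (onb V) i) * inner y (tnth (onb V) i).
Proof.
rewrite -{1}(to_coordK y) /of_coord inner_sumr.
by apply: eq_bigr => i _; rewrite innerZr tnth_mktuple mulrC.
Qed.

Lemma innerNl x z : inner (- x) z = - inner x z.
Proof. by rewrite -scaleN1r innerZl mulN1r. Qed.

Lemma innerNr x z : inner z (- x) = - inner z x.
Proof. by rewrite innerC innerNl innerC. Qed.

Lemma innerBl x y z : inner (x - y) z = inner x z - inner y z.
Proof. by rewrite innerDl innerNl. Qed.

Lemma innerBr x y z : inner z (x - y) = inner z x - inner z y.
Proof. by rewrite innerC innerBl !(innerC z). Qed.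

Lemma inner_ge0 x : 0 <= inner x x.
Proof. by rewrite inner_onb sumr_ge0// => i _; rewrite -expr2 sqr_ge0. Qed.

Lemma measurable_innerB w x : measurable_fun setT (fun y : BV => inner w (x - y)).
Proof.
under eq_fun do rewrite innerBr.
by apply: measurable_funB => //; exact: measurable_inner.
Qed.

Lemma measurable_sqdist x : measurable_fun setT (fun y : BV => inner (x - y) (x - y)).
Proof.
under eq_fun do rewrite inner_onb.
apply: measurable_sum => i; under eq_fun do rewrite innerC.
by apply: measurable_funM; exact: measurable_innerB.
Qed.

(* [heat_flow t f x] is the integral of [f y * heat_kernel t (x - y)], by conversion. *)
Definition heat_kernel t z : R :=
  (4 * pi * t) `^ (- (dim V)%:R / 2) * expR (- inner z z / (4 * t)).

Lemma heat_kernel_ge0 t z : 0 <= heat_kernel t z.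
Proof. by rewrite mulr_ge0 ?powR_ge0 ?expR_ge0. Qed.

Lemma measurable_heat_kernel t x :
  measurable_fun setT (fun y : BV => heat_kernel t (x - y)).
Proof.
apply: measurable_funM => //; apply: measurableT_comp => //.
apply: measurable_funM => //; apply: measurableT_comp => //.
exact: measurable_sqdist.
Qed.

Lemma powR_half_dim (a : R) (n : nat) : 0 < a ->
  a `^ (- n%:R / 2) = (Num.sqrt a)^-1 ^+ n.
Proof.
move=> a0; rewrite mulNr powRN mulrC powRrM powR12_sqrt ?ltW//.
by rewrite powR_mulrn ?sqrtr_ge0// exprVn.
Qed.

(** The exponent |z|^2 / (4t) is a sum of squares in orthonormal coordinates, each belonging to a
    normal law of variance 2t. *)
Lemma heat_kernel_prod t x (c : (dim V).-tuple R) : 0 < t ->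
  heat_kernel t (x - of_coord c) = \prod_(i < dim V)
    normal_pdf (inner x (tnth (onb V) i)) (Num.sqrt (2 * t)) (tnth c i).
Proof.
move=> t0; have s0 : Num.sqrt (2 * t) != 0 by rewrite gt_eqF// sqrtr_gt0 mulr_gt0.
rewrite /heat_kernel inner_onb powR_half_dim ?mulr_gt0 ?pi_gt0//.
under [RHS]eq_bigr do rewrite (normal_pdfE _ s0).
rewrite big_split/=; congr (_ * _).
  rewrite prodr_const card_ord /normal_peak sqr_sqrtr ?mulr_ge0 ?ltW//.
  by congr ((Num.sqrt _)^-1 ^+ _); ring.
rewrite -sumrN mulr_suml expR_sum; apply: eq_bigr => i _.
rewrite /normal_fun sqr_sqrtr ?mulr_ge0 ?ltW//; congr expR.
have -> : tnth c i = inner (of_coord c) (tnth (onb V) i).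
  by rewrite -{1}(of_coordK c) tnth_mktuple.
by rewrite innerBl; field; lra.
Qed.

Lemma integral_heat_kernel t x : 0 < t ->
  (\int[euclidean_lebesgue V]_y (heat_kernel t (x - y))%:E = 1)%E.
Proof.
move=> t0.
rewrite (ge0_integral_pushforward (@measurable_of_coord R V))//=; last 2 first.
- by apply/measurable_EFinP; exact: measurable_heat_kernel.
- by move=> y _; rewrite lee_fin heat_kernel_ge0.
rewrite -[RHS](@lebesgue_tuple_prod1 R (dim V)
  (fun i => normal_pdf (inner x (tnth (onb V) i)) (Num.sqrt (2 * t))))//.
- by apply: eq_integral => c _ /=; rewrite heat_kernel_prod.
- by move=> i; exact: measurable_normal_pdf.
- by move=> i y; exact: normal_pdf_ge0.
- by move=> i; exact: integral_normal_pdf.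
Qed.

End EuclideanBorel.

(** * Regularity of finite Borel measures *)

Section Regularity.
Context {R : realType} {V : euclidean R}.
Implicit Types (x y z w : V).
Local Notation BV := (euclidean_borel V).

(* Vectors of a [euclidean] carry no topology of the library; radii are squared. *)
Definition inner_open (U : set V) :=
  forall y, U y -> exists2 r : R, 0 < r & forall z, inner (z - y) (z - y) < r -> U z.

Lemma inner_openI (U W : set V) :
  inner_open U -> inner_open W -> inner_open (U `&` W).
Proof.
move=> oU oW y [/oU[r r0 rU] /oW[s s0 sW]]; exists (Num.min r s).
  by rewrite lt_min r0.
by move=> z; rewrite lt_min => /andP[zr zs]; split; [exact: rU|exact: sW].
Qed.

Lemma inner_open_bigcup (U : nat -> set V) :
  (forall n, inner_open (U n)) -> inner_open (\bigcup_n U n).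
Proof.
move=> oU y [n _ /oU[r r0 rU]]; exists r => // z /rU Uz; by exists n.
Qed.

Lemma inner0r x : inner x 0 = 0.
Proof. by rewrite -(scale0r x) innerZr mul0r. Qed.

Lemma CauchySchwarz_inner x y : (inner x y) ^+ 2 <= inner x x * inner y y.
Proof.
have [->|y0] := eqVneq y 0.
  by rewrite !inner0r mulr0 expr0n.
have := inner_ge0 (inner y y *: x - inner x y *: y).
rewrite !(innerBl, innerBr, innerZl, innerZr) (innerC y x) => H.
have yy := inner_gt0 y0.
rewrite -(ler_pM2l yy) -subr_ge0; move: H; congr (0 <= _); ring.
Qed.

Lemma inner_open_gt w (a : R) : inner_open [set y | a < inner w y].
Proof.
move=> y /= ay; have W0 := inner_ge0 w.
have W1 : 0 < inner w w + 1 by rewrite ltr_wpDl.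
have d0 : 0 < inner w y - a by rewrite subr_gt0.
(* The radius comes from Cauchy-Schwarz; the [+ 1] covers w = 0. *)
exists ((inner w y - a) ^+ 2 / (inner w w + 1)); first by rewrite divr_gt0 ?exprn_gt0.
move=> z; rewrite ltr_pdivlMr// => zr.
have := CauchySchwarz_inner w (z - y); rewrite innerBr => CS.
rewrite ltNge; apply/negP => za.
have : (inner w y - a) ^+ 2 <= (inner w z - inner w y) ^+ 2 by nra.
have := inner_ge0 (z - y); nra.
Qed.

Lemma inner_open_ball (rho : R) : inner_open [set y | inner y y < rho].
Proof.
move=> y /= yr; set d := rho - inner y y.
have d0 : 0 < d by rewrite subr_gt0.
set N := inner y y; have N0 : 0 <= N := inner_ge0 y.
(* |z|^2 <= (1+l)|y|^2 + (1+1/l)|z-y|^2 *)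
have N1 : 0 < N + 1 by rewrite ltr_wpDl.
(* This weight gives l |y|^2 <= d/2, which leaves the other half of the gap [d] for (1 + 1/l) |z -
   y|^2. *)
pose l := d / (2 * (N + 1)).
have l0 : 0 < l by rewrite divr_gt0// mulr_gt0.
have lN : l * N <= d / 2.
  rewrite /l mulrAC ler_pdivrMr ?mulr_gt0//.
  have : d * N <= d * (N + 1) by rewrite mulrDr mulr1 lerDl ltW.
  lra.
clearbody l; have l1 : 0 < 1 + l^-1 by rewrite addr_gt0 ?invr_gt0.
exists (d / 2 / (1 + l^-1)); first by rewrite !divr_gt0.
move=> z zr /=; have zE : z = y + (z - y) by rewrite subrKC.
move: (z - y) zr zE => u zr ->.
have zr' : (1 + l^-1) * inner u u < d / 2 by rewrite mulrC -ltr_pdivlMr.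
have := inner_ge0 (l *: y - u).
rewrite innerBl !innerBr !innerZl !innerZr (innerC u y) -/N => H.
have key : 2 * inner y u <= l * N + l^-1 * inner u u.
  rewrite -(ler_pM2l l0).
  have -> : l * (l * N + l^-1 * inner u u) = l * (l * N) + inner u u.
    by field; rewrite gt_eqF.
  by lra.
rewrite innerDl !innerDr (innerC u y) -/N.
have -> : rho = N + d by rewrite /d/N; ring.
lra.
Qed.

Variable mu : {measure set BV -> \bar R}.
Hypothesis muT : (mu setT < +oo)%E.

Let mu_fin A : measurable A -> (mu A < +oo)%E.
Proof.
by move=> mA; apply: le_lt_trans muT; rewrite le_measure ?inE.
Qed.

(** Closed sets appear as complements of [inner_open] ones. Asking for an inner closed and an outer
    open set at once makes the class stable under complement; boundedness of [K] is added only in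
    [inner_regular]. *)
Definition regular_set (A : set BV) := forall e : R, 0 < e ->
  exists K U : set BV, [/\ measurable K /\ measurable U,
    inner_open (~` K), inner_open U, K `<=` A /\ A `<=` U &
    (mu (U `\` K) < e%:E)%E].

Lemma regular_setC A : regular_set A -> regular_set (~` A).
Proof.
move=> rA e /rA[K [U [[mK mU] oK oU [KA AU] UK]]].
exists (~` U), (~` K); split => //.
- by split; exact: measurableC.
- by rewrite setCK.
- by split; exact: subsetC.
- by rewrite setDE setCK setIC -setDE.
Qed.

(** The individual errors e / 2^(n+2) sum to e/2. An infinite union of closed sets need not be
    closed, so the inner set is a finite union [L n]; as [mu] is finite, continuity from above makes
    the extra loss small for large n. *)
Lemma regular_set_bigcup (A : nat -> set BV) :
  (forall n, regular_set (A n)) -> regular_set (\bigcup_n A n).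
Proof.
move=> rA e e0.
have : forall n, exists KU : set BV * set BV,
    [/\ measurable KU.1 /\ measurable KU.2,
    inner_open (~` KU.1), inner_open KU.2, KU.1 `<=` A n /\ A n `<=` KU.2 &
    (mu (KU.2 `\` KU.1) <= (e / 2 / (2 ^ n.+1)%:R)%:E)%E].
  move=> n; have en : 0 < e / 2 / (2 ^ n.+1)%:R.
    by rewrite !divr_gt0// ltr0n expn_gt0.
  have [K [U [m1 m2 m3 m4 m5]]] := rA n _ en.
  by exists (K, U); split => //; exact: ltW.
move=> /choice[KU KUP].
pose K n := (KU n).1; pose U n := (KU n).2.
have mK n : measurable (K n) by have [[]] := KUP n.
have mU n : measurable (U n) by have [[]] := KUP n.
pose L n := \bigcup_(i < n) K i.
have mL n : measurable (L n) by apply: bigcup_measurable.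
have mUU : measurable (\bigcup_n U n) by apply: bigcup_measurable.
have capE : \bigcap_n ((\bigcup_n U n) `\` L n) =
    (\bigcup_n U n) `\` \bigcup_n K n.
  apply/seteqP; split => y.
    move=> H; split; first by have [] := H 0%N I.
    by move=> [n _ Kn]; have [_] := H n.+1 I; apply; exists n => /=.
  by move=> [Uy Ky] n _; split => // -[i _ Ki]; apply: Ky; exists i.
have le2 : (mu ((\bigcup_n U n) `\` \bigcup_n K n) <= (e / 2)%:E)%E.
  apply: (@le_trans _ _ (\sum_(n <oo) mu (U n `\` K n))%E).
    apply: measure_sigma_subadditive => //.
    - by move=> n; exact: measurableD.
    - by apply: measurableD => //; exact: bigcup_measurable.
    - by move=> y [[n _ Uy] Ky]; exists n => //; split => // Kn; apply: Ky; exists n.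
  apply: (@le_trans _ _ (\sum_(n <oo) (e / 2 / (2 ^ n.+1)%:R)%:E)%E).
    by apply: lee_nneseries => // n _; have [] := KUP n.
  by apply: epsilon_trick0; rewrite divr_ge0 ?ltW.
have cv : (mu \o (fun n => (\bigcup_n U n) `\` L n)) @ \oo -->
    mu ((\bigcup_n U n) `\` \bigcup_n K n).
  rewrite -capE; apply: nonincreasing_cvg_mu.
  - by apply: mu_fin; exact: measurableD.
  - by move=> n; exact: measurableD.
  - by rewrite capE; apply: measurableD => //; exact: bigcup_measurable.
  - move=> m n mn; apply/subsetPset; apply: setDS => y [i /= im Ki].
    by exists i => //=; exact: leq_trans mn.
have [n _ nP] : \forall n \near \oo, (mu ((\bigcup_n U n) `\` L n) < e%:E)%E.
  have lte : (mu ((\bigcup_n U n) `\` \bigcup_n K n) < e%:E)%E.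
    by apply: le_lt_trans le2 _; rewrite lte_fin; lra.
  exact: cv _ (open_nbhs_nbhs (conj (@open_ereal_lt_ereal _ _) lte)).
exists (L n), (\bigcup_n U n); split => //.
- rewrite /L; elim: n {nP} => [|n IH].
    rewrite (_ : \bigcup_(i < 0) K i = set0) ?setC0; last first.
      by apply/seteqP; split => // y [].
    by move=> y _; exists 1.
  rewrite bigcup_mkord big_ord_recr/= setCU -bigcup_mkord.
  by apply: inner_openI => //; have [] := KUP n.
- by apply: inner_open_bigcup => i; have [] := KUP i.
- split => y [i ii Ki]; first by exists i => //; have [_ _ _ [+ _] _] := KUP i; exact.
  by exists i => //; have [_ _ _ [_ +] _] := KUP i; exact.
- exact: nP (leqnn _).
Qed.

Lemma inner_open_measurable_gt w (a : R) :
  measurable ([set y | a < inner w y] : set BV).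
Proof.
have := @measurable_inner R V w measurableT `]a, +oo[%classic (measurable_itv _).
by rewrite setTI; congr measurable; apply/seteqP; split => y /=;
  rewrite in_itv/= andbT.
Qed.

Lemma regular_set_gt w (a : R) : regular_set [set y | a < inner w y].
Proof.
move=> e e0; set U := [set y | a < inner w y].
have mU b : measurable ([set y | b < inner w y] : set BV).
  exact: inner_open_measurable_gt.
(* The closed half-space a + 1/(n+1) <= <w, y>, written as the complement of an open half-space for
   -w so that [inner_open_gt] applies. *)
pose K n : set BV := ~` [set y | - (a + n.+1%:R^-1) < inner (- w) y].
have mK n : measurable (K n) by apply: measurableC; exact: inner_open_measurable_gt.
have KE n y : K n y <-> a + n.+1%:R^-1 <= inner w y.
  rewrite /K /= innerNl ltrN2.
  by split => [/negP|]; [rewrite -leNgt|rewrite leNgt => /negP].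
have capE : \bigcap_n (U `\` K n) = set0.
  apply/seteqP; split => // y H; have [/= ay _] := H 0%N I.
  have d0 : 0 < inner w y - a by rewrite subr_gt0.
  have [n nP] : exists n : nat, n.+1%:R^-1 < inner w y - a.
    have [n _ nP] := near_infty_natSinv_lt (PosNum d0).
    by exists n; apply: nP => /=.
  have [_] := H n I; apply; apply/KE; rewrite addrC -lerBrDr ltW//.
have cv : (mu \o (fun n => U `\` K n)) @ \oo --> mu set0.
  rewrite -capE; apply: nonincreasing_cvg_mu.
  - by apply: mu_fin; apply: measurableD => //; exact: mU.
  - by move=> n; apply: measurableD => //; exact: mU.
  - by rewrite capE.
  - move=> m n mn; apply/subsetPset; apply: setDS => y /KE h; apply/KE.
    by apply: le_trans h; rewrite lerD2l lef_pV2 ?posrE// ler_nat.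
have e0' : (mu set0 < e%:E)%E by rewrite measure0 lte_fin.
have [n _ nP] := cv _ (open_nbhs_nbhs (conj (@open_ereal_lt_ereal _ _) e0')).
exists (K n), U; split.
- by split => //; exact: mU.
- by rewrite /K setCK; exact: inner_open_gt.
- exact: inner_open_gt.
- split => // y /KE h /=; apply: lt_le_trans h.
  by rewrite ltrDl invr_gt0.
- exact: nP (leqnn _).
Qed.

(** Two inductions on generated sigma-algebras: Borel sets of tuples are generated by preimages
    under coordinates, and Borel sets of the line by open rays, whose preimages are the half-spaces
    of [regular_set_gt]. *)
Lemma measurable_regular (A : set BV) : measurable A -> regular_set A.
Proof.
move=> mA.
pose P (B : set ((dim V).-tuple (measurableTypeR R))) :=
  regular_set ([set y | B (to_coord y)] : set BV).
suff : P (@borel_of_coord R V @^-1` A).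
  rewrite /P; congr regular_set; apply/seteqP; split => y /=;
  by rewrite /borel_of_coord to_coordK.
have regC (I : Type) (h : BV -> I) : sigma_algebra setT
    [set B : set I | regular_set ([set y | B (h y)] : set BV)].
  split.
  - move=> e e0; exists set0, set0.
    split; [by split|by rewrite setC0 => y _; exists 1|by move=> y []|by split|].
    by rewrite setD0 measure0 lte_fin.
  - move=> B /= rB; rewrite (_ : [set y | _] = ~` [set y | B (h y)]).
      exact: regular_setC.
    by apply/seteqP; split => y /=; [case|].
  - by move=> B rB /=; exact: (regular_set_bigcup (A := fun n => [set y | B n (h y)])).
have : measurable (@borel_of_coord R V @^-1` A) by [].
rewrite {1}/measurable /=.
apply: smallest_sub; first exact: (regC _ (@to_coord R V)).
move=> B; rewrite -bigcup_seq => -[i _ [Y mY <-]].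
rewrite setTI /P /=.
pose Q (Y : set R) := regular_set ([set y | Y (tnth (to_coord y) i)] : set BV).
suff : Q Y by [].
have {mY} : (@RGenOInfty.G R).-sigma.-measurable Y.
  by rewrite -(RGenOInfty.measurableE R).
move: Y; apply: smallest_sub; first exact: (regC _ (fun y => tnth (to_coord y) i)).
move=> _ [a ->]; rewrite /Q /=.
have := @regular_set_gt (tnth (onb V) i) a.
congr regular_set; apply/seteqP; split => y /=;
  by rewrite in_itv/= andbT tnth_mktuple innerC.
Qed.

Lemma inner_regular (A : set BV) (e : R) : measurable A -> 0 < e ->
  exists K : set BV, [/\ measurable K, inner_open (~` K), K `<=` A,
    exists rho : R, forall y, K y -> inner y y <= rho &
    (mu (A `\` K) < e%:E)%E].
Proof.
move=> mA e0; have e20 : 0 < e / 2 by rewrite divr_gt0.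
have [K [U [[mK mU] oK oU [KA AU] UK]]] := measurable_regular mA e20.
pose B n : set BV := [set y | inner y y <= n%:R].
have mB n : measurable (B n).
  have := @measurable_sqdist R V 0 measurableT `]-oo, n%:R]%classic (measurable_itv _).
  rewrite setTI; congr measurable; apply/seteqP; split => y /=;
  by rewrite in_itv/= sub0r innerNl innerNr opprK.
have capE : \bigcap_n (~` B n) = set0.
  apply/seteqP; split => // y H.
  have [n _ nP] := nbhs_infty_ger (inner y y).
  by have := H n I; apply; apply: nP => /=.
have cv : (mu \o (fun n => ~` B n)) @ \oo --> mu set0.
  rewrite -capE; apply: nonincreasing_cvg_mu.
  - by apply: mu_fin; apply: measurableC; exact: mB.
  - by move=> n; apply: measurableC; exact: mB.
  - by rewrite capE.
  - move=> m n mn; apply/subsetPset; apply: subsetC => y /= h.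
    by apply: le_trans h _; rewrite ler_nat.
have e0' : (mu set0 < (e / 2)%:E)%E by rewrite measure0 lte_fin.
have [n _ nP] := cv _ (open_nbhs_nbhs (conj (@open_ereal_lt_ereal _ _) e0')).
exists (K `&` B n); split.
- exact: measurableI.
- rewrite setCI => y [/oK[r r0 rK]|nB].
    by exists r => // z /rK; left.
  (* A point z outside the closed ball lies in the open half-space <z, x> > sqrt(n) |z|, which
     misses the ball by Cauchy-Schwarz. *)
  have oB : inner_open (~` B n).
    move=> z /= /negP; rewrite -ltNge => nz.
    have Nz : 0 < inner z z by apply: le_lt_trans nz.
    have hz : Num.sqrt (n%:R * inner z z) < inner z z.
      have : Num.sqrt (n%:R * inner z z) < Num.sqrt (inner z z ^+ 2).
        by rewrite ltr_sqrt ?exprn_gt0// expr2 ltr_pM2r.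
      by rewrite sqrtr_sqr ger0_norm ?inner_ge0.
    have [r r0 rP] := inner_open_gt hz.
    exists r => // x /rP /= zx /=; apply/negP; rewrite -ltNge.
    have := CauchySchwarz_inner z x.
    have n0 : 0 <= n%:R * inner z z by rewrite mulr_ge0// ltW.
    have : Num.sqrt (n%:R * inner z z) ^+ 2 < inner z x ^+ 2.
      by rewrite ltr_sqr ?nnegrE ?sqrtr_ge0// (le_trans (sqrtr_ge0 _) (ltW zx)).
    rewrite sqr_sqrtr// => h1 h2.
    by rewrite -(ltr_pM2r Nz) (lt_le_trans h1)// mulrC.
  have [r r0 rP] := oB _ nB; exists r => // z /rP; by right.
- by move=> y [/KA].
- by exists n%:R => y [].
- apply: (@le_lt_trans _ _ (mu (U `\` K `|` ~` B n))).
    rewrite le_measure ?inE//.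
    + by apply: measurableD => //; exact: measurableI.
    + by apply: measurableU; [exact: measurableD|exact: measurableC].
    + move=> y [/AU Uy nKB]; have [Ky|nKy] := pselect (K y); last by left.
      by right => By; exact: nKB.
  apply: (le_lt_trans (measureU2 _ _ _)).
  + exact: measurableD.
  + exact: measurableC.
  rewrite [e]splitr EFinD lteD//.
  exact: nP (leqnn _).
Qed.

End Regularity.

Import HBNNSimple.

(* [f] need not be measurable: the integral of a nonnegative function is a
   supremum over the simple functions below it. *)
Lemma ge0_ae_eq_integral_l d (T : measurableType d) (R : realType)
    (mu : {measure set T -> \bar R}) (f g : T -> \bar R) :
  measurable_fun setT g -> (forall x, 0 <= f x)%E -> (forall x, 0 <= g x)%E ->
  {ae mu, forall x, f x = g x} ->
  (\int[mu]_x f x = \int[mu]_x g x)%E.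
Proof.
move=> mg f0 g0 [N [mN N0 fgN]].
have fg x : ~ N x -> f x = g x by move=> nN; apply: contrapT => /fgN.
apply/eqP; rewrite eq_le; apply/andP; split.
- rewrite [leLHS]ge0_integralTE//; apply: ge_ereal_sup => _ [s /= sf <-].
  rewrite -integralT_nnsfun.
  rewrite (ge0_negligible_integral mN)//.
  rewrite [leRHS](ge0_negligible_integral mN)//.
  apply: ge0_le_integral => //.
  + exact: measurableD.
  + by move=> x _; rewrite lee_fin fun_ge0.
  + exact/measurable_funTS/measurable_EFinP.
  + exact: measurable_funTS.
  + by move=> x [_ /fg <-]; exact: sf.
  + exact/measurable_EFinP.
  + by move=> x _; rewrite lee_fin fun_ge0.
- rewrite [leRHS]ge0_integralTE// (ge0_negligible_integral mN)//.
  rewrite integral_mkcond ge0_integralTE; last first.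
    by move=> x; rewrite /patch; case: ifP.
  apply: le_ereal_sup => _ [s /= sf <-].
  exists s => //= x; apply: le_trans (sf x) _; rewrite /patch.
  case: ifPn => [|_]; last exact: f0.
  by rewrite inE => -[_ /fg <-].
Qed.

(** * The heat flow on bounded Borel functions *)

Section HeatFunctional.
Context {R : realType} {V : euclidean R}.
Implicit Types (x y z w : V) (t : R) (a b : V -> R).
Local Notation BV := (euclidean_borel V).

Definition bounded_borel a :=
  measurable_fun setT (a : BV -> R) /\ exists C, forall y, `|a y| <= C.

Lemma bounded_borel_cst (c : R) : bounded_borel (fun=> c).
Proof. by split => //; exists `|c|. Qed.

Lemma bounded_borelD a b :
  bounded_borel a -> bounded_borel b -> bounded_borel (fun y => a y + b y).
Proof.
move=> [ma [C aC]] [mb [D bD]]; split; first exact: measurable_funD.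
by exists (C + D) => y; apply: le_trans (ler_normD _ _) _; rewrite lerD.
Qed.

Lemma bounded_borelM a b :
  bounded_borel a -> bounded_borel b -> bounded_borel (fun y => a y * b y).
Proof.
move=> [ma [C aC]] [mb [D bD]]; split; first exact: measurable_funM.
by exists (C * D) => y; rewrite normrM ler_pM.
Qed.

Lemma bounded_borelZ (c : R) a : bounded_borel a -> bounded_borel (fun y => c * a y).
Proof. by apply: bounded_borelM; exact: bounded_borel_cst. Qed.

Lemma bounded_borel_sum (I : Type) (s : seq I) (F : I -> V -> R) :
  (forall i, bounded_borel (F i)) -> bounded_borel (fun y => \sum_(i <- s) F i y).
Proof.
move=> bF; elim: s => [|i s IH].
  by under eq_fun do rewrite big_nil; exact: bounded_borel_cst.
by under eq_fun do rewrite big_cons; exact: bounded_borelD.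
Qed.

Lemma bounded_borel_norm a : bounded_borel a -> bounded_borel (fun y => `|a y|).
Proof.
move=> [ma [C aC]]; split; first exact: measurableT_comp.
by exists C => y; rewrite normr_id.
Qed.

Lemma bounded_borel_indic (A : set BV) : measurable A -> bounded_borel (\1_A : V -> R).
Proof.
move=> mA; split; first exact: measurable_indic.
by exists 1 => y; rewrite indicE; case: (_ \in _); rewrite ?normr1 ?normr0.
Qed.

Lemma heat_integrable t x a : 0 < t -> bounded_borel a ->
  (euclidean_lebesgue V).-integrable setT
    (EFin \o (fun y => a y * heat_kernel t (x - y))).
Proof.
move=> t0 [ma [C aC]].
have ik : (euclidean_lebesgue V).-integrable setT
    (fun y => (C%:E * (heat_kernel t (x - y))%:E)%E).
  apply: integrableZl => //; apply/integrableP; split.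
    by apply/measurable_EFinP; exact: measurable_heat_kernel.
  under eq_integral do rewrite /= ger0_norm ?heat_kernel_ge0//.
  by rewrite integral_heat_kernel// ltry.
apply: le_integrable ik => //.
  by apply/measurable_EFinP; apply: measurable_funM => //; exact: measurable_heat_kernel.
move=> y _; rewrite lee_fin !normrM ler_wpM2r//.
by apply: le_trans (aC y) _; exact: ler_norm.
Qed.

Lemma heat_flow_cst t x (c : R) : 0 < t -> heat_flow t (fun=> c) x = c.
Proof.
move=> t0; rewrite /heat_flow RintegralZl//; last first.
  have := heat_integrable x t0 (bounded_borel_cst 1).
  by under eq_fun do rewrite mul1r.
by rewrite -[RHS]mulr1 /Rintegral (integral_heat_kernel x t0).
Qed.

Lemma heat_flowD t x a b : 0 < t -> bounded_borel a -> bounded_borel b ->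
  heat_flow t (fun y => a y + b y) x = heat_flow t a x + heat_flow t b x.
Proof.
move=> t0 ba bb; rewrite /heat_flow -RintegralD//; last 2 first.
- exact: heat_integrable.
- exact: heat_integrable.
by apply: eq_Rintegral => y _; rewrite mulrDl.
Qed.

Lemma heat_flowZ t x (c : R) a : 0 < t -> bounded_borel a ->
  heat_flow t (fun y => c * a y) x = c * heat_flow t a x.
Proof.
move=> t0 ba; rewrite /heat_flow -RintegralZl//; last exact: heat_integrable.
by apply: eq_Rintegral => y _; rewrite -mulrA.
Qed.

Lemma heat_flow_sum (I : Type) (s : seq I) (F : I -> V -> R) t x :
  0 < t -> (forall i, bounded_borel (F i)) ->
  heat_flow t (fun y => \sum_(i <- s) F i y) x = \sum_(i <- s) heat_flow t (F i) x.
Proof.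
move=> t0 bF; elim: s => [|i s IH].
  by under eq_fun do rewrite big_nil; rewrite heat_flow_cst// big_nil.
under eq_fun do rewrite big_cons.
by rewrite heat_flowD// ?IH ?big_cons//; exact: bounded_borel_sum.
Qed.

Lemma heat_flow_le t x a b : 0 < t -> bounded_borel a -> bounded_borel b ->
  (forall y, a y <= b y) -> heat_flow t a x <= heat_flow t b x.
Proof.
move=> t0 ba bb ab; apply: le_Rintegral => //; try exact: heat_integrable.
by move=> y _; rewrite ler_wpM2r ?heat_kernel_ge0.
Qed.

Lemma heat_flow_ge0 t x a : (forall y, 0 <= a y) -> 0 <= heat_flow t a x.
Proof.
move=> a0; apply: Rintegral_ge0 => y _.
by rewrite mulr_ge0 ?heat_kernel_ge0.
Qed.

Lemma heat_flow_norm t x a : 0 < t -> bounded_borel a ->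
  `|heat_flow t a x| <= heat_flow t (fun y => `|a y|) x.
Proof.
move=> t0 ba; rewrite ler_norml; apply/andP; split.
  rewrite -mulN1r -heat_flowZ//; last exact: bounded_borel_norm.
  apply: heat_flow_le => //; first exact/bounded_borelZ/bounded_borel_norm.
  by move=> y; rewrite mulN1r lerNl -normrN ler_norm.
apply: heat_flow_le => //; first exact: bounded_borel_norm.
by move=> y; exact: ler_norm.
Qed.

Lemma heat_flow_ae t x (f h : V -> R) : (forall y, 0 <= f y) ->
  (forall y, 0 <= h y) -> measurable_fun setT (h : BV -> R) ->
  {ae euclidean_lebesgue V, forall y, f y = h y} ->
  heat_flow t f x = heat_flow t h x.
Proof.
move=> f0 h0 mh fh; congr fine; apply: ge0_ae_eq_integral_l.
- apply/measurable_EFinP; apply: measurable_funM => //.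
  exact: measurable_heat_kernel.
- by move=> y; rewrite lee_fin mulr_ge0 ?heat_kernel_ge0.
- by move=> y; rewrite lee_fin mulr_ge0 ?heat_kernel_ge0.
- have [N [mN N0 fhN]] := fh; exists N; split => // y nfh; apply: fhN => /= fhy.
  by apply: nfh; rewrite /= fhy.
Qed.

Section HeatMeasure.
Variables (t : R) (x : V).

(** For t > 0 this measure has mass 1, so inner regularity applies to it; its value on a set is the
    heat flow of the indicator at x, hence approximation errors are measured directly in the
    required quantity. *)
Definition heat_measure (A : set BV) : \bar R :=
  (\int[euclidean_lebesgue V]_(y in A) (heat_kernel t (x - y))%:E)%E.

Let heat_measure0 : heat_measure set0 = 0%E.
Proof. by rewrite /heat_measure integral_set0. Qed.

Let heat_measure_ge0 A : (0 <= heat_measure A)%E.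
Proof. by apply: integral_ge0 => y _; rewrite lee_fin heat_kernel_ge0. Qed.

Let heat_measure_sigma_additive : semi_sigma_additive heat_measure.
Proof.
move=> A mA tA mUA; rewrite /heat_measure ge0_integral_bigcup//.
- by apply: is_cvg_ereal_nneg_natsum_cond => n _ _; exact: heat_measure_ge0.
- apply: measurable_funTS; apply/measurable_EFinP.
  exact: measurable_heat_kernel.
- by move=> y _; rewrite lee_fin heat_kernel_ge0.
Qed.

HB.instance Definition _ := isMeasure.Build _ _ _ heat_measure
  heat_measure0 heat_measure_ge0 heat_measure_sigma_additive.

Lemma heat_flow_indic (A : set BV) : measurable A ->
  heat_flow t (\1_A) x = fine (heat_measure A).
Proof.
move=> mA; rewrite /heat_flow /heat_measure; congr fine.
rewrite [RHS]integral_mkcond; apply: eq_integral => y _.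
by rewrite /patch indicE; case: (y \in A); rewrite ?mul1r ?mul0r.
Qed.

End HeatMeasure.

End HeatFunctional.

(** * Semicontinuous approximation *)

Section Semicontinuous.
Context {R : realType} {V : euclidean R}.
Implicit Types (x y z w : V) (t : R) (a b : V -> R).
Local Notation BV := (euclidean_borel V).

Definition inner_usc a := forall y (e : R), 0 < e ->
  exists2 r : R, 0 < r & forall z, inner (z - y) (z - y) < r -> a z <= a y + e.

Lemma inner_usc_cst (c : R) : inner_usc (fun=> c).
Proof. by move=> y e e0; exists 1 => // z _; rewrite lerDl ltW. Qed.

Lemma inner_uscD a b : inner_usc a -> inner_usc b -> inner_usc (fun y => a y + b y).
Proof.
move=> ua ub y e e0; have e20 : 0 < e / 2 by rewrite divr_gt0.
have [r r0 rP] := ua y _ e20; have [s s0 sP] := ub y _ e20.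
exists (Num.min r s); first by rewrite lt_min r0.
move=> z; rewrite lt_min => /andP[/rP za /sP zb].
by rewrite [e]splitr addrACA lerD.
Qed.

Lemma inner_uscZ (c : R) a : 0 <= c -> inner_usc a -> inner_usc (fun y => c * a y).
Proof.
move=> c0 ua y e e0; have c1 : 0 < c + 1 by rewrite ltr_wpDl.
have ec0 : 0 < e / (c + 1) by rewrite divr_gt0.
have [r r0 rP] := ua y _ ec0; exists r => // z /rP za.
apply: (le_trans (ler_wpM2l c0 za)); rewrite mulrDr lerD2l mulrA ler_pdivrMr//.
by rewrite mulrDr mulr1 [e * c]mulrC lerDl ltW.
Qed.

Lemma inner_usc_sum (I : eqType) (s : seq I) (F : I -> V -> R) :
  (forall i, i \in s -> inner_usc (F i)) -> inner_usc (fun y => \sum_(i <- s) F i y).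
Proof.
elim: s => [|i s IH] uF.
  by under eq_fun do rewrite big_nil; exact: inner_usc_cst.
under eq_fun do rewrite big_cons; apply: inner_uscD.
  by apply: uF; rewrite mem_head.
by apply: IH => j js; apply: uF; rewrite inE js orbT.
Qed.

Lemma inner_usc_indic (K : set V) : inner_open (~` K) -> inner_usc (\1_K : V -> R).
Proof.
move=> oK y e e0; have [Ky|nKy] := pselect (K y).
  exists 1 => // z _; rewrite !indicE (mem_set Ky).
  by rewrite (le_trans (y := 1)) ?lern1 ?leq_b1// lerDl ltW.
have [r r0 rK] := oK y nKy; exists r => // z /rK nKz.
by rewrite !indicE !memNset// lerDl ltW.
Qed.

(** The Gaussian is bounded by its value at 0, so integrability of [h] passes to the product with
    the kernel. As f >= 0, replacing h by |h| keeps the almost everywhere equality. *)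
Lemma lebesgue_integrable_heat t x (f : V -> R) :
  0 < t -> (forall y, 0 <= f y) -> lebesgue_integrable f ->
  exists h : BV -> R, [/\ measurable_fun setT h, forall y, 0 <= h y,
    (euclidean_lebesgue V).-integrable setT
      (EFin \o (fun y => h y * heat_kernel t (x - y))) &
    {ae euclidean_lebesgue V, forall y, f y = h y}].
Proof.
move=> t0 f0 [h ih [N [mN N0 fhN]]].
have mh : measurable_fun setT h by apply/measurable_EFinP; case/integrableP: ih.
exists (fun y => `|h y|); split => //; first exact: measurableT_comp.
- pose C := (4 * pi * t) `^ (- (dim V)%:R / 2).
  have kC z : heat_kernel t z <= C.
    rewrite ler_piMr ?powR_ge0// -expR0 ler_expR mulNr oppr_le0.
    by rewrite divr_ge0 ?inner_ge0// mulr_ge0// ltW.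
  apply: le_integrable (integrableZl measurableT C ih) => //.
    apply/measurable_EFinP; apply: measurable_funM => //.
      exact: measurableT_comp.
    exact: measurable_heat_kernel.
  move=> y _; rewrite /= lee_fin [leLHS]normrM [leRHS](normrM C) mulrC normr_id.
  rewrite ler_wpM2r// [leLHS]ger0_norm ?heat_kernel_ge0// (le_trans (kC _))//.
  exact: ler_norm.
- exists N; split => // y fy; apply: fhN => /= fh; apply: fy.
  by rewrite /= -fh ger0_norm.
Qed.

(** A simple function below [f] has nearly the same heat flow; each of its level sets is then shrunk
    to a bounded closed subset of almost full [heat_measure]. A combination of indicators of closed
    sets with nonnegative coefficients is upper semicontinuous. *)
Lemma heat_flow_inner_approx t x (f : V -> R) (h : BV -> R) (e : R) :
  0 < t -> (forall y, 0 <= f y) -> measurable_fun setT h ->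
  (euclidean_lebesgue V).-integrable setT
    (EFin \o (fun y => h y * heat_kernel t (x - y))) ->
  {ae euclidean_lebesgue V, forall y, f y = h y} -> 0 < e ->
  exists q : V -> R, [/\ bounded_borel q, inner_usc q,
    forall y, 0 <= q y <= f y,
    exists rho : R, forall y, rho < inner y y -> q y = 0 &
    heat_flow t f x <= heat_flow t q x + e].
Proof.
move=> t0 f0 mh ih fh e0; have [N [mN N0 fhN]] := fh.
have e20 : 0 < e / 2 by rewrite divr_gt0.
have fhE y : ~ N y -> f y = h y by move=> nN; apply: contrapT => /fhN.
(* Setting the Borel representative to 0 on the exceptional set puts it below [f] at every point, as
   needed for q <= f everywhere. *)
pose h' y := h y * \1_(~` N) y.
have mh' : measurable_fun setT (h' : BV -> R).
  by apply: measurable_funM => //; apply: measurable_indic; exact: measurableC.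
have h'E y : h' y = if pselect (N y) then 0 else f y.
  rewrite /h' indicE; case: pselect => [Ny|nN].
    by rewrite memNset ?mulr0//; apply.
  by rewrite mem_set// mulr1 fhE.
have h'0 y : 0 <= h' y by rewrite h'E; case: pselect => //=.
have h'f y : h' y <= f y by rewrite h'E; case: pselect => //=.
have fh' : heat_flow t f x = heat_flow t h' x.
  apply: heat_flow_ae => //; exists N; split => // y /= fy.
  by apply: contrapT => nN; apply: fy; rewrite /= h'E; case: pselect => //=.
have ih' : (euclidean_lebesgue V).-integrable setT
    (fun y => (h' y * heat_kernel t (x - y))%:E).
  apply: le_integrable ih => //.
    apply/measurable_EFinP; apply: measurable_funM => //.
    exact: measurable_heat_kernel.
  move=> y _; rewrite /= lee_fin [leLHS]normrM [leRHS]normrM ler_wpM2r//.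
  rewrite /h' normrM ler_piMr// indicE; case: (_ \in _);
  by rewrite ?normr0 ?normr1.
pose s n := nnsfun_approx measurableT ((measurable_EFinP _ _).2 mh') n.
have sh' n y : s n y <= h' y.
  rewrite -lee_fin /s nnsfun_approxE.
  by apply: le_approx => // z _; rewrite /= lee_fin.
have cvI : (fun n => \int[euclidean_lebesgue V]_y
      ((s n y * heat_kernel t (x - y))%:E))%E @ \oo -->
    (\int[euclidean_lebesgue V]_y ((h' y * heat_kernel t (x - y))%:E))%E.
  rewrite (_ : (\int[euclidean_lebesgue V]_y ((h' y * heat_kernel t (x - y))%:E))%E = (\int[euclidean_lebesgue V]_y
      (limn (fun n => (s n y * heat_kernel t (x - y))%:E)))%E); last first.
    apply: eq_integral => y _; apply/esym/cvg_lim => //.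
    rewrite mulrC EFinM; under eq_fun do rewrite mulrC EFinM.
    apply: cvgeZl => //; apply: cvg_nnsfun_approx => //.
    by move=> z _; rewrite /= lee_fin.
  apply: cvg_monotone_convergence => //.
  - move=> n; apply/measurable_EFinP; apply: measurable_funM => //.
    exact: measurable_heat_kernel.
  - by move=> n y _; rewrite lee_fin mulr_ge0 ?heat_kernel_ge0.
  - move=> y _ m n mn; rewrite lee_fin ler_wpM2r ?heat_kernel_ge0//.
    exact/lefP/nd_nnsfun_approx.
have Ifin : (\int[euclidean_lebesgue V]_y
    ((h' y * heat_kernel t (x - y))%:E))%E \is a fin_num.
  exact: integrable_fin_num.
have lt_lim : ((\int[euclidean_lebesgue V]_y
    ((h' y * heat_kernel t (x - y))%:E)) - (e / 2)%:E <
    \int[euclidean_lebesgue V]_y ((h' y * heat_kernel t (x - y))%:E))%E.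
  by rewrite lteBlDr// lteDl// lte_fin.
have [n _ /(_ n (leqnn _)) nP] :=
  cvI _ (open_nbhs_nbhs (conj (@open_ereal_gt_ereal _ _) lt_lim)).
move: nP => /= nP; move: (s n) (sh' n) nP => {s cvI sh'} s sh' nP.
pose S : seq R := finmap.enum_fset (fset_set (range s)).
have SP r : r \in S -> exists y, s y = r.
  rewrite -[r \in S]/(r \in fset_set (range s)) in_fset_set//.
  by rewrite inE => -[y _ <-]; exists y.
pose A r : set BV := s @^-1` [set r].
have mA r : measurable (A r) by exact: measurable_sfunP.
have sE y : s y = \sum_(r <- S) r * \1_(A r) y.
  by rewrite fimfunE fsbig_finite.
have bA r : bounded_borel (fun y => r * \1_(A r) y).
  by apply: bounded_borelZ; exact: bounded_borel_indic.
have bs : bounded_borel s.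
  by rewrite (_ : (s : V -> R) = fun y => \sum_(r <- S) r * \1_(A r) y);
    [exact: bounded_borel_sum|exact/funext].
have sPh : heat_flow t f x - e / 2 <= heat_flow t s x.
  rewrite fh' -lee_fin EFinB /heat_flow !fineK//; first exact: ltW.
  by apply: integrable_fin_num => //; exact: heat_integrable.
(* Shrinking the level set of r loses at most r d in the flow; this d makes the losses add up to at
   most e/2. *)
pose d := e / 2 / (1 + \sum_(r <- S) `|r|).
have S1 : 0 < 1 + \sum_(r <- S) `|r| by rewrite ltr_pwDl// sumr_ge0.
have d0 : 0 < d by rewrite divr_gt0.
have nuT : (heat_measure t x setT < +oo)%E.
  by rewrite /heat_measure integral_heat_kernel// ltry.
have /choice[K KP] r := inner_regular nuT (mA r) d0.
have mK r : measurable (K r) by have [] := KP r.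
have KA r : K r `<=` A r by have [] := KP r.
have oK r : inner_open (~` K r) by have [] := KP r.
have /choice[rho rhoP] : forall r, exists c : R, forall y, K r y -> inner y y <= c.
  by move=> r; have [] := KP r.
have nuK r : (heat_measure t x (A r `\` K r) < d%:E)%E by have [] := KP r.
have S0 r : r \in S -> 0 <= r by move=> /SP[y <-].
have bK r : bounded_borel (fun y => r * \1_(K r) y).
  by apply: bounded_borelZ; exact: bounded_borel_indic.
exists (fun y => \sum_(r <- S) r * \1_(K r) y); split.
- exact: bounded_borel_sum.
- apply: inner_usc_sum => r /S0 r0; apply: inner_uscZ => //.
  exact: inner_usc_indic.
- move=> y; apply/andP; split.
    by rewrite big_seq sumr_ge0// => r /S0 r0; rewrite mulr_ge0// indicE.
  rewrite (le_trans _ (h'f y))// (le_trans _ (sh' y))// sE.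
  rewrite big_seq [leRHS]big_seq; apply: ler_sum => r /S0 r0.
  rewrite ler_wpM2l// !indicE ler_nat.
  have [Ky|nKy] := pselect (K r y); last by rewrite (memNset nKy).
  by rewrite (mem_set (KA _ _ Ky)) leq_b1.
- exists (\sum_(r <- S) `|rho r|) => y ylt; rewrite big_seq big1// => r rS.
  rewrite indicE memNset ?mulr0// => /rhoP; apply/negP; rewrite -ltNge.
  apply: le_lt_trans ylt; apply: le_trans (ler_norm _) _.
  by rewrite (big_rem r)//= lerDl sumr_ge0.
- rewrite heat_flow_sum//.
  have -> : heat_flow t f x = heat_flow t f x - e / 2 + e / 2 by rewrite subrK.
  rewrite [in leRHS](splitr e) addrA lerD2r (le_trans sPh)//.
  have -> : heat_flow t s x = \sum_(r <- S) r * heat_flow t (\1_(A r)) x.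
    rewrite (_ : (s : V -> R) = fun y => \sum_(r <- S) r * \1_(A r) y); last exact/funext.
    rewrite heat_flow_sum//; apply: eq_bigr => r _; rewrite heat_flowZ//.
    exact: bounded_borel_indic.
  apply: (@le_trans _ _ (\sum_(r <- S) (heat_flow t (fun y => r * \1_(K r) y) x + `|r| * d))).
    rewrite big_seq [leRHS]big_seq; apply: ler_sum => r /S0 r0.
    rewrite heat_flowZ//; last exact: bounded_borel_indic.
    rewrite ger0_norm// -mulrDr ler_wpM2l//.
    have mAK : measurable (A r `\` K r) by exact: measurableD.
    have -> : \1_(A r) = (fun y : V => (\1_(K r) y : R) + \1_(A r `\` K r) y).
      apply/funext => y; rewrite !indicE.
      have [Ky|nKy] := pselect (K r y).
        rewrite (mem_set Ky) (mem_set (KA _ _ Ky)) memNset ?addr0//.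
        by move=> [].
      rewrite (memNset nKy) add0r; have [Ay|nAy] := pselect (A r y).
        by rewrite !mem_set.
      by rewrite !memNset// => -[].
    rewrite heat_flowD//; [|exact: bounded_borel_indic..].
    rewrite lerD2l heat_flow_indic// -lee_fin fineK; first exact: ltW.
    rewrite ge0_fin_numE//; exact: lt_trans (nuK r) (ltry _).
  rewrite big_split/= lerD2l -mulr_suml.
  rewrite /d mulrCA -[leRHS]mulr1 ler_wpM2l ?(ltW e20)//.
  by rewrite ler_pdivrMr// mul1r lerDr.
Qed.

(* The witness is [M 1_B] minus an inner approximation of [(M - min(g, M)) 1_B],
   where [B] is the ball of squared radius [rho]. *)
Lemma heat_flow_outer_approx t x (g : V -> R) (M rho e : R) :
  0 < t -> (forall y, 0 <= g y) -> lebesgue_integrable g -> 0 <= M -> 0 < e ->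
  exists q : V -> R, [/\ bounded_borel q, inner_usc (fun y => - q y),
    forall y, 0 <= q y <= M,
    (forall y, inner y y < rho -> Num.min (g y) M <= q y) /\
    (exists rho' : R, forall y, rho' < inner y y -> q y = 0) &
    heat_flow t q x <= heat_flow t g x + e].
Proof.
move=> t0 g0 /(lebesgue_integrable_heat x t0 g0)[h [mh h0 ih gh]] M0 e0.
pose B : set BV := [set y | inner y y < rho].
have mB : measurable B.
  have := @measurable_sqdist R V 0 measurableT `]-oo, rho[%classic (measurable_itv _).
  rewrite setTI; congr measurable; apply/seteqP; split => y /=;
  by rewrite in_itv/= sub0r innerNl innerNr opprK.
pose cap (u : V -> R) y := (M - Num.min (u y) M) * \1_B y.
have bcap : bounded_borel (cap h).
  split.
    apply: measurable_funM; last exact: measurable_indic.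
    by apply: measurable_funB => //; exact: measurable_minr.
  exists M => y; rewrite /cap indicE; case: (_ \in _); last by rewrite mulr0 normr0.
  have := h0 y; rewrite mulr1 ger0_norm.
    by rewrite /Num.min; case: ifP; lra.
  by rewrite subr_ge0 ge_min lexx orbT.
have cap0 y : 0 <= cap g y.
  by rewrite mulr_ge0 ?indicE// subr_ge0 ge_min lexx orbT.
have capM y : cap g y <= M * \1_B y.
  rewrite ler_wpM2r ?indicE// gerBl le_min; apply/andP; split => //.
have capE : {ae euclidean_lebesgue V, forall y, cap g y = cap h y}.
  have [N [mN N0 fhN]] := gh; exists N; split => // y fy; apply: fhN => /= fh.
  by apply: fy; rewrite /= /cap fh.
have [q [bq uq q0 _ qe]] := heat_flow_inner_approx t0 cap0 bcap.1
  (heat_integrable x t0 bcap) capE e0.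
have bB : bounded_borel (\1_B : V -> R) by exact: bounded_borel_indic.
exists (fun y => M * \1_B y + -1 * q y); split.
- by apply: bounded_borelD; exact: bounded_borelZ.
(* The ball is open, so the indicator of its complement is upper semicontinuous, and - M 1_B is M
   times that indicator minus M. *)
- rewrite (_ : (fun y => _) = fun y => q y + (M * \1_(~` B) y + - M)).
    apply: inner_uscD => //; apply: inner_uscD; last exact: inner_usc_cst.
    apply: inner_uscZ => //; apply: inner_usc_indic; rewrite setCK.
    exact: inner_open_ball.
  by apply/funext => y; rewrite indicC !indicE; case: (y \in B) => /=; ring.
- move=> y; have /andP[q0y qy] := q0 y; have := capM y.
  have : M * \1_B y <= M by rewrite ler_piMr// indicE; case: (_ \in _).
  by move=> h1 h2; apply/andP; split; lra.
- split => [y yB|]; last first.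
    exists rho => y yrho; have nB : ~ B y by move=> /= /lt_trans/(_ yrho); rewrite ltxx.
    have /andP[q0y qy] := q0 y.
    have : cap g y = 0 by rewrite /cap indicE memNset// mulr0.
    by rewrite indicE memNset// mulr0; lra.
  have /andP[q0y qy] := q0 y; move: qy.
  by rewrite /cap !indicE !mem_set//= !mulr1; lra.
- rewrite heat_flowD//; [|exact: bounded_borelZ..].
  rewrite [X in _ + X]heat_flowZ//.
  have -> : heat_flow t g x = heat_flow t h x by exact: heat_flow_ae.
  rewrite (heat_flow_ae t x cap0 _ _ capE) in qe; last exact: bcap.1.
  (* M 1_B is [cap h] plus min(h, M) 1_B, and the flow of the last term is at most that of [h]; the
     gap between [cap] and its inner approximation costs at most e. *)
  + pose hB y := Num.min (h y) M * \1_B y.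
    have bhB : bounded_borel hB.
      split.
        apply: measurable_funM; last exact: measurable_indic.
        exact: measurable_minr.
      exists M => y; rewrite /hB indicE; case: (_ \in _); last by rewrite mulr0 normr0.
      rewrite mulr1 ger0_norm; first by rewrite ge_min lexx orbT.
      by rewrite le_min h0 M0.
    have -> : (fun y => M * \1_B y) = fun y => cap h y + hB y.
      by apply/funext => y; rewrite /cap /hB; ring.
    rewrite heat_flowD//.
    have : heat_flow t hB x <= heat_flow t h x.
      apply: le_Rintegral => //; first exact: heat_integrable.
      move=> y _; rewrite ler_wpM2r ?heat_kernel_ge0// /hB indicE.
      case: (_ \in _); last by rewrite mulr0.
      by rewrite mulr1 ge_min lexx.
    lra.
  + move=> y; rewrite mulr_ge0 ?indicE// subr_ge0 ge_min lexx orbT //.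
Qed.

End Semicontinuous.

(** * Gaussian tails: the heat flow near time 0 and near infinity *)

Section HeatEstimates.
Context {R : realType} {V : euclidean R}.
Implicit Types (x y z w : V) (t : R) (a b q : V -> R).
Local Notation BV := (euclidean_borel V).

Lemma eq_heat_flow t t' x x' a a' :
  (forall y, a y * heat_kernel t (x - y) = a' y * heat_kernel t' (x' - y)) ->
  heat_flow t a x = heat_flow t' a' x'.
Proof. by move=> E; congr fine; apply: eq_integral => y _; congr EFin; exact: E. Qed.

Lemma heat_kernelE t z : 0 < t ->
  heat_kernel t z = expR (- (dim V)%:R / 2 * ln (4 * pi * t) - inner z z / (4 * t)).
Proof.
move=> t0; rewrite /heat_kernel /powR gt_eqF ?mulr_gt0 ?pi_gt0//.
by rewrite -expRD (mulNr (inner z z)).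
Qed.

Lemma inner_parallelogram_le x y : inner (x + y) (x + y) <= 2 * inner x x + 2 * inner y y.
Proof.
have := inner_ge0 (x - y).
rewrite !(innerDl, innerDr, innerNl, innerNr) (innerC y x); lra.
Qed.

Lemma measurable_far x (r : R) : measurable ([set y | r <= inner (x - y) (x - y)] : set BV).
Proof.
have := @measurable_sqdist R V x measurableT `[r, +oo[%classic (measurable_itv _).
rewrite setTI; congr measurable; apply/seteqP; split => y /=;
by rewrite in_itv/= andbT.
Qed.

(* [k_t z = 2^(n/2) exp(- |z|^2 / 8t) k_{2t} z]. *)
Lemma heat_tail t x (r : R) : 0 < t -> 0 < r ->
  heat_flow t (\1_[set y | r <= inner (x - y) (x - y)]) x <=
  expR ((dim V)%:R / 2 * ln 2) * (8 * t / r).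
Proof.
move=> t0 r0; set F := [set y | _]; set D := expR _.
have mF : measurable (F : set BV) by exact: measurable_far.
pose b y := D * expR (- inner (x - y) (x - y) / (8 * t)) * \1_F y.
(* exp(-a) <= 1/a with a = |x - y|^2 / (8t) >= r / (8t). *)
have bu y : b y <= D * (8 * t / r).
  rewrite /b -mulrA ler_wpM2l ?expR_ge0// indicE.
  have t8 : 0 < 8 * t / r by rewrite divr_gt0// mulr_gt0.
  have [Fy|nFy] := pselect (F y); last by rewrite memNset// mulr0 ltW.
  rewrite mem_set// mulr1 mulNr expRN -[leRHS]invrK lef_pV2 ?posrE ?expR_gt0 ?invr_gt0//.
  rewrite invf_div (le_trans _ (expR_ge1Dx _))// -[leLHS]add0r lerD//.
  by rewrite ler_pM2r// invr_gt0 mulr_gt0.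
have bb : bounded_borel b.
  split.
    apply: measurable_funM; last exact: measurable_indic.
    apply: measurable_funM => //; apply: measurableT_comp => //.
    apply: measurable_funM => //; apply: measurableT_comp => //.
    exact: measurable_sqdist.
  exists (D * (8 * t / r)) => y; rewrite ger0_norm//.
  by rewrite mulr_ge0 ?mulr_ge0 ?expR_ge0 ?indicE.
have t20 : 0 < 2 * t by rewrite mulr_gt0.
rewrite (_ : heat_flow t _ x = heat_flow (2 * t) b x); last first.
  apply: eq_heat_flow => y; rewrite /b !heat_kernelE// [D * _ * _]mulrC -[RHS]mulrA; congr (_ * _).
  rewrite /D -!expRD; congr expR.
  have -> : 4 * pi * (2 * t) = 2 * (4 * pi * t) by ring.
  rewrite [in RHS]lnM ?posrE ?mulr_gt0 ?pi_gt0//.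
  by field; rewrite gt_eqF.
rewrite -[leRHS](heat_flow_cst x _ t20); apply: heat_flow_le => //.
exact: bounded_borel_cst.
Qed.

(** The integral formula need not return [q] at t = 0, so the initial value is prescribed there. *)
Definition heat_ext t q x := if t == 0 then q x else heat_flow t q x.

(** Near x0 the data are at most q x0 + e/2; the rest of the mass seen from x is a Gaussian tail of
    size O(t), multiplied by a bound on |q|. *)
Lemma heat_ext_usc0 q x0 (e : R) : bounded_borel q -> inner_usc q -> 0 < e ->
  exists2 d : R, 0 < d & forall t x, 0 <= t < d -> inner (x - x0) (x - x0) < d ->
    heat_ext t q x <= q x0 + e.
Proof.
move=> bq uq e0; have e20 : 0 < e / 2 by rewrite divr_gt0.
have [mq [C qC]] := bq; have [r r0 rP] := uq x0 _ e20.
have C0 : 0 <= C by apply: le_trans (qC x0).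
have r40 : 0 < r / 4 by rewrite divr_gt0.
pose D := expR ((dim V)%:R / 2 * ln 2) : R.
have D0 : 0 < D by exact: expR_gt0.
pose A := 2 * C * D * (8 / (r / 4)).
have A0 : 0 <= A by rewrite !mulr_ge0// ?(ltW D0)// invr_ge0 ltW.
(* Two displacements of squared length below r/4 add up to one below r; the second entry of the
   minimum makes the tail A t at most e/2. *)
exists (Num.min (r / 4) (e / 2 / (A + 1))).
  by rewrite lt_min r40 divr_gt0// ltr_wpDl.
move=> t x /andP[t0 +]; rewrite !lt_min => /andP[_ tA] /andP[xr _].
have qx0 y : inner (y - x0) (y - x0) < r -> q y <= q x0 + e / 2 by exact: rP.
rewrite /heat_ext; case: eqVneq => [_|tn0].
  by rewrite (le_trans (qx0 x _))//; [lra|rewrite lerD2l; lra].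
have {}t0 : 0 < t by rewrite lt_neqAle eq_sym tn0.
pose F : set BV := [set y | r / 4 <= inner (x - y) (x - y)].
have bF : bounded_borel (\1_F : V -> R).
  by apply: bounded_borel_indic; exact: measurable_far.
apply: (@le_trans _ _ (heat_flow t (fun y => (q x0 + e / 2) + 2 * C * \1_F y) x)).
  apply: heat_flow_le => //.
    by apply: bounded_borelD; [exact: bounded_borel_cst|exact: bounded_borelZ].
  move=> y; rewrite indicE; have [Fy|nFy] := pselect (F y).
    rewrite mem_set// mulr1; have := qC y; have := qC x0.
    by rewrite !ler_norml => /andP[? ?] /andP[? ?]; lra.
  rewrite memNset// mulr0 addr0; apply: qx0.
  have := inner_parallelogram_le (y - x) (x - x0); rewrite addrA subrK.
  have -> : inner (y - x) (y - x) = inner (x - y) (x - y).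
    by rewrite -opprB innerNl innerNr opprK.
  move: nFy => /negP; rewrite -ltNge => nFy.
  lra.
rewrite heat_flowD//; [|exact: bounded_borel_cst|exact: bounded_borelZ].
rewrite heat_flow_cst// heat_flowZ// [in leRHS](splitr e) addrA lerD2l.
apply: (@le_trans _ _ (2 * C * (D * (8 * t / (r / 4))))).
  by apply: ler_wpM2l; [rewrite mulr_ge0|exact: heat_tail].
have -> : 2 * C * (D * (8 * t / (r / 4))) = A * t by rewrite /A; ring.
move: tA; rewrite ltr_pdivlMr ?ltr_wpDl//; nra.
Qed.

Lemma heat_ext_decay q (rho T M e : R) : bounded_borel q -> 0 < T -> 0 < e ->
  (forall y, 0 <= q y <= M) -> (forall y, rho < inner y y -> q y = 0) ->
  exists s : R, forall t x, 0 <= t <= T -> s <= inner x x -> heat_ext t q x <= e.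
Proof.
move=> bq T0 e0 qM q0; pose D := expR ((dim V)%:R / 2 * ln 2) : R.
have D0 : 0 < D by exact: expR_gt0.
have M0 : 0 <= M by have /andP[+ +] := qM 0; exact: le_trans.
(* Chosen so that the tail bound M D 8T / r is at most e; a squared norm of at least 2r + 2 |rho|
   then keeps x at squared distance at least r from the support. *)
pose r := M * D * (8 * T) / e + 1.
have r0 : 0 < r by rewrite ltr_wpDl// divr_ge0 ?(ltW e0)// !mulr_ge0// ltW.
exists (2 * r + 2 * `|rho|) => t x /andP[t0 tT] sx; rewrite /heat_ext.
case: eqVneq => [_|tn0].
  rewrite q0 ?ltW//; have := ler_norm rho; have := normr_ge0 rho; lra.
have {}t0 : 0 < t by rewrite lt_neqAle eq_sym tn0.
pose F : set BV := [set y | r <= inner (x - y) (x - y)].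
have bF : bounded_borel (\1_F : V -> R).
  by apply: bounded_borel_indic; exact: measurable_far.
apply: (@le_trans _ _ (heat_flow t (fun y => M * \1_F y) x)).
  apply: heat_flow_le => //; first exact: bounded_borelZ.
  move=> y; have /andP[qy0 qyM] := qM y; rewrite indicE.
  have [Fy|nFy] := pselect (F y); first by rewrite mem_set// mulr1.
  rewrite memNset// mulr0 q0//.
  have := inner_parallelogram_le (x - y) y; rewrite subrK.
  move: nFy => /negP; rewrite -ltNge => nFy; have := ler_norm rho; lra.
rewrite heat_flowZ//; apply: (@le_trans _ _ (M * (D * (8 * t / r)))).
  by apply: ler_wpM2l => //; exact: heat_tail.
have -> : M * (D * (8 * t / r)) = M * D * 8 * t / r by ring.
rewrite ler_pdivrMr//.
have -> : e * r = M * D * (8 * T) + e by rewrite /r; field; rewrite gt_eqF.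
apply: (@le_trans _ _ (M * D * (8 * T))); last by rewrite lerDl ltW.
by rewrite -mulrA ler_wpM2l ?mulr_ge0 ?(ltW D0)// ler_wpM2l.
Qed.

End HeatEstimates.

(** * Second order expansions *)

Section TaylorBounds.
Context {R : realType}.
Implicit Types (u x : R).

(** One application of the mean value theorem raises the order of vanishing at 0 by one without
    enlarging the constant; iterated, it gives the Taylor remainders of exp and ln below. *)
Lemma derive_bound_pow (f df : R -> R) (n : nat) (C d x : R) :
  (forall u, `|u| <= d -> is_derive u (1 : R) f (df u)) ->
  (forall u, `|u| <= d -> `|df u| <= C * `|u| ^+ n) ->
  f 0 = 0 -> `|x| <= d -> `|f x| <= C * `|x| ^+ n.+1.
Proof.
move=> fd dfC f0 xd.
have cont a b : `|a| <= d -> `|b| <= d -> {within `[a, b], continuous f}.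
  move=> ad bd; apply: derivable_within_continuous => u; rewrite in_itv/= => /andP[au ub].
  have ud : `|u| <= d.
    move: ad bd; rewrite !ler_norml => /andP[? ?] /andP[? ?].
    by apply/andP; split; [exact: le_trans au|exact: le_trans ub _].
  by have [] := fd u ud.
have d0 : `|0 : R| <= d by rewrite normr0 (le_trans _ xd).
have key c : `|c| <= `|x| -> `|df c * x| <= C * `|x| ^+ n.+1.
  move=> cx; have cd := le_trans cx xd.
  have C0 : 0 <= C * `|c| ^+ n by apply: le_trans (dfC c cd).
  rewrite normrM exprSr mulrA ler_wpM2r//; apply: le_trans (dfC c cd) _.
  (* The intermediate point may be 0, and [C] is not assumed nonnegative: its sign is read off from
     the bound itself. *)
  have [->|c0] := eqVneq c 0.
    case: n dfC C0 => [|n] dfC C0; first by rewrite !expr0.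
    have := dfC x xd.
    by rewrite normr0 expr0n/= mulr0 => /(le_trans (normr_ge0 _)).
  have C1 : 0 <= C.
    by move: C0; rewrite pmulr_lge0// exprn_gt0// normr_gt0.
  by rewrite ler_wpM2l// lerXn2r// nnegrE.
have [x0|x0] := leP 0 x.
  have fd' u : u \in `]0, x[%R -> is_derive u (1 : R) f (df u).
    rewrite in_itv/= => /andP[u0 ux]; apply: fd; rewrite ger0_norm ?(ltW u0)//.
    by rewrite (le_trans (ltW ux))// (le_trans _ xd)// ler_norm.
  have [c] := MVT_segment x0 fd' (cont _ _ d0 xd).
  rewrite in_itv/= => /andP[c0 cx]; rewrite f0 !subr0 => ->; apply: key.
  by rewrite !ger0_norm.
have fd' u : u \in `]x, 0[%R -> is_derive u (1 : R) f (df u).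
  rewrite in_itv/= => /andP[u0 ux]; apply: fd; rewrite ltr0_norm//.
  by rewrite (le_trans _ xd)// ltr0_norm// lerN2 ltW.
have [c] := MVT_segment (ltW x0) fd' (cont _ _ xd d0).
rewrite in_itv/= => /andP[c0 cx]; rewrite f0 !sub0r mulrN => /oppr_inj ->.
by apply: key; rewrite ler0_norm// ltr0_norm// lerN2.
Qed.

Lemma expR_bound1 u : `|u| <= 1 / 2 -> `|expR u - 1| <= 2 * `|u|.
Proof.
move=> u1; rewrite -(expr1 `|u|).
apply: (@derive_bound_pow (fun u => expR u - 1) expR 0 2 (1 / 2)) => //.
- move=> v _; have h := is_derive_expR v.
  rewrite -[X in is_derive _ _ _ X]subr0; apply: is_deriveB.
(* exp v <= 2 because exp(-v) >= 1 - v >= 1/2. *)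
- move=> v v1; rewrite expr0 mulr1 ger0_norm ?expR_ge0//.
  have h := expR_ge1Dx (- v); have h4 := expR_gt0 v.
  have h3 : expR v * expR (- v) = 1 by rewrite -expRD subrr expR0.
  have := ler_norm v; nra.
- by rewrite expR0 subrr.
Qed.

Lemma expR_bound2 u : `|u| <= 1 / 2 -> `|expR u - 1 - u| <= 2 * `|u| ^+ 2.
Proof.
move=> u1.
apply: (@derive_bound_pow (fun u => expR u - 1 - u) (fun u => expR u - 1) 1 2 (1 / 2)) => //.
- move=> v _; have h := is_derive_expR v.
  rewrite -[X in is_derive _ _ _ (X - _)]subr0; apply: is_deriveB.
- by move=> v v1; rewrite expr1; exact: expR_bound1.
- by rewrite expR0 !subrr.
Qed.

Lemma expR_bound3 u : `|u| <= 1 / 2 ->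
  `|expR u - 1 - u - u ^+ 2 / 2| <= 2 * `|u| ^+ 3.
Proof.
move=> u1.
apply: (@derive_bound_pow (fun u => expR u - 1 - u - u ^+ 2 / 2)
  (fun u => expR u - 1 - u) 2 2 (1 / 2)) => //.
- move=> v _; have h := is_derive_expR v.
  apply: is_derive_eq; rewrite !scaler0 add0r subr0; congr (_ - _).
  by rewrite /GRing.scale/= !mulr1 -[X in X + X]mul1r -mulrDl mulrA mulVf ?mul1r.
- by move=> v v1; exact: expR_bound2.
- by rewrite expR0 expr0n/= mul0r !subrr.
Qed.

Lemma ln_bound3 u : `|u| <= 1 / 2 ->
  `|ln (1 + u) - u + u ^+ 2 / 2| <= 2 * `|u| ^+ 3.
Proof.
move=> u1.
apply: (@derive_bound_pow (fun u => ln (1 + u) - u + u ^+ 2 / 2)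
  (fun u => (1 + u)^-1 - 1 + u) 2 2 (1 / 2)) => //.
- move=> v v1; have v0 : 0 < 1 + v by move: v1; rewrite ler_norml => /andP[? ?]; lra.
  have h1 : is_derive v (1 : R) (fun v => 1 + v) 1.
    by apply: is_derive_eq; rewrite add0r mulr1.
  have h := @is_derive1_comp R (@ln R) (fun v => 1 + v) v (1 + v)^-1 1 (is_derive1_ln v0) h1.
  rewrite /comp mulr1 in h.
  apply: is_derive_eq; rewrite !scaler0 add0r; congr (_ + _).
  by rewrite /GRing.scale/= !mulr1 -[X in X + X]mul1r -mulrDl mulrA mulVf ?mul1r.
- move=> v v1; have v0 : 1 / 2 <= 1 + v by move: v1; rewrite ler_norml => /andP[? ?]; lra.
  have v00 : 0 < 1 + v by lra.
  have -> : (1 + v)^-1 - 1 + v = v ^+ 2 / (1 + v) by field; rewrite gt_eqF.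
  rewrite normrM normrX [X in _ * X]ger0_norm ?invr_ge0 ?(ltW v00)// [leLHS]mulrC.
  apply: ler_wpM2r; first by rewrite exprn_ge0.
  by rewrite -[leRHS]invrK lef_pV2 ?posrE ?invr_gt0//; lra.
- by rewrite addr0 ln1 expr0n/= mul0r !subrr addr0.
Qed.

End TaylorBounds.

Section Taylor2.
Context {R : realType}.
Implicit Types (phi psi : R -> R) (a b c s : R).

(* [phi s = a + b s + c s^2 + O(|s|^3)]; the second derivative is [2 c]. *)
Definition taylor2 phi a b c := exists C d : R, 0 < d /\
  forall s, `|s| <= d -> `|phi s - (a + b * s + c * s ^+ 2)| <= C * `|s| ^+ 3.

Lemma taylor2D phi psi a b c a' b' c' : taylor2 phi a b c -> taylor2 psi a' b' c' ->
  taylor2 (fun s => phi s + psi s) (a + a') (b + b') (c + c').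
Proof.
move=> [C [d [d0 H]]] [C' [d' [d'0 H']]]; exists (C + C'), (Num.min d d').
split; first by rewrite lt_min d0.
move=> s; rewrite le_min => /andP[/H h /H' h'].
rewrite [leRHS]mulrDl (_ : phi s + psi s - _ = (phi s - (a + b * s + c * s ^+ 2)) +
  (psi s - (a' + b' * s + c' * s ^+ 2))); last by ring.
exact: le_trans (ler_normD _ _) (lerD h h').
Qed.

Lemma taylor2Z k phi a b c : taylor2 phi a b c ->
  taylor2 (fun s => k * phi s) (k * a) (k * b) (k * c).
Proof.
move=> [C [d [d0 H]]]; exists (`|k| * C), d; split => // s /H h.
rewrite -[leRHS]mulrA (_ : k * phi s - _ = k * (phi s - (a + b * s + c * s ^+ 2))); last by ring.
by rewrite normrM ler_wpM2l.
Qed.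

Lemma taylor2_cst a : taylor2 (fun=> a) a 0 0.
Proof.
exists 0, 1; split => // s _.
by rewrite !mul0r !addr0 subrr normr0.
Qed.

Lemma taylor2_sum n (phi : 'I_n -> R -> R) (a b c : 'I_n -> R) :
  (forall i, taylor2 (phi i) (a i) (b i) (c i)) ->
  taylor2 (fun s => \sum_i phi i s) (\sum_i a i) (\sum_i b i) (\sum_i c i).
Proof.
move=> H; elim: (index_enum _) => [|i r IH].
  by under eq_fun do rewrite big_nil; rewrite !big_nil; exact: taylor2_cst.
by under eq_fun do rewrite big_cons; rewrite !big_cons; exact: taylor2D.
Qed.

(** Comparing s with -s kills the linear term, after which the quadratic one dominates the cubic
    error. *)
Lemma taylor2_max phi a b c (d : R) : 0 < d -> taylor2 phi a b c ->
  (forall s, `|s| <= d -> phi s <= a) -> b = 0 /\ c <= 0.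
Proof.
move=> d0 [C [d' [d'0 H]]] le.
pose D := Num.min 1 (Num.min d d').
have D0 : 0 < D by rewrite !lt_min ltr01 d0.
have [D1 Dd Dd'] : [/\ D <= 1, D <= d & D <= d'].
  by rewrite /D !ge_min !lexx !orbT.
have key s : `|s| <= D -> b * s + c * s ^+ 2 <= `|C| * `|s| ^+ 3.
  move=> sD; have := H s (le_trans sD Dd'); have := le s (le_trans sD Dd).
  rewrite ler_norml => h1 /andP[h2 h3].
  have : C * `|s| ^+ 3 <= `|C| * `|s| ^+ 3.
    by rewrite ler_wpM2r ?exprn_ge0// ler_norm.
  lra.
have b0 : b = 0.
  apply/eqP/negPn/negP => b0; have nb : 0 < `|b| by rewrite normr_gt0.
  (* For u <= |b| / (2K) the quadratic and cubic terms stay below |b| u / 2, which contradicts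
     [bu]. *)
  pose K := `|c| + `|C| + 1; have K0 : 0 < K by rewrite ltr_pwDr// addr_ge0.
  pose u := Num.min D (`|b| / (2 * K)).
  have u0 : 0 < u by rewrite lt_min D0 divr_gt0// mulr_gt0.
  have uD : u <= D by rewrite ge_min lexx.
  have uK : u * (2 * K) <= `|b|.
    by rewrite -ler_pdivlMr ?mulr_gt0// ge_min lexx orbT.
  have u1 : u <= 1 by apply: le_trans D1.
  have k1 := key u; rewrite ger0_norm ?(ltW u0)// in k1; have {}k1 := k1 uD.
  have k2 := key (- u); rewrite normrN ger0_norm ?(ltW u0)// in k2.
  have {}k2 := k2 uD; rewrite sqrrN mulrN in k2.
  have bu : `|b| * u <= `|C| * u ^+ 3 + `|c| * u ^+ 2.
    have : - (c * u ^+ 2) <= `|c| * u ^+ 2.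
      by rewrite -mulNr ler_wpM2r ?sqr_ge0// -normrN ler_norm.
    by have [b0'|b0'] := leP 0 b; [rewrite (ger0_norm b0')|rewrite (ltr0_norm b0')]; lra.
  have u2 : 0 <= u ^+ 2 := sqr_ge0 u.
  have u3 : `|C| * u ^+ 3 <= `|C| * u ^+ 2.
    by rewrite ler_wpM2l// exprSr ler_piMr.
  have : `|b| * u <= K * u ^+ 2 by rewrite /K; lra.
  rewrite expr2 mulrA ler_pM2r// => bK.
  by move: uK nb; lra.
split => //; rewrite leNgt; apply/negP => c0.
pose u := Num.min D (c / (2 * (`|C| + 1))).
have C1 : 0 < `|C| + 1 by rewrite ltr_pwDr.
have u0 : 0 < u by rewrite lt_min D0 divr_gt0// mulr_gt0.
have uD : u <= D by rewrite ge_min lexx.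
have uK : u * (2 * (`|C| + 1)) <= c.
  by rewrite -ler_pdivlMr ?mulr_gt0// ge_min lexx orbT.
have := key u; rewrite ger0_norm ?(ltW u0)// => /(_ uD).
rewrite b0 mul0r add0r (exprSr u 2).
have u20 : 0 < u ^+ 2 by rewrite exprn_gt0.
rewrite [leRHS]mulrA [leRHS]mulrAC -subr_ge0 -mulrBl pmulr_lge0//.
have := normr_ge0 C; nra.
Qed.

(** The constant depends on [A] alone, so under the integral the estimate is uniform in the point y,
    on which a, b and z will depend. *)
Lemma exp_quad (A a b z s : R) : 0 <= A -> `|a| <= A -> `|b| <= A ->
  `|z - (a * s + b * s ^+ 2)| <= A * `|s| ^+ 3 -> `|s| <= (8 * (A + 1))^-1 ->
  `|expR z - (1 + a * s + (b + a ^+ 2 / 2) * s ^+ 2)| <=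
    (54 * A ^+ 3 + 4 * A ^+ 2 + A) * `|s| ^+ 3.
Proof.
move=> A0 aA bA zA sA; have A1 : 0 < A + 1 by rewrite ltr_wpDl.
set u := `|s| in zA sA *; have u0 : 0 <= u by exact: normr_ge0.
have uA : u * (8 * (A + 1)) <= 1.
  by rewrite -ler_pdivlMr ?mulr_gt0// div1r.
have u1 : u <= 1 / 8 by nra.
have uAA : u * A <= 1 / 8 by nra.
have u2 : u ^+ 2 <= u by rewrite expr2; nra.
have u3 : u ^+ 3 <= u ^+ 2 by rewrite exprSr; have := sqr_ge0 u; nra.
have s2 : s ^+ 2 = u ^+ 2 by rewrite /u real_normK// num_real.
have as1 : `|a * s| <= A * u by rewrite normrM ler_wpM2r.
have bs1 : `|b * s ^+ 2| <= A * u ^+ 2.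
  by rewrite normrM s2 (ger0_norm (sqr_ge0 u)) ler_wpM2r ?sqr_ge0.
have zas : `|z - a * s| <= 2 * A * u ^+ 2.
  have -> : z - a * s = (z - (a * s + b * s ^+ 2)) + b * s ^+ 2 by ring.
  apply: le_trans (ler_normD _ _) _.
  have : A * u ^+ 3 <= A * u ^+ 2 by rewrite ler_wpM2l.
  lra.
have z1 : `|z| <= 3 * A * u.
  have -> : z = (z - a * s) + a * s by ring.
  apply: le_trans (ler_normD _ _) _.
  have : A * u ^+ 2 <= A * u by rewrite ler_wpM2l.
  lra.
have z2 : `|z + a * s| <= 4 * A * u by apply: le_trans (ler_normD _ _) _; lra.
have z12 : `|z| <= 1 / 2 by apply: le_trans z1 _; lra.
have E := expR_bound3 z12.
have zu3 : `|z| ^+ 3 <= 27 * A ^+ 3 * u ^+ 3.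
  have -> : 27 * A ^+ 3 * u ^+ 3 = (3 * A * u) ^+ 3 by ring.
  by rewrite lerXn2r// nnegrE// !mulr_ge0.
have zz : `|(z - a * s) * (z + a * s)| <= 8 * A ^+ 2 * u ^+ 3.
  rewrite normrM; have -> : 8 * A ^+ 2 * u ^+ 3 = (2 * A * u ^+ 2) * (4 * A * u) by ring.
  by apply: ler_pM.
(* Remainder of exp at z, error in the exponent, and half the difference of the squares of z and a
   s: they contribute 54 A^3, A and 4 A^2 respectively. *)
have -> : expR z - (1 + a * s + (b + a ^+ 2 / 2) * s ^+ 2) =
  (expR z - 1 - z - z ^+ 2 / 2) + (z - (a * s + b * s ^+ 2))
  + 2^-1 * ((z - a * s) * (z + a * s)) by field.
apply: le_trans (ler_normD _ _) _.
rewrite normrM (ger0_norm (_ : 0 <= 2^-1)) ?invr_ge0//.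
have := ler_normD (expR z - 1 - z - z ^+ 2 / 2) (z - (a * s + b * s ^+ 2)).
lra.
Qed.

(** The expansion of ln (1 + v) is applied to the relative increment v = phi/a - 1. The term -
    (b/a)^2 / 2 is the source of the squared gradients in the second order conditions. *)
Lemma taylor2_ln phi a b c : 0 < a -> taylor2 phi a b c ->
  taylor2 (fun s => ln (phi s)) (ln a) (b / a) (c / a - (b / a) ^+ 2 / 2).
Proof.
move=> a0 [C [d [d0 H]]]; pose B := b / a; pose G := c / a.
pose K := `|B| + `|G| + `|C| / a.
have K0 : 0 <= K by rewrite !addr_ge0// divr_ge0// ltW.
have K1 : 0 < K + 1 by rewrite ltr_wpDl.
exists (2 * K ^+ 3 + K ^+ 2 + K), (Num.min d (Num.min 1 (2 * (K + 1))^-1)).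
split; first by rewrite !lt_min d0 ltr01 invr_gt0 mulr_gt0.
move=> s; rewrite !le_min => /and3P[sd s1 sK].
have {H}h := H s sd; set u := `|s| in h sd s1 sK *.
have u0 : 0 <= u by exact: normr_ge0.
have uK : u * (2 * (K + 1)) <= 1 by rewrite -ler_pdivlMr ?mulr_gt0// div1r.
have s2 : s ^+ 2 = u ^+ 2 by rewrite /u real_normK// num_real.
have u2 : u ^+ 2 <= u by rewrite expr2 ler_piMr.
have u20 : 0 <= u ^+ 2 := sqr_ge0 u.
have u3 : u ^+ 3 <= u ^+ 2 by rewrite exprSr ler_piMr.
have u30 : 0 <= u ^+ 3 by exact: exprn_ge0.
pose v := phi s / a - 1.
have vE : v - (B * s + G * s ^+ 2) = (phi s - (a + b * s + c * s ^+ 2)) / a.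
  by rewrite /v /B /G; field; rewrite gt_eqF.
have v3 : `|v - (B * s + G * s ^+ 2)| <= `|C| / a * u ^+ 3.
  rewrite vE normrM [X in _ * X]ger0_norm ?invr_ge0 ?(ltW a0)//.
  rewrite mulrAC ler_wpM2r ?invr_ge0 ?(ltW a0)//; apply: le_trans h _.
  by rewrite ler_wpM2r// ler_norm.
have Ca0 : 0 <= `|C| / a by rewrite divr_ge0// ltW.
have Bs : `|B * s| = `|B| * u by rewrite normrM.
have vB : `|v - B * s| <= K * u ^+ 2.
  have -> : v - B * s = (v - (B * s + G * s ^+ 2)) + G * s ^+ 2 by ring.
  apply: le_trans (ler_normD _ _) _.
  have -> : `|G * s ^+ 2| = `|G| * u ^+ 2 by rewrite normrM s2 (ger0_norm u20).
  have : `|C| / a * u ^+ 3 <= `|C| / a * u ^+ 2 by rewrite ler_wpM2l.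
  have : 0 <= `|B| * u ^+ 2 by rewrite mulr_ge0.
  rewrite /K; lra.
have vK : `|v| <= K * u.
  have -> : v = (v - (B * s + G * s ^+ 2)) + G * s ^+ 2 + B * s by ring.
  apply: le_trans (ler_normD _ _) _; apply: le_trans (lerD (ler_normD _ _) (lexx _)) _.
  have -> : `|G * s ^+ 2| = `|G| * u ^+ 2 by rewrite normrM s2 (ger0_norm u20).
  have : `|C| / a * u ^+ 3 <= `|C| / a * u by rewrite ler_wpM2l// (le_trans u3).
  have : `|G| * u ^+ 2 <= `|G| * u by rewrite ler_wpM2l.
  rewrite /K Bs; lra.
have v12 : `|v| <= 1 / 2 by apply: le_trans vK _; lra.
have vB2 : `|v + B * s| <= 2 * K * u.
  apply: le_trans (ler_normD _ _) _; rewrite Bs.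
  have : `|B| * u <= K * u.
    by rewrite ler_wpM2r// /K -addrA lerDl addr_ge0.
  lra.
have phiE : phi s = a * (1 + v) by rewrite /v; field; rewrite gt_eqF.
have v10 : 0 < 1 + v by move: v12; rewrite ler_norml => /andP[? ?]; lra.
rewrite phiE lnM ?posrE//.
have E := ln_bound3 v12.
have v33 : `|v| ^+ 3 <= K ^+ 3 * u ^+ 3.
  by rewrite -exprMn lerXn2r// nnegrE// mulr_ge0.
have vv : `|(v - B * s) * (v + B * s)| <= 2 * K ^+ 2 * u ^+ 3.
  rewrite normrM; have -> : 2 * K ^+ 2 * u ^+ 3 = (K * u ^+ 2) * (2 * K * u) by ring.
  exact: ler_pM.
rewrite (_ : ln a + ln (1 + v) - _ = (ln (1 + v) - v + v ^+ 2 / 2) +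
  (v - (B * s + G * s ^+ 2)) - 2^-1 * ((v - B * s) * (v + B * s))); last first.
  by rewrite -/B -/G; field.
apply: le_trans (ler_normB _ _) _.
rewrite normrM (ger0_norm (_ : 0 <= 2^-1)) ?invr_ge0//.
have := ler_normD (ln (1 + v) - v + v ^+ 2 / 2) (v - (B * s + G * s ^+ 2)).
have : `|C| / a * u ^+ 3 <= K * u ^+ 3 by rewrite ler_wpM2r// /K lerDr addr_ge0.
lra.
Qed.

End Taylor2.

(** * Expansions of the heat flow in space and in time *)

Section HeatTaylor.
Context {R : realType} {V : euclidean R}.
Implicit Types (x y z w : V) (t : R) (a b q : V -> R).
Local Notation BV := (euclidean_borel V).

Lemma bounded_borel_supp q (E : V -> R) (rho C : R) : bounded_borel q ->
  (forall y, rho < inner y y -> q y = 0) -> measurable_fun setT (E : BV -> R) ->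
  (forall y, inner y y <= rho -> `|E y| <= C) -> bounded_borel (fun y => q y * E y).
Proof.
move=> [mq [D qD]] q0 mE EC; split; first exact: measurable_funM.
exists (D * `|C|) => y; have [yr|yr] := leP (inner y y) rho; last first.
  by rewrite q0// mul0r normr0 mulr_ge0// (le_trans _ (qD y)).
by rewrite normrM ler_pM// (le_trans (EC y yr))// ler_norm.
Qed.

(** Replaces differentiation under the integral sign: since the kernel at (t, x) has mass 1, an
    approximation [E0] of the quotient [E1] of the kernels that is uniform on the support of [q]
    transfers to the heat flow. *)
Lemma heat_flow_perturb t x q (rho C e : R) (E0 E1 : V -> R) (t' : R) x' :
  0 < t -> bounded_borel q -> (forall y, `|q y| <= C) ->
  (forall y, rho < inner y y -> q y = 0) ->
  measurable_fun setT (E0 : BV -> R) -> measurable_fun setT (E1 : BV -> R) ->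
  (exists D, forall y, inner y y <= rho -> `|E0 y| <= D) -> 0 <= e ->
  (forall y, inner y y <= rho -> `|E1 y - E0 y| <= e) ->
  (forall y, heat_kernel t' (x' - y) = heat_kernel t (x - y) * E1 y) ->
  `|heat_flow t' q x' - heat_flow t (fun y => q y * E0 y) x| <= C * e.
Proof.
move=> t0 bq qC q0 mE0 mE1 [D E0D] e0 Ee kE.
have bqE0 : bounded_borel (fun y => q y * E0 y) by exact: (bounded_borel_supp bq q0 mE0 E0D).
have bqE1 : bounded_borel (fun y => q y * E1 y).
  apply: (bounded_borel_supp (C := D + e) bq q0 mE1) => y yr.
  rewrite -(subrK (E0 y) (E1 y)) addrC; apply: le_trans (ler_normD _ _) _.
  by rewrite lerD// ?E0D// Ee.
have -> : heat_flow t' q x' = heat_flow t (fun y => q y * E1 y) x.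
  by apply: eq_heat_flow => y; rewrite kE; ring.
have -> : heat_flow t (fun y => q y * E1 y) x - heat_flow t (fun y => q y * E0 y) x =
    heat_flow t (fun y => q y * E1 y + -1 * (q y * E0 y)) x.
  by rewrite heat_flowD// ?heat_flowZ// ?mulN1r//; exact: bounded_borelZ.
have bd : bounded_borel (fun y => q y * E1 y + -1 * (q y * E0 y)).
  by apply: bounded_borelD => //; exact: bounded_borelZ.
apply: le_trans (heat_flow_norm x t0 bd) _.
rewrite -[leRHS](heat_flow_cst x _ t0); apply: heat_flow_le => //.
- exact: bounded_borel_norm.
- exact: bounded_borel_cst.
- move=> y; rewrite mulN1r -mulrBr normrM.
  have [yr|yr] := leP (inner y y) rho; last first.
    by rewrite q0// normr0 mul0r mulr_ge0// (le_trans _ (qC y)).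
  by rewrite ler_pM// Ee.
Qed.

(** Cauchy-Schwarz together with u <= u^2 + 1, which avoids a square root. *)
Lemma inner_bound w p (P : R) : inner p p <= P -> `|inner w p| <= inner w w * P + 1.
Proof.
move=> pP; have CS := CauchySchwarz_inner w p; have w0 := inner_ge0 w.
have := ler_wpM2l w0 pP; have : `|inner w p| ^+ 2 = inner w p ^+ 2 by rewrite real_normK// num_real.
have := normr_ge0 (inner w p); nra.
Qed.

Lemma sqdist_bound x y (rho : R) : inner y y <= rho ->
  inner (x - y) (x - y) <= 2 * inner x x + 2 * rho.
Proof.
move=> yr; have := inner_parallelogram_le x (- y).
rewrite innerNl innerNr opprK; lra.
Qed.

(** The quotient of the kernels at x + s w and x is exactly exp(a s + b s^2), since the squared
    distance is quadratic in s. *)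
Lemma heat_taylor_space t x q w (rho : R) : 0 < t -> bounded_borel q ->
  (forall y, rho < inner y y -> q y = 0) ->
  let a y := - (2 * t)^-1 * inner w (x - y) in
  let b y := - inner w w / (4 * t) in
  taylor2 (fun s => heat_flow t q (x + s *: w)) (heat_flow t q x)
    (heat_flow t (fun y => q y * a y) x)
    (heat_flow t (fun y => q y * (b y + a y ^+ 2 / 2)) x).
Proof.
move=> t0 bq q0 a b; have [mq [C0 qC0]] := bq.
pose P := 2 * inner x x + 2 * rho.
pose B := inner w w * P + 1.
have wB y : inner y y <= rho -> `|inner w (x - y)| <= B.
  by move=> yr; apply: inner_bound; exact: sqdist_bound.
pose A := (2 * t)^-1 * `|B| + inner w w / (4 * t).
have t20 : 0 <= (2 * t)^-1 by rewrite invr_ge0 mulr_ge0// ltW.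
have w40 : 0 <= inner w w / (4 * t) by rewrite divr_ge0 ?inner_ge0// mulr_ge0// ltW.
have A0 : 0 <= A by rewrite addr_ge0// mulr_ge0.
have aA y : inner y y <= rho -> `|a y| <= A.
  move=> yr; rewrite normrM normrN (ger0_norm t20).
  apply: (@le_trans _ _ ((2 * t)^-1 * `|B|)); last by rewrite /A lerDl.
  by rewrite ler_wpM2l// (le_trans (wB y yr))// ler_norm.
have bA y : `|b y| <= A.
  by rewrite /b mulNr normrN (ger0_norm w40) /A lerDr mulr_ge0.
have ma : measurable_fun setT (a : BV -> R).
  by apply: measurable_funM => //; exact: measurable_innerB.
have mb : measurable_fun setT (b : BV -> R) by exact: measurable_cst.
have aE y : a y = - (2 * t)^-1 * inner w (x - y) by [].
have bE y : b y = - inner w w / (4 * t) by [].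
clearbody a b.
exists (C0 * (54 * A ^+ 3 + 4 * A ^+ 2 + A)), (8 * (A + 1))^-1; split.
  by rewrite invr_gt0 mulr_gt0// ltr_wpDl.
move=> s sA; set c := 54 * _ + _ + _.
have c0 : 0 <= c by rewrite !addr_ge0// ?mulr_ge0// ?exprn_ge0.
pose E0 y := 1 + a y * s + (b y + a y ^+ 2 / 2) * s ^+ 2.
pose E1 y := expR (a y * s + b y * s ^+ 2).
have mE0 : measurable_fun setT (E0 : BV -> R).
  apply: measurable_funD; first by apply: measurable_funD => //; exact: measurable_funM.
  apply: measurable_funM => //; apply: measurable_funD => //.
  by apply: measurable_funM => //; exact: measurable_funX.
have mE1 : measurable_fun setT (E1 : BV -> R).
  by apply: measurableT_comp => //; apply: measurable_funD; apply: measurable_funM.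
have bqa : bounded_borel (fun y => q y * a y) by exact: (bounded_borel_supp bq q0 ma aA).
have mab : measurable_fun setT (fun y : BV => b y + a y ^+ 2 / 2).
  by apply: measurable_funD => //; apply: measurable_funM => //; exact: measurable_funX.
have bqb : bounded_borel (fun y => q y * (b y + a y ^+ 2 / 2)).
  apply: (bounded_borel_supp (C := A + A ^+ 2) bq q0 mab) => y yr.
  apply: le_trans (ler_normD _ _) _; apply: lerD => //.
  have : `|a y| ^+ 2 <= A ^+ 2 by rewrite lerXn2r ?nnegrE// aA.
  have := sqr_ge0 A.
  rewrite normrM normrX (ger0_norm (_ : 0 <= 2^-1)) ?invr_ge0//; lra.
have <- : heat_flow t (fun y => q y * E0 y) x = heat_flow t q x +
    heat_flow t (fun y => q y * a y) x * s +
    heat_flow t (fun y => q y * (b y + a y ^+ 2 / 2)) x * s ^+ 2.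
  rewrite (_ : (fun y => q y * E0 y) = fun y => (q y + s * (q y * a y)) +
    s ^+ 2 * (q y * (b y + a y ^+ 2 / 2))); last by apply/funext => y; rewrite /E0; ring.
  rewrite heat_flowD//; [|by apply: bounded_borelD => //; exact: bounded_borelZ|exact: bounded_borelZ].
  rewrite heat_flowD//; last exact: bounded_borelZ.
  by rewrite !heat_flowZ//; ring.
rewrite -mulrA; apply: (heat_flow_perturb (rho := rho) (E1 := E1)) => //.
- exists (1 + A * `|s| + (A + A ^+ 2) * `|s| ^+ 2) => y yr.
  apply: le_trans (ler_normD _ _) _; apply: lerD.
    apply: le_trans (ler_normD _ _) _; rewrite normr1 lerD2l normrM.
    by rewrite ler_wpM2r// aA.
  rewrite normrM normrX ler_wpM2r ?exprn_ge0//.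
  apply: le_trans (ler_normD _ _) _; apply: lerD => //.
  have : `|a y| ^+ 2 <= A ^+ 2 by rewrite lerXn2r ?nnegrE// aA.
  have := sqr_ge0 A.
  rewrite normrM normrX (ger0_norm (_ : 0 <= 2^-1)) ?invr_ge0//; lra.
- by rewrite mulr_ge0// exprn_ge0.
- move=> y yr; apply: exp_quad => //; first exact: aA.
  by rewrite subrr normr0 mulr_ge0// exprn_ge0.
- move=> y; rewrite !heat_kernelE// -expRD; congr expR.
  rewrite aE bE (_ : x + s *: w - y = x - y + s *: w); last by rewrite addrAC.
  move: (x - y) => p; rewrite innerDl !innerDr !innerZl !innerZr (innerC p w).
  by field; rewrite gt_eqF.
Qed.

(* Time runs backwards along [t exp(- s^2)], so that first order in time is
   compared with second order in space. *)
Lemma heat_taylor_time t x q (rho : R) : 0 < t -> bounded_borel q ->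
  (forall y, rho < inner y y -> q y = 0) ->
  taylor2 (fun s => heat_flow (t * expR (- s ^+ 2)) q x) (heat_flow t q x) 0
    (heat_flow t (fun y => q y * ((dim V)%:R / 2 - inner (x - y) (x - y) / (4 * t))) x).
Proof.
move=> t0 bq q0; have [mq [C0 qC0]] := bq.
pose b y := (dim V)%:R / 2 - inner (x - y) (x - y) / (4 * t).
pose P := 2 * inner x x + 2 * `|rho|.
have pP y : inner y y <= rho -> inner (x - y) (x - y) <= P.
  move=> yr; apply: le_trans (sqdist_bound x yr) _.
  by rewrite lerD2l ler_wpM2l// ler_norm.
have P0 : 0 <= P by rewrite addr_ge0// mulr_ge0 ?inner_ge0.
have t40 : 0 < 4 * t by rewrite mulr_gt0.
pose A := (dim V)%:R / 2 + 2 * (P / (4 * t)).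
have Pt0 : 0 <= P / (4 * t) by rewrite divr_ge0// ltW.
have A0 : 0 <= A by rewrite addr_ge0// mulr_ge0.
have pA y : inner y y <= rho -> 0 <= inner (x - y) (x - y) / (4 * t) <= P / (4 * t).
  move=> yr; rewrite divr_ge0 ?inner_ge0 ?(ltW t40)//=.
  by rewrite ler_wpM2r ?invr_ge0 ?(ltW t40)// pP.
have bA y : inner y y <= rho -> `|b y| <= A.
  move=> /pA/andP[h1 h2]; have d0 : 0 <= (dim V)%:R / 2 :> R by rewrite divr_ge0.
  by rewrite ler_norml /b /A; apply/andP; split; lra.
have mb : measurable_fun setT (b : BV -> R).
  by apply: measurable_funB => //; apply: measurable_funM => //; exact: measurable_sqdist.
exists (C0 * (54 * A ^+ 3 + 4 * A ^+ 2 + A)), (8 * (A + 1))^-1; split.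
  by rewrite invr_gt0 mulr_gt0// ltr_wpDl.
move=> s sA; set c := 54 * _ + _ + _.
have c0 : 0 <= c by have := exprn_ge0 3 A0; have := exprn_ge0 2 A0; rewrite /c; lra.
have s1 : `|s| <= 1 / 8.
  apply: le_trans sA _; rewrite div1r lef_pV2 ?posrE// ?mulr_gt0 ?ltr_wpDl//; lra.
pose E0 y := 1 + b y * s ^+ 2.
(* The quotient of the kernels at times t exp(-s^2) and t: the normalisation gives the first term,
   the change of 1/t the second. *)
pose E1 y := expR ((dim V)%:R / 2 * s ^+ 2
   - inner (x - y) (x - y) / (4 * t) * (expR (s ^+ 2) - 1)).
have mE0 : measurable_fun setT (E0 : BV -> R).
  by apply: measurable_funD => //; exact: measurable_funM.
have mE1 : measurable_fun setT (E1 : BV -> R).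
  apply: measurableT_comp => //; apply: measurable_funB => //.
  apply: measurable_funM => //; apply: measurable_funM => //.
  exact: measurable_sqdist.
have bqb : bounded_borel (fun y => q y * b y) by exact: (bounded_borel_supp bq q0 mb bA).
have <- : heat_flow t (fun y => q y * E0 y) x = heat_flow t q x + 0 * s +
    heat_flow t (fun y => q y * b y) x * s ^+ 2.
  rewrite (_ : (fun y => q y * E0 y) = fun y => q y +
    s ^+ 2 * (q y * b y)); last by apply/funext => y; rewrite /E0; ring.
  by rewrite heat_flowD ?heat_flowZ//; [ring|exact: bounded_borelZ].
rewrite -mulrA; apply: (heat_flow_perturb (rho := rho) (E1 := E1)) => //.
- exists (1 + A * `|s| ^+ 2) => y yr.
  apply: le_trans (ler_normD _ _) _; rewrite normr1 lerD2l normrM normrX.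
  by rewrite ler_wpM2r ?exprn_ge0// bA.
- by rewrite mulr_ge0// exprn_ge0.
(* [exp_quad] with zero linear coefficient: the exponent differs from b s^2 only by a term of order
   s^4, coming from exp(s^2) - 1 - s^2. *)
- move=> y yr; rewrite /E0 (_ : 1 + _ = 1 + 0 * s + (b y + 0 ^+ 2 / 2) * s ^+ 2);
    last by rewrite expr0n/=; ring.
  apply: exp_quad => //; [by rewrite normr0|exact: bA|].
  rewrite (_ : _ - _ = - (inner (x - y) (x - y) / (4 * t)
    * (expR (s ^+ 2) - 1 - s ^+ 2))); last by rewrite /b; ring.
  have /andP[h1 h2] := pA y yr.
  have s2 : `|s ^+ 2| <= 1 / 2.
    by rewrite normrX; have := normr_ge0 s; nra.
  rewrite normrN normrM (ger0_norm h1).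
  have := expR_bound2 s2; rewrite normrX -exprM => h3.
  have s34 : `|s| ^+ (2 * 2) <= `|s| ^+ 3.
    rewrite (_ : (2 * 2)%N = 4%N)// (exprSr _ 3) ler_piMr ?exprn_ge0//; lra.
  apply: le_trans (ler_pM h1 (normr_ge0 _) h2 h3) _.
  have s30 : 0 <= `|s| ^+ 3 by exact: exprn_ge0.
  have : P / (4 * t) * (2 * `|s| ^+ (2 * 2)) <= P / (4 * t) * (2 * `|s| ^+ 3).
    by rewrite ler_wpM2l// ler_wpM2l.
  have : 0 <= (dim V)%:R / 2 * `|s| ^+ 3 by rewrite mulr_ge0.
  rewrite /A; lra.
- move=> y; rewrite !heat_kernelE ?mulr_gt0 ?expR_gt0// -expRD; congr expR.
  rewrite mulrA lnM ?posrE ?mulr_gt0 ?pi_gt0 ?expR_gt0// expRK expRN.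
  field; rewrite ?gt_eqF ?expR_gt0//.
Qed.

End HeatTaylor.

(** The quotient of the two kernels is exp(L y) with |L| <= eta on the support of [q], and
    [heat_flow_perturb] with E0 = 1 concludes. The three thirds of [eta] go to the logarithm of
    time, to its inverse and to the displacement of the point. *)
Lemma heat_flow_continuous (R : realType) (V : euclidean R) (t0 : R) (x0 : V)
    (q : V -> R) (rho e : R) : 0 < t0 -> bounded_borel q ->
  (forall y, rho < inner y y -> q y = 0) -> 0 < e ->
  exists2 d : R, 0 < d & forall t x, `|t - t0| < d -> inner (x - x0) (x - x0) < d ->
    `|heat_flow t q x - heat_flow t0 q x0| <= e.
Proof.
move=> t00 bq q0 e0; have [mq [C qC]] := bq.
have C0 : 0 <= C by apply: le_trans (qC 0).
pose P := 2 * inner x0 x0 + 2 * `|rho|.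
have P0 : 0 <= P by rewrite addr_ge0// mulr_ge0 ?inner_ge0.
have pP y : inner y y <= rho -> inner (x0 - y) (x0 - y) <= P.
  move=> yr; apply: le_trans (sqdist_bound x0 yr) _.
  by rewrite lerD2l ler_wpM2l// ler_norm.
pose eta := Num.min (1 / 2) (e / (2 * (C + 1))).
have C1 : 0 < C + 1 by rewrite ltr_wpDl.
have eta0 : 0 < eta by rewrite lt_min !divr_gt0// mulr_gt0.
have eta1 : eta <= 1 / 2 by rewrite ge_min lexx.
have etae : eta * (2 * (C + 1)) <= e.
  by rewrite -ler_pdivlMr ?mulr_gt0// ge_min lexx orbT.
pose n : R := (dim V)%:R / 2.
have n0 : 0 <= n by rewrite divr_ge0.
have near1 : \forall t \near t0, `|ln t0 - ln t| < eta / (3 * (n + 1)).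
  have := @continuous_ln R t0 t00; move/cvgrPdist_lt; apply.
  by rewrite divr_gt0// mulr_gt0// ltr_wpDl.
have near2 : \forall t \near t0, `|t0^-1 - t^-1| < eta / (3 * (P + 1)).
  have := @inv_continuous R t0 (lt0r_neq0 t00); move/cvgrPdist_lt; apply.
  by rewrite divr_gt0// mulr_gt0// ltr_wpDl.
have near3 : \forall t \near t0, t0 / 2 < t by apply: lt_nbhsr; lra.
have : \forall t \near t0, [/\ `|ln t0 - ln t| < eta / (3 * (n + 1)),
    `|t0^-1 - t^-1| < eta / (3 * (P + 1)) & t0 / 2 < t] by near=> t; split; near: t.
move=> /nbhs_ballP[d1 /= d10 H1].
(* Weight in 2 |<u, p>| <= |u|^2 / l + l |p|^2: it makes l |p|^2 at most t0 eta / 3, and [d2] does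
   the same for the terms in |u|^2. *)
pose l := t0 * eta / (3 * (P + 1)).
have l0 : 0 < l by rewrite divr_gt0 ?mulr_gt0// ltr_wpDl.
pose d2 := t0 * eta / (3 * (l^-1 + 1)).
have d20 : 0 < d2 by rewrite divr_gt0 ?mulr_gt0// addr_gt0// invr_gt0.
exists (Num.min d1 d2); first by rewrite lt_min d10.
move=> t x; rewrite !lt_min => /andP[td _] /andP[_ xd].
have [h1 h2 h3] : [/\ `|ln t0 - ln t| < eta / (3 * (n + 1)),
    `|t0^-1 - t^-1| < eta / (3 * (P + 1)) & t0 / 2 < t].
  by apply: H1; rewrite /ball/= distrC.
have tp : 0 < t by apply: lt_trans h3; rewrite divr_gt0.
pose L y := n * (ln t0 - ln t) +
  (inner (x0 - y) (x0 - y) / (4 * t0) - inner (x - y) (x - y) / (4 * t)).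
have mL : measurable_fun setT (L : euclidean_borel V -> R).
  apply: measurable_funD => //; apply: measurable_funB;
  by apply: measurable_funM => //; exact: measurable_sqdist.
have LB y : inner y y <= rho -> `|L y| <= eta.
  move=> /pP; rewrite /L (_ : x - y = (x - x0) + (x0 - y)); last by rewrite addrA subrK.
  move: (x - x0) (x0 - y) xd => u p ud pp.
  set p2 := inner p p in pp *; set u2 := inner u u in ud; set up := inner u p.
  have p20 : 0 <= p2 := inner_ge0 p.
  have -> : inner (u + p) (u + p) = u2 + 2 * up + p2.
    by rewrite innerDl !innerDr (innerC p u) /u2 /up /p2; ring.
  have b1 : `|n * (ln t0 - ln t)| <= eta / 3.
    rewrite normrM (ger0_norm n0).
    apply: le_trans (ler_wpM2l n0 (ltW h1)) _.
    rewrite mulrA ler_pdivrMr ?mulr_gt0 ?ltr_wpDl//.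
    have -> : eta / 3 * (3 * (n + 1)) = n * eta + eta by field.
    by rewrite lerDl ltW.
  have b2 : `|p2 / 4 * (t0^-1 - t^-1)| <= eta / 3.
    rewrite normrM ger0_norm ?divr_ge0//.
    apply: le_trans (ler_wpM2l _ (ltW h2)) _; first by rewrite divr_ge0.
    rewrite mulrA ler_pdivrMr ?mulr_gt0 ?ltr_wpDl//.
    have -> : eta / 3 * (3 * (P + 1)) = P * eta + eta by field.
    have : p2 / 4 * eta <= P * eta by rewrite ler_wpM2r ?(ltW eta0)//; lra.
    move: eta0; lra.
  have amgm : `|2 * up| <= l^-1 * u2 + l * p2.
    have g1 := inner_ge0 (u - l *: p); have g2 := inner_ge0 (u + l *: p).
    rewrite !(innerDl, innerDr, innerNl, innerNr, innerZl, innerZr) (innerC p u) in g1 g2.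
    have -> : l^-1 * u2 + l * p2 = l^-1 * (u2 + l * (l * p2)).
      by field; rewrite gt_eqF.
    rewrite ler_norml; apply/andP; split.
      by rewrite lerNl ler_pdivlMl//; move: g2; rewrite -/u2 -/up -/p2; lra.
    by rewrite ler_pdivlMl//; move: g1; rewrite -/u2 -/up -/p2; lra.
  have l1 : 0 < l^-1 + 1 by rewrite addr_gt0// invr_gt0.
  have b4 : (l^-1 + 1) * u2 <= t0 * eta / 3.
    have <- : d2 * (l^-1 + 1) = t0 * eta / 3.
      by rewrite /d2 invfM mulrA mulfVK ?gt_eqF.
    by rewrite mulrC ler_wpM2r ?(ltW l1)// ltW.
  have b5 : l * p2 <= t0 * eta / 3.
    apply: le_trans (ler_wpM2l (ltW l0) pp) _.
    rewrite /l mulrAC ler_pdivrMr ?mulr_gt0 ?ltr_wpDl//.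
    have -> : t0 * eta / 3 * (3 * (P + 1)) = t0 * eta * P + t0 * eta by field.
    by rewrite lerDl mulr_ge0 ?ltW.
  have b3 : `|(u2 + 2 * up) / (4 * t)| <= eta / 3.
    rewrite normrM [X in _ * X]ger0_norm ?invr_ge0 ?mulr_ge0 ?(ltW tp)//.
    rewrite ler_pdivrMr ?mulr_gt0//; apply: le_trans (ler_normD _ _) _.
    rewrite (ger0_norm (inner_ge0 u)).
    have : eta / 3 * (4 * (t0 / 2)) <= eta / 3 * (4 * t).
      by rewrite ler_wpM2l ?divr_ge0 ?(ltW eta0)// ler_wpM2l// ltW.
    move: b4 b5 amgm; rewrite -/u2; lra.
  have -> : n * (ln t0 - ln t) + (p2 / (4 * t0) - (u2 + 2 * up + p2) / (4 * t)) =
    n * (ln t0 - ln t) + p2 / 4 * (t0^-1 - t^-1) - (u2 + 2 * up) / (4 * t).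
    by field; rewrite ?gt_eqF.
  apply: le_trans (ler_normB _ _) _; apply: le_trans (lerD (ler_normD _ _) (lexx _)) _.
  lra.
have bqL : bounded_borel (fun y => q y * 1) by apply: bounded_borelM => //; exact: bounded_borel_cst.
have -> : heat_flow t0 q x0 = heat_flow t0 (fun y => q y * 1) x0.
  by congr (heat_flow _ _ _); apply/funext => y; rewrite mulr1.
apply: (@le_trans _ _ (C * (2 * eta))); last first.
  have : C * (2 * eta) <= (C + 1) * (2 * eta) by rewrite ler_wpM2r ?mulr_ge0 ?ltW// ltrDl.
  lra.
apply: (heat_flow_perturb (rho := rho) (E1 := fun y => expR (L y))) => //.
- exact: measurableT_comp.
- by exists 1 => y _; rewrite normr1.
- by rewrite mulr_ge0// ltW.
- move=> y yr; apply: le_trans (expR_bound1 _) _; first exact: le_trans (LB y yr) _.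
  by rewrite ler_wpM2l// LB.
- move=> y; rewrite !heat_kernelE// -expRD; congr expR.
  rewrite !lnM ?posrE ?mulr_gt0 ?pi_gt0// /L /n.
  ring.
Unshelve. all: by end_near. Qed.

(** * Positive semidefinite maps and geometric data *)

Section PsdForms.
Context {R : realType} {V : euclidean R}.
Implicit Types (x y v : V) (b : V -> V -> R).

Definition psd_form b := [/\ forall a x y z, b (a *: x + y) z = a * b x z + b y z,
  forall x y, b x y = b y x & forall x, 0 <= b x x].

Lemma psd_form_eq0 b e y : psd_form b -> b e e = 0 -> b e y = 0.
Proof.
move=> [bl bs b0] ee; apply/eqP/negPn/negP => ey0.
have bsq : 0 < b e y ^+ 2 by rewrite exprn_even_gt0.
(* If b e y were nonzero, this multiple of [e] would give the form the value -1 at a e + y. *)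
pose a := - (b y y + 1) / (2 * b e y ^+ 2) * b e y.
have := b0 (a *: e + y); rewrite bl (bs e) (bs y) !bl ee (bs y e).
have -> : a * (a * 0 + b e y) + (a * b e y + b y y) = - 1.
  by rewrite /a; field.
by rewrite lerNr oppr0 ler10.
Qed.

(* One step of Cholesky elimination, along [e]. *)
Lemma psd_form_elim b e : psd_form b -> exists (phi : V -> R) b',
  [/\ psd_form b', forall y, b' e y = 0,
   forall y, (forall z, b y z = 0) -> forall z, b' y z = 0,
   forall a x y, phi (a *: x + y) = a * phi x + phi y &
   forall x y, b x y = phi x * phi y + b' x y].
Proof.
move=> pb; have [bl bs b0] := pb.
have [ee|ee] := eqVneq (b e e) 0.
  exists (fun=> 0), b; split => //.
  - by move=> y; exact: psd_form_eq0.
  - by move=> a x y; rewrite mulr0 addr0.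
  - by move=> x y; rewrite mulr0 add0r.
have e0 : 0 < b e e by rewrite lt_neqAle eq_sym ee b0.
have s0 : Num.sqrt (b e e) != 0 by rewrite gt_eqF// sqrtr_gt0.
have s2 : Num.sqrt (b e e) ^+ 2 = b e e by rewrite sqr_sqrtr// ltW.
exists (fun x => b x e / Num.sqrt (b e e)), (fun x y => b x y - b x e * b e y / b e e).
split.
- split.
  + by move=> a x y z; rewrite !bl; field.
  + by move=> x y; rewrite (bs x y) (bs x e) (bs e y); congr (_ - _ / _); rewrite mulrC.
  + move=> x; have := b0 ((- (b x e / b e e)) *: e + x).
    have bE a : b (a *: e + x) (a *: e + x) = a * (a * b e e) + 2 * a * b x e + b x x.
      rewrite bl (bs e (a *: e + x)) (bs x (a *: e + x)) !bl (bs e x); ring.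
    by rewrite bE (bs e x); congr (0 <= _); field.
- by move=> y; rewrite mulrAC divff// mul1r subrr.
- by move=> y by0 z; rewrite !by0 !mul0r subrr.
- by move=> a x y; rewrite bl; field.
- move=> x y; rewrite mulrACA -expr2 exprVn s2 (bs y e); ring.
Qed.

(** Elimination runs through an orthonormal basis; basis vectors already treated stay in the kernel
    of the remainder, which therefore vanishes in the end. The linear forms split off are inner
    products with vectors (Riesz). *)
Lemma psd_form_decomp b : psd_form b -> exists vs : seq V,
  forall x y, b x y = \sum_(v <- vs) inner x v * inner v y.
Proof.
move=> pb.
have rep (phi : V -> R) : (forall a x y, phi (a *: x + y) = a * phi x + phi y) ->
    exists v, forall x, phi x = inner x v.
  move=> pl; have p0 : phi 0 = 0.
    by have := pl (-1) 0 0; rewrite scaler0 addr0 mulN1r addNr.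
  exists (\sum_(i < dim V) phi (tnth (onb V) i) *: tnth (onb V) i) => x.
  rewrite inner_sumr -{1}(to_coordK x) /of_coord.
  elim: (index_enum _) => [|i r IH]; first by rewrite !big_nil.
  by rewrite !big_cons pl IH innerZr tnth_mktuple mulrC.
have [vs [b' [pb' b'0 bE]]] : exists vs b', [/\ psd_form b',
    forall e, e \in (onb V : seq V) -> forall y, b' e y = 0 &
    forall x y, b x y = \sum_(v <- vs) inner x v * inner v y + b' x y].
  elim: (onb V : seq V) => [|e s [vs [b1 [pb1 b10 bE]]]].
    by exists [::], b; split => // x y; rewrite big_nil add0r.
  have [phi [b' [pb' b'e b'0 pl bE1]]] := psd_form_elim e pb1.
  have [v vP] := rep _ pl.
  exists (v :: vs), b'; split => //.
    move=> e'; rewrite inE => /predU1P[->//|es] y; apply: b'0; exact: b10.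
  move=> x y; rewrite big_cons bE bE1 !vP (innerC v y); ring.
exists vs => x y; rewrite bE; suff -> : b' x y = 0 by rewrite addr0.
have [bl _ _] := pb'.
have b00 : b' 0 y = 0.
  by have := bl (-1) 0 0 y; rewrite scaler0 addr0 mulN1r addNr.
rewrite -(to_coordK x) /of_coord.
elim: (index_enum _) => [|i r IH]; first by rewrite big_nil.
by rewrite big_cons bl IH b'0 ?mem_tnth// mulr0 addr0.
Qed.

Lemma psd_decomp (A : 'End(V)) : psd A -> exists vs : seq V,
  forall x y, inner x (A y) = \sum_(v <- vs) inner x v * inner v y.
Proof.
move=> [sA A0]; apply: psd_form_decomp; split => //.
- by move=> a x y z; rewrite innerDl innerZl.
- by move=> x y; rewrite -{1}sA -adjointE innerC.
Qed.

End PsdForms.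

Section Geometric.
Context {R : realType} {k m : nat} (E : 'I_k -> euclidean R) (F : 'I_m -> euclidean R).

Lemma inner_block_scalar n (G : 'I_n -> euclidean R) (c : 'I_n -> R) (x y : dsum G) :
  inner x (block_scalar G c y) = \sum_i c i * inner (dsum_proj G i x) (dsum_proj G i y).
Proof.
rewrite /block_scalar sum_lfunE inner_sumr; apply: eq_bigr => i _.
by rewrite scale_lfunE innerZr comp_lfunE -adjointE.
Qed.

Lemma geometric_le (D : FRBL_datum E F) (x : dsum E) : FRBL_geometric D ->
  \sum_j FRBL_d D j * inner (dsum_proj F j (FRBL_Q D x)) (dsum_proj F j (FRBL_Q D x))
  <= \sum_i FRBL_c D i * inner (dsum_proj E i x) (dsum_proj E i x).
Proof.
move=> [[_ H] _]; have := H x.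
rewrite add_lfunE opp_lfunE innerBr inner_block_scalar !comp_lfunE -adjointE.
by rewrite inner_block_scalar subr_ge0.
Qed.

(** With Sigma a sum of v v^*, the quadratic form of its i-th diagonal block at p is the sum of the
    <p, v_i>^2. The two coupling conditions thus say that the components of the v, and those of the
    Qv, form Parseval families in every summand. *)
Lemma geometric_frame (D : FRBL_datum E F) : FRBL_geometric D ->
  exists vs : seq (dsum E),
    (forall i p, \sum_(v <- vs) inner p (dsum_proj E i v) ^+ 2 = inner p p) /\
    (forall j p, \sum_(v <- vs) inner p (dsum_proj F j (FRBL_Q D v)) ^+ 2 = inner p p).
Proof.
move=> [_ [S [[pS Sid] [_ QSid]]]]; have [vs vsP] := psd_decomp pS.
have frame n (G : 'I_n -> euclidean R) (i : 'I_n) (T : 'Hom(dsum E, dsum G)) p :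
    inner p (dsum_proj G i (T (S (adjoint T (adjoint (dsum_proj G i) p))))) =
    \sum_(v <- vs) inner p (dsum_proj G i (T v)) ^+ 2.
  rewrite innerC (adjointE (dsum_proj G i)) (adjointE T) innerC vsP.
  apply: eq_bigr => v _; rewrite (@innerC _ (dsum E) _ v) -(adjointE T).
  by rewrite -(adjointE (dsum_proj G i)) expr2 (innerC p).
exists vs; split => [i p|j p].
- have := congr1 (fun h : 'End(E i) => inner p (h p)) (Sid i).
  rewrite /= !comp_lfunE id_lfunE innerC (adjointE (dsum_proj E i)) innerC vsP => <-.
  apply: eq_bigr => v _; rewrite (@innerC _ (dsum E) _ v) -!(adjointE (dsum_proj E i)) expr2.
  by rewrite (innerC p).
- have := congr1 (fun h : 'End(F j) => inner p (h p)) (QSid j).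
  by rewrite /= !comp_lfunE id_lfunE frame.
Qed.

End Geometric.

(** * The maximum principle *)

Section HeatNode.
Context {R : realType} {V : euclidean R}.
Implicit Types (x y z w p : V) (ws : seq V).

Definition parseval ws := forall p, \sum_(w <- ws) inner p w ^+ 2 = inner p p.

(** Both sides are the trace of the identity: the squared coordinates of the family are summed in
    the other order. *)
Lemma parseval_dim ws : parseval ws -> \sum_(w <- ws) inner w w = (dim V)%:R :> R.
Proof.
move=> P; under eq_bigr do rewrite inner_onb.
rewrite exchange_big /=.
under eq_bigr => i _.
  under eq_bigr do rewrite (innerC _ (tnth (onb V) i)) -expr2.
  rewrite P onbE eqxx; over.
by rewrite sumr_const card_ord.
Qed.

(* [g] is the gradient of the logarithm of [H = eps + heat_flow t q]; the last
   clause is the heat equation, a Parseval family [ws] turning the second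
   derivatives [2 b w] of [H] (divided by [H]) into the Laplacian. *)
Lemma heat_node (t : R) x (q : V -> R) (rho eps : R) : 0 < t -> bounded_borel q ->
  (forall y, rho < inner y y -> q y = 0) -> 0 < eps + heat_flow t q x ->
  exists (g : V) (b : V -> R) (tau : R), [/\
    forall w, taylor2 (fun s => ln (eps + heat_flow t q (x + s *: w)))
      (ln (eps + heat_flow t q x)) (inner g w) (b w - inner g w ^+ 2 / 2),
    taylor2 (fun s => ln (eps + heat_flow (t * expR (- s ^+ 2)) q x))
      (ln (eps + heat_flow t q x)) 0 tau &
    forall ws, parseval ws -> \sum_(w <- ws) b w = - tau / (2 * t)].
Proof.
move=> t0 bq q0 H0; pose H := eps + heat_flow t q x.
pose P := 2 * inner x x + 2 * rho.
have bqi w : bounded_borel (fun y => q y * inner w (x - y)).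
  apply: (bounded_borel_supp (C := inner w w * P + 1) bq q0 (measurable_innerB w x)) => y yr.
  by apply: inner_bound; exact: sqdist_bound.
have bqi2 w : bounded_borel (fun y => q y * inner w (x - y) ^+ 2).
  apply: (bounded_borel_supp (C := inner w w * P) bq q0).
    by apply: measurable_funX; exact: measurable_innerB.
  move=> y yr; rewrite ger0_norm ?sqr_ge0//.
  apply: le_trans (CauchySchwarz_inner _ _) _.
  by rewrite ler_wpM2l ?inner_ge0//; exact: sqdist_bound.
have bqn : bounded_borel (fun y => q y * inner (x - y) (x - y)).
  apply: (bounded_borel_supp (C := P) bq q0 (measurable_sqdist x)) => y yr.
  by rewrite ger0_norm ?inner_ge0//; exact: sqdist_bound.
pose A w := heat_flow t (fun y => q y * inner w (x - y)) x.
have AE w : heat_flow t (fun y => q y * (- (2 * t)^-1 * inner w (x - y))) x =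
    - (2 * t)^-1 * A w.
  by rewrite -heat_flowZ//; congr (heat_flow _ _ _); apply/funext => y; ring.
(* Linearity of [A] in the direction, made explicit on the basis so that a vector g represents
   it. *)
have Al w : A w = \sum_(i < dim V) A (tnth (onb V) i) * inner w (tnth (onb V) i).
  rewrite {1}/A (_ : (fun y => q y * inner w (x - y)) = fun y =>
      \sum_(i < dim V) inner w (tnth (onb V) i) * (q y * inner (tnth (onb V) i) (x - y))).
    rewrite heat_flow_sum//; last by move=> i; exact: bounded_borelZ.
    by apply: eq_bigr => i _; rewrite heat_flowZ// mulrC.
  apply/funext => y; rewrite inner_onb mulr_sumr; apply: eq_bigr => i _.
  by rewrite (innerC (x - y)); ring.
pose g := \sum_(i < dim V) (- (2 * t)^-1 * A (tnth (onb V) i) / H) *: tnth (onb V) i.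
have gE w : inner g w = - (2 * t)^-1 * A w / H.
  rewrite inner_suml Al mulr_sumr mulr_suml; apply: eq_bigr => i _.
  by rewrite innerZl (innerC w); ring.
pose N := heat_flow t (fun y => q y * inner (x - y) (x - y)) x.
pose B w := heat_flow t (fun y => q y * inner w (x - y) ^+ 2) x.
have BE w : heat_flow t (fun y => q y * (- inner w w / (4 * t) +
      (- (2 * t)^-1 * inner w (x - y)) ^+ 2 / 2)) x =
    (- inner w w / (4 * t)) * heat_flow t q x + (2 * t) ^- 2 / 2 * B w.
  rewrite -(heat_flowZ x _ t0 bq) -(heat_flowZ x _ t0 (bqi2 w)).
  rewrite -(heat_flowD x t0 (bounded_borelZ _ bq) (bounded_borelZ _ (bqi2 w))).
  by congr (heat_flow t _ x); apply/funext => y; field; rewrite gt_eqF.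
have NE : heat_flow t (fun y => q y * ((dim V)%:R / 2 - inner (x - y) (x - y) / (4 * t))) x =
    (dim V)%:R / 2 * heat_flow t q x + - (4 * t)^-1 * N.
  rewrite -(heat_flowZ x _ t0 bq) -(heat_flowZ x _ t0 bqn).
  rewrite -(heat_flowD x t0 (bounded_borelZ _ bq) (bounded_borelZ _ bqn)).
  by congr (heat_flow t _ x); apply/funext => y; field; rewrite gt_eqF.
exists g, (fun w => ((- inner w w / (4 * t)) * heat_flow t q x + (2 * t) ^- 2 / 2 * B w) / H),
  (((dim V)%:R / 2 * heat_flow t q x + - (4 * t)^-1 * N) / H); split.
- move=> w; rewrite gE.
  have := taylor2D (taylor2_cst eps) (heat_taylor_space x w t0 bq q0).
  by rewrite AE BE !add0r => /(taylor2_ln H0).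
- have := taylor2D (taylor2_cst eps) (heat_taylor_time x t0 bq q0).
  rewrite NE !add0r => /(taylor2_ln H0).
  by rewrite mul0r expr0n/= mul0r subr0.
(* Both sides equal (- n F / (4t) + N / (8t^2)) / H, where F is the heat flow and the dimension n
   arises as the sum of the <w, w>. *)
- move=> ws Pws; rewrite -mulr_suml big_split/= -mulr_suml -mulr_sumr.
  have -> : \sum_(w <- ws) B w = N.
    rewrite /B -(heat_flow_sum ws x t0 bqi2); congr (heat_flow t _ x).
    apply/funext => y.
    rewrite -mulr_sumr; congr (_ * _); rewrite -Pws.
    by apply: eq_bigr => w _; rewrite innerC.
  rewrite -mulr_suml sumrN parseval_dim//; field.
  by rewrite !gt_eqF.
Qed.

End HeatNode.

Definition dsum_of (R : realType) (n : nat) (G : 'I_n -> euclidean R)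
    (h : forall i, G i) : dsum G := [ffun i => h i] : dsum_type G.

Lemma dsum_of_proj (R : realType) (n : nat) (G : 'I_n -> euclidean R)
    (h : forall i, G i) i : dsum_proj G i (dsum_of h) = h i.
Proof. by rewrite dsum_projE /dsum_of ffunE. Qed.

(** * First and second order conditions at a maximum of positive time *)

Section NoInteriorMax.
Context {R : realType} {k m : nat} (E : 'I_k -> euclidean R) (F : 'I_m -> euclidean R).
Variable D : FRBL_datum E F.
Hypothesis geoD : FRBL_geometric D.
Variables (f : forall i, E i -> R) (g : forall j, F j -> R) (rho eps eta : R).
Arguments f : clear implicits.
Arguments g : clear implicits.
Hypotheses (bf : forall i, bounded_borel (f i)) (bg : forall j, bounded_borel (g j)).
Hypothesis f_supp : forall i y, rho < inner y y -> f i y = 0.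
Hypothesis g_supp : forall j y, rho < inner y y -> g j y = 0.
Hypothesis eta0 : 0 < eta.

(* The terms [0 + _] make the two sums instances of [heat_node]. *)
Definition log_ratio (t : R) (X : forall i, E i) (Y : forall j, F j) : R :=
  \sum_i FRBL_c D i * ln (0 + heat_flow t (f i) (X i)) +
  - 1 * \sum_j FRBL_d D j * ln (eps + heat_flow t (g j) (Y j)) +
  - eta * t.

Lemma log_ratio_no_max (t : R) (X : forall i, E i) (Y : forall j, F j) : 0 < t ->
  (forall i, 0 < 0 + heat_flow t (f i) (X i)) ->
  (forall j, 0 < eps + heat_flow t (g j) (Y j)) ->
  (forall w : dsum E, exists2 d : R, 0 < d &
    forall s, `|s| <= d -> log_ratio t (fun i => X i + s *: dsum_proj E i w)
      (fun j => Y j + s *: dsum_proj F j (FRBL_Q D w)) <= log_ratio t X Y) ->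
  (exists2 d : R, 0 < d &
    forall s, `|s| <= d -> log_ratio (t * expR (- s ^+ 2)) X Y <= log_ratio t X Y) ->
  False.
Proof.
move=> t0 Hf Hg max_x max_t.
have nf i := heat_node t0 (bf i) (f_supp (i := i)) (Hf i).
have ng j := heat_node t0 (bg j) (g_supp (j := j)) (Hg j).
(* The gradients are collected into vectors p and r of the direct sums, so that the first order
   condition can be tested in the direction p itself. *)
have [p pP] : exists p : dsum E, forall i, exists (b : E i -> R) (tau : R), [/\
    forall w, taylor2 (fun s => ln (0 + heat_flow t (f i) (X i + s *: w)))
      (ln (0 + heat_flow t (f i) (X i))) (inner (dsum_proj E i p) w)
      (b w - inner (dsum_proj E i p) w ^+ 2 / 2),
    taylor2 (fun s => ln (0 + heat_flow (t * expR (- s ^+ 2)) (f i) (X i)))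
      (ln (0 + heat_flow t (f i) (X i))) 0 tau &
    forall ws, parseval ws -> \sum_(w <- ws) b w = - tau / (2 * t)].
  exists (dsum_of (fun i => sval (cid (nf i)))) => i.
  by rewrite dsum_of_proj; case: cid.
have [r rP] : exists r : dsum F, forall j, exists (b : F j -> R) (tau : R), [/\
    forall w, taylor2 (fun s => ln (eps + heat_flow t (g j) (Y j + s *: w)))
      (ln (eps + heat_flow t (g j) (Y j))) (inner (dsum_proj F j r) w)
      (b w - inner (dsum_proj F j r) w ^+ 2 / 2),
    taylor2 (fun s => ln (eps + heat_flow (t * expR (- s ^+ 2)) (g j) (Y j)))
      (ln (eps + heat_flow t (g j) (Y j))) 0 tau &
    forall ws, parseval ws -> \sum_(w <- ws) b w = - tau / (2 * t)].
  exists (dsum_of (fun j => sval (cid (ng j)))) => j.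
  by rewrite dsum_of_proj; case: cid.
pose bf' i := sval (cid (pP i)); pose bg' j := sval (cid (rP j)).
pose tf i := sval (cid (svalP (cid (pP i)))).
pose tg j := sval (cid (svalP (cid (rP j)))).
have pP' i := svalP (cid (svalP (cid (pP i)))).
have rP' j := svalP (cid (svalP (cid (rP j)))).
rewrite -/(tf _) -/(bf' _) in pP'; rewrite -/(tg _) -/(bg' _) in rP'.
pose c := FRBL_c D; pose d := FRBL_d D; pose Q := FRBL_Q D.
have space (w : dsum E) :
    \sum_i c i * inner (dsum_proj E i p) (dsum_proj E i w) =
    \sum_j d j * inner (dsum_proj F j r) (dsum_proj F j (Q w)) /\
    \sum_i c i * (bf' i (dsum_proj E i w) - inner (dsum_proj E i p) (dsum_proj E i w) ^+ 2 / 2) <=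
    \sum_j d j * (bg' j (dsum_proj F j (Q w)) - inner (dsum_proj F j r) (dsum_proj F j (Q w)) ^+ 2 / 2).
  have [del del0 le_max] := max_x w.
  have T1 := taylor2_sum (fun i => taylor2Z (c i) (let: And3 h _ _ := pP' i in h (dsum_proj E i w))).
  have T2 := taylor2_sum (fun j => taylor2Z (d j) (let: And3 h _ _ := rP' j in h (dsum_proj F j (Q w)))).
  have T3 := taylor2D (taylor2D T1 (taylor2Z (-1) T2)) (taylor2_cst (- eta * t)).
  have [|c1 c2] := taylor2_max del0 T3.
    by move=> s /le_max; exact.
  by split; lra.
(* Along t exp(-s^2) the term - eta t contributes + eta t to the coefficient of s^2. *)
have time : \sum_i c i * tf i - \sum_j d j * tg j <= - eta * t.
  have [del del0 le_max] := max_t.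
  have T1 := taylor2_sum (fun i => taylor2Z (c i) (let: And3 _ h _ := pP' i in h)).
  have T2 := taylor2_sum (fun j => taylor2Z (d j) (let: And3 _ h _ := rP' j in h)).
  have T0 : taylor2 (fun s : R => expR (- s ^+ 2)) 1 0 (- 1).
    exists (2 : R), (1 / 2 : R); split => // s s12.
    have s2 : `|- s ^+ 2| <= 1 / 2.
      by rewrite normrN normrX; have := normr_ge0 s; nra.
    rewrite (_ : _ - _ = expR (- s ^+ 2) - 1 - (- s ^+ 2)); last by ring.
    apply: le_trans (expR_bound2 s2) _; rewrite ler_wpM2l// normrN normrX -exprM.
    by rewrite (_ : (2 * 2)%N = 4%N)// (exprSr _ 3) ler_piMr ?exprn_ge0//; lra.
  have T3 := taylor2D (taylor2D T1 (taylor2Z (-1) T2)) (taylor2Z (- eta * t) T0).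
  have [|_ c2] := taylor2_max del0 T3; last by lra.
  move=> s /le_max; rewrite /log_ratio mulr1; congr (_ <= _); congr (_ + _).
  by rewrite mulrA.
have [vs [vsE vsF]] := geometric_frame geoD.
have parE i : parseval [seq dsum_proj E i v | v <- vs].
  by move=> q; rewrite big_map vsE.
have parF j : parseval [seq dsum_proj F j (Q v) | v <- vs].
  by move=> q; rewrite big_map vsF.
have sumE i : \sum_(v <- vs) (bf' i (dsum_proj E i v) -
    inner (dsum_proj E i p) (dsum_proj E i v) ^+ 2 / 2) =
    - tf i / (2 * t) - inner (dsum_proj E i p) (dsum_proj E i p) / 2.
  rewrite big_split/= sumrN -mulr_suml vsE; congr (_ - _).
  by case: (pP' i) => _ _ /(_ _ (parE i)); rewrite big_map.
have sumF j : \sum_(v <- vs) (bg' j (dsum_proj F j (Q v)) -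
    inner (dsum_proj F j r) (dsum_proj F j (Q v)) ^+ 2 / 2) =
    - tg j / (2 * t) - inner (dsum_proj F j r) (dsum_proj F j r) / 2.
  rewrite big_split/= sumrN -mulr_suml vsF; congr (_ - _).
  by case: (rP' j) => _ _ /(_ _ (parF j)); rewrite big_map.
(* Sum of the second order conditions over the frame: squared directional gradients become squared
   norms, and the remaining terms become - tau / (2t). *)
have second : \sum_i c i * (- tf i / (2 * t) - inner (dsum_proj E i p) (dsum_proj E i p) / 2) <=
    \sum_j d j * (- tg j / (2 * t) - inner (dsum_proj F j r) (dsum_proj F j r) / 2).
  under eq_bigr do rewrite -sumE mulr_sumr.
  under [leRHS]eq_bigr do rewrite -sumF mulr_sumr.
  rewrite exchange_big [leRHS]exchange_big /=.
  by apply: ler_sum => v _; have [] := space v.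
have split_sum n (a u v : 'I_n -> R) : \sum_i a i * (- u i / (2 * t) - v i / 2) =
    - (2 * t)^-1 * \sum_i a i * u i - 2^-1 * \sum_i a i * v i.
  rewrite !mulr_sumr -sumrB; apply: eq_bigr => i _; field.
  by rewrite gt_eqF.
rewrite !split_sum in second.
set Cp := \sum_i c i * inner (dsum_proj E i p) (dsum_proj E i p) in second.
set Dr := \sum_j d j * inner (dsum_proj F j r) (dsum_proj F j r) in second.
have [first _] := space p; rewrite -/Cp in first.
have geo : \sum_j d j * inner (dsum_proj F j (Q p)) (dsum_proj F j (Q p)) <= Cp.
  exact: geometric_le.
(* Expand <Lambda_d (r - Qp), r - Qp> >= 0: by the first order condition in the direction p the
   mixed term is - 2 [Cp], and the geometric inequality bounds the last term by [Cp]. *)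
have DC : Cp <= Dr.
  have : 0 <= \sum_j d j * inner (dsum_proj F j r - dsum_proj F j (Q p))
      (dsum_proj F j r - dsum_proj F j (Q p)).
    apply: sumr_ge0 => j _; rewrite mulr_ge0 ?inner_ge0// ltW//.
    exact: FRBL_d_gt0.
  have -> : \sum_j d j * inner (dsum_proj F j r - dsum_proj F j (Q p))
      (dsum_proj F j r - dsum_proj F j (Q p)) =
      Dr - 2 * Cp + \sum_j d j * inner (dsum_proj F j (Q p)) (dsum_proj F j (Q p)).
    rewrite first /Dr mulr_sumr -sumrB -big_split/=; apply: eq_bigr => j _.
    rewrite innerBl !innerBr (innerC (dsum_proj F j (Q p)) (dsum_proj F j r)); ring.
  lra.
have : (2 * t)^-1 * (\sum_i c i * tf i - \sum_j d j * tg j) <= - (eta / 2).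
  have -> : - (eta / 2) = (2 * t)^-1 * (- eta * t) by field; rewrite gt_eqF.
  by rewrite ler_wpM2l// invr_ge0 mulr_ge0// ltW.
by move: second DC eta0; rewrite mulrBr; lra.
Qed.

End NoInteriorMax.

(** * Upper limits along filters and maxima on compact sets *)

Section NearUsc.
Context {R : realType} {T : Type} (F : set_system T) {FF : Filter F}.
Implicit Types (u v : T -> R) (a b c e : R).

(** An upper limit bound. The filter is left free since it serves both neighbourhoods in space-time
    and the final limit at 0 from the right. *)
Definition near_usc u a := forall e, 0 < e -> \forall z \near F, u z <= a + e.

Lemma near_uscM u v a b : (forall z, 0 <= u z) -> (forall z, 0 <= v z) ->
  0 <= a -> 0 <= b -> near_usc u a -> near_usc v b ->
  near_usc (fun z => u z * v z) (a * b).
Proof.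
move=> u0 v0 a0 b0 ua vb e e0.
have ab1 : 0 < a + b + 1 by rewrite ltr_wpDl// addr_ge0.
(* For d <= 1, (a + d)(b + d) <= a b + d (a + b + 1). *)
pose d := Num.min 1 (e / (a + b + 1)).
have d0 : 0 < d by rewrite lt_min ltr01 divr_gt0.
have d1 : d <= 1 by rewrite ge_min lexx.
have de : d * (a + b + 1) <= e by rewrite -ler_pdivlMr// ge_min lexx orbT.
apply: filterS2 (ua d d0) (vb d d0) => z uz vz.
apply: le_trans (ler_pM (u0 z) (v0 z) uz vz) _.
nra.
Qed.

Lemma powR_right a c e : 0 <= a -> 0 < c -> 0 < e ->
  exists2 d : R, 0 < d & (a + d) `^ c <= a `^ c + e.
Proof.
move=> a0 c0 e0; have [->|an0] := eqVneq a 0.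
  exists (e `^ c^-1); first exact: powR_gt0.
  by rewrite add0r -powRrM mulVf ?gt_eqF// powRr1 ?(ltW e0)// powR0 ?gt_eqF// add0r.
have {an0} ap : 0 < a by rewrite lt_neqAle eq_sym an0.
have pa : 0 < a `^ c by exact: powR_gt0.
(* Then (1 + v)^c <= exp(c v) = 1 + e / a^c. *)
pose v := ln (1 + e / a `^ c) / c.
have v0 : 0 < v.
  by apply: divr_gt0 => //; apply: ln_gt0; rewrite ltrDl; exact: divr_gt0.
exists (a * v); first by rewrite mulr_gt0.
have -> : a + a * v = a * (1 + v) by ring.
have v1 : 0 <= 1 + v by rewrite addr_ge0// ltW.
rewrite powRM// (le_trans (y := a `^ c * (1 + e / a `^ c)))//; last first.
  by rewrite mulrDr mulr1 [X in _ + X]mulrC divfK ?gt_eqF.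
rewrite ler_wpM2l ?(ltW pa)// [leLHS]/powR gt_eqF ?ltr_wpDr ?(ltW v0)//.
rewrite -[leRHS](lnK (x := 1 + _)); last by rewrite posrE addr_gt0// divr_gt0.
rewrite ler_expR; have : ln (1 + v) <= v by apply: le_ln1Dx; apply: lt_trans v0; rewrite ltrN10.
move=> /(ler_wpM2l (ltW c0)) h; apply: le_trans h _.
by rewrite /v mulrC divfK ?gt_eqF.
Qed.

Lemma near_usc_powR u a c : (forall z, 0 <= u z) -> 0 <= a -> 0 < c ->
  near_usc u a -> near_usc (fun z => u z `^ c) (a `^ c).
Proof.
move=> u0 a0 c0 ua e e0; have [d d0 dP] := powR_right a0 c0 e0.
apply: filterS (ua d d0) => z uz; apply: le_trans dP.
by apply: ge0_ler_powR; rewrite ?nnegrE ?(ltW c0)// addr_ge0// ltW.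
Qed.

Lemma near_usc_prod n (u : 'I_n -> T -> R) (a : 'I_n -> R) :
  (forall i z, 0 <= u i z) -> (forall i, 0 <= a i) -> (forall i, near_usc (u i) (a i)) ->
  near_usc (fun z => \prod_i u i z) (\prod_i a i).
Proof.
move=> u0 a0 ua; elim: (index_enum _) => [|i r IH].
  rewrite big_nil => e e0; apply: filterE => z; rewrite big_nil lerDl; exact: ltW.
under eq_fun do rewrite big_cons; rewrite big_cons; apply: near_uscM => //.
- by move=> z; exact: prodr_ge0.
- exact: prodr_ge0.
Qed.

Lemma near_usc_inv u a : 0 < a -> (forall z, 0 < u z) ->
  near_usc (fun z => - u z) (- a) -> near_usc (fun z => (u z)^-1) a^-1.
Proof.
move=> a0 u0 ua e e0.
have ae0 : 0 < 1 + a * e by rewrite addr_gt0// mulr_gt0.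
(* The solution of 1/(a - d) = 1/a + e. *)
pose d := a * (a * e) / (1 + a * e).
have d0 : 0 < d by rewrite divr_gt0 ?mulr_gt0.
apply: filterS (ua d d0) => z; rewrite lerNl opprD opprK => uz.
have -> : a^-1 + e = (a - d)^-1.
  rewrite /d; field; rewrite !gt_eqF//= -?mulrA.
  by rewrite (_ : _ - _ = a) ?gt_eqF//; ring.
rewrite lef_pV2 ?posrE//.
have -> : a - d = a / (1 + a * e) by rewrite /d; field; rewrite gt_eqF.
by rewrite divr_gt0.
Qed.

End NearUsc.

(** Without a maximum, every point of [A] has a neighbourhood in [A] on which [u] lies below some
    value u q0. Near-covering compactness for the filter of superlevel sets makes this uniform: some
    q0 in [A] has u z < u q0 for all z in [A], absurd at z = q0. *)
Lemma compact_usc_max (R : realType) (T : topologicalType) (A : set T) (u : T -> R) :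
  compact A -> A !=set0 ->
  (forall p, A p -> near_usc (within A (nbhs p)) u (u p)) ->
  exists2 p, A p & forall z, A z -> u z <= u p.
Proof.
move=> /compact_near_coveringP/near_covering_withinP cA [a0 Aa0] usc_u.
apply: contrapT => nomax.
have bigger p : A p -> exists2 q, A q & u p < u q.
  move=> Ap; apply: contrapT => np; apply: nomax; exists p => // z Az.
  by rewrite leNgt; apply/negP => pz; apply: np; exists z.
pose F := filter_from A (fun q0 => [set q | A q /\ u q0 <= u q]).
have FF : Filter F.
  apply: filter_from_filter; first by exists a0.
  move=> q r Aq Ar; have [qr|/ltW rq] := leP (u q) (u r).
    by exists r => // z [Az rz]; split; split => //; exact: le_trans rz.
  by exists q => // z [Az qz]; split; split => //; exact: le_trans qz.
have /cA : forall p, A p -> \forall x' \near p & q \near F, A x' -> u x' < u q.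
  move=> p /[dup] Ap /bigger[q0 Aq0 pq0].
  have e0 : 0 < (u q0 - u p) / 2 by rewrite divr_gt0// subr_gt0.
  exists ([set z | A z -> u z <= u p + (u q0 - u p) / 2], [set q | A q /\ u q0 <= u q]).
    by split => /=; [exact: (usc_u p Ap _ e0)|exists q0].
  move=> [z q] /= [zp [Aq q0q]] Az; apply: le_lt_trans (zp Az) _; lra.
move=> [q0 Aq0 /(_ q0)] /= H.
by have := H (conj Aq0 (lexx _)) q0 Aq0; rewrite ltxx.
Qed.

Section HeatExt.
Context {R : realType} {V : euclidean R}.
Implicit Types (q : V -> R) (x : V) (t : R).

Lemma heat_ext0 q x : heat_ext 0 q x = q x.
Proof. by rewrite /heat_ext eqxx. Qed.

Lemma heat_ext_gt0 t q x : 0 < t -> heat_ext t q x = heat_flow t q x.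
Proof. by move=> t0; rewrite /heat_ext gt_eqF. Qed.

Lemma heat_ext_ge0 t q x : (forall y, 0 <= q y) -> 0 <= heat_ext t q x.
Proof. by move=> q0; rewrite /heat_ext; case: ifP => // _; exact: heat_flow_ge0. Qed.

Lemma heat_ext_le t q x (M : R) : 0 <= t -> bounded_borel q -> (forall y, q y <= M) ->
  heat_ext t q x <= M.
Proof.
move=> t0 bq qM; have [->|tn0] := eqVneq t 0; first by rewrite heat_ext0.
have tp : 0 < t by rewrite lt_neqAle eq_sym tn0.
rewrite heat_ext_gt0// -[leRHS](heat_flow_cst x M tp).
by apply: heat_flow_le => //; exact: bounded_borel_cst.
Qed.

Lemma heat_extN t q x : 0 <= t -> bounded_borel q ->
  heat_ext t (fun y => - q y) x = - heat_ext t q x.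
Proof.
move=> t0 bq; have [->|tn0] := eqVneq t 0; first by rewrite !heat_ext0.
have tp : 0 < t by rewrite lt_neqAle eq_sym tn0.
rewrite !heat_ext_gt0// -mulN1r -(heat_flowZ x _ tp bq).
by congr (heat_flow t _ x); apply/funext => y; rewrite mulN1r.
Qed.

(** At t0 = 0 only upper semicontinuity of the data is available; at t0 > 0 the heat flow is
    continuous, and the minimum with t0 keeps nearby times positive. *)
Lemma heat_ext_near_usc (T : Type) (G : set_system T) {FG : Filter G}
    (tau : T -> R) (X : T -> V) q (rho t0 : R) (x0 : V) :
  bounded_borel q -> inner_usc q -> (forall y, rho < inner y y -> q y = 0) -> 0 <= t0 ->
  (forall d, 0 < d -> \forall z \near G, 0 <= tau z /\ `|tau z - t0| < d) ->
  (forall d, 0 < d -> \forall z \near G, inner (X z - x0) (X z - x0) < d) ->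
  near_usc G (fun z => heat_ext (tau z) q (X z)) (heat_ext t0 q x0).
Proof.
move=> bq uq q0 t00 ct cX e e0.
have [t0E|tn0] := eqVneq t0 0.
  have [d d0 dP] := heat_ext_usc0 x0 bq uq e0.
  rewrite t0E heat_ext0; apply: filterS2 (ct d d0) (cX d d0) => z [z0 zd] xd.
  apply: dP => //; rewrite z0/=; apply: le_lt_trans zd.
  by rewrite t0E subr0 ler_norm.
have tp : 0 < t0 by rewrite lt_neqAle eq_sym tn0.
have [d d0 dP] := heat_flow_continuous x0 tp bq q0 e0.
have m0 : 0 < Num.min d t0 by rewrite lt_min d0.
apply: filterS2 (ct _ m0) (cX d d0) => z [z0]; rewrite lt_min => /andP[zd zt] xd.
have tz : 0 < tau z by move: zt; rewrite ltr_norml => /andP[+ _]; lra.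
rewrite !heat_ext_gt0//; have := dP _ _ zd xd.
by rewrite ler_norml => /andP[_]; rewrite lerBlDl.
Qed.

End HeatExt.

Section Coordinates.
Context {R : realType}.

Lemma inner_of_coord (V : euclidean R) (y y' : (dim V).-tuple R) :
  inner (of_coord y : V) (of_coord y') = \sum_i tnth y i * tnth y' i.
Proof.
rewrite inner_onb; apply: eq_bigr => i _.
by rewrite -{2}(of_coordK y) -{2}(of_coordK y') !tnth_mktuple.
Qed.

(** Row vectors carry the product topology, in which closed boxes are compact; the space-time
    maximum is sought in these coordinates. *)
Definition row_pt (V : euclidean R) (r : 'rV[R]_(dim V)) : V :=
  of_coord [tuple r ord0 i | i < dim V].

Lemma row_ptK (V : euclidean R) (x : V) :
  row_pt (\row_i tnth (to_coord x) i) = x.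
Proof.
rewrite -[RHS]to_coordK; congr of_coord; apply: eq_from_tnth => i.
by rewrite tnth_mktuple mxE.
Qed.

Lemma sqdist_row_pt (V : euclidean R) (r r' : 'rV[R]_(dim V)) :
  inner (row_pt r - row_pt r') (row_pt r - row_pt r') =
  \sum_i (r ord0 i - r' ord0 i) ^+ 2.
Proof.
have -> : row_pt r - row_pt r' = of_coord [tuple r ord0 i - r' ord0 i | i < dim V].
  rewrite /row_pt /of_coord -sumrB; apply: eq_bigr => i _.
  by rewrite !tnth_mktuple scalerBl.
rewrite inner_of_coord; apply: eq_bigr => i _.
by rewrite !tnth_mktuple expr2.
Qed.

Lemma row_pt_near (V : euclidean R) (r0 : 'rV[R]_(dim V)) (d : R) : 0 < d ->
  \forall r \near r0, inner (row_pt r - row_pt r0) (row_pt r - row_pt r0) < d.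
Proof.
move=> d0; pose n : R := (dim V)%:R.
have n1 : 0 < n + 1 by rewrite ltr_wpDl.
pose e := Num.min 1 (d / (n + 1)).
have e0 : 0 < e by rewrite lt_min ltr01 divr_gt0.
apply/nbhs_ballP; exists e => //= r [_ rr].
rewrite sqdist_row_pt.
have ed : e * (n + 1) <= d by rewrite -ler_pdivlMr// ge_min lexx orbT.
have e1 : e <= 1 by rewrite ge_min lexx.
apply: (@le_lt_trans _ _ (n * e)); last by move: ed e0; lra.
have -> : n * e = \sum_(i < dim V) e by rewrite sumr_const card_ord mulr_natl.
apply: ler_sum => i _; have := rr ord0 i; rewrite /ball/= => h.
have -> : (r ord0 i - r0 ord0 i) ^+ 2 = `|r0 ord0 i - r ord0 i| ^+ 2.
  by rewrite real_normK ?num_real//; ring.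
have := normr_ge0 (r0 ord0 i - r ord0 i); nra.
Qed.

Lemma inner_dsum n (G : 'I_n -> euclidean R) (x y : dsum G) :
  inner x y = \sum_i inner (dsum_proj G i x) (dsum_proj G i y).
Proof. by rewrite {1}/inner/= /dsum_dot; apply: eq_bigr => i _; rewrite !dsum_projE. Qed.

Lemma inner_proj_le n (G : 'I_n -> euclidean R) (x : dsum G) i :
  inner (dsum_proj G i x) (dsum_proj G i x) <= inner x x.
Proof.
by rewrite inner_dsum (bigD1 i)//= lerDl sumr_ge0// => j _; exact: inner_ge0.
Qed.

End Coordinates.

Lemma taylor2_gt0 (R : realType) (phi : R -> R) (a b c : R) : 0 < a -> taylor2 phi a b c ->
  exists2 d : R, 0 < d & forall s, `|s| <= d -> 0 < phi s.
Proof.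
move=> a0 [C [d [d0 H]]]; pose K := `|b| + `|c| + `|C| + 1.
have K0 : 0 < K by rewrite ltr_wpDl// !addr_ge0.
exists (Num.min d (Num.min 1 (a / (2 * K)))).
  by rewrite !lt_min d0 ltr01 divr_gt0// mulr_gt0.
move=> s; rewrite !le_min => /and3P[sd s1 sK]; have := H s sd.
have u0 := normr_ge0 s; set u := `|s| in sd s1 sK u0 *.
have uK : u * (2 * K) <= a by rewrite -ler_pdivlMr// mulr_gt0.
have s2 : s ^+ 2 = u ^+ 2 by rewrite /u real_normK// num_real.
have u2 : u ^+ 2 <= u by rewrite expr2 ler_piMr.
have u3 : u ^+ 3 <= u by rewrite exprSr (le_trans _ u2)// ler_piMr ?sqr_ge0.
have h1 : C * u ^+ 3 <= `|C| * u.
  by apply: (@le_trans _ _ (`|C| * u ^+ 3)); [rewrite ler_wpM2r ?exprn_ge0// ler_norm|rewrite ler_wpM2l].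
have h2 : - (`|b| * u) <= b * s by rewrite lerNl -mulrN (le_trans (ler_norm _))// normrM normrN.
have h3 : - (`|c| * u) <= c * s ^+ 2.
  rewrite s2 lerNl -mulNr (@le_trans _ _ (`|c| * u ^+ 2))//.
    by rewrite ler_wpM2r ?sqr_ge0// -normrN ler_norm.
  by rewrite ler_wpM2l.
rewrite ler_norml => /andP[h4 _].
have : 2 * (K * u) <= a by lra.
have : K * u = `|b| * u + `|c| * u + `|C| * u + u by rewrite /K; ring.
clear -h1 h2 h3 h4 a0 u0; lra.
Qed.

Lemma ord_min_radius (R : realType) (n : nat) (P : 'I_n -> R -> Prop) :
  (forall i, exists2 d : R, 0 < d & forall s, `|s| <= d -> P i s) ->
  exists2 d : R, 0 < d & forall s, `|s| <= d -> forall i, P i s.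
Proof.
move=> H; have /choice[d dP] : forall i, exists d : R, 0 < d /\ forall s, `|s| <= d -> P i s.
  by move=> i; have [d d0 dP] := H i; exists d.
exists (\big[Num.min/1]_i d i).
  by apply: lt_bigmin => // i _; have [] := dP i.
move=> s sd i; have [_] := dP i; apply; apply: le_trans sd _.
exact: bigmin_le.
Qed.

#[local] Opaque dsum_proj.

(** * Semicontinuity, decay and global bound of the ratio *)

Section MaxPrinciple.
Context {R : realType} {k m : nat} (E : 'I_k -> euclidean R) (F : 'I_m -> euclidean R).
Variable D : FRBL_datum E F.
Hypothesis geoD : FRBL_geometric D.
Variables (f : forall i, E i -> R) (g : forall j, F j -> R) (rho eps eta M T : R).
Arguments f : clear implicits.
Arguments g : clear implicits.
Hypotheses (bf : forall i, bounded_borel (f i)) (bg : forall j, bounded_borel (g j)).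
Hypotheses (uf : forall i, inner_usc (f i)) (ug : forall j, inner_usc (fun y => - g j y)).
Hypothesis f_supp : forall i y, rho < inner y y -> f i y = 0.
Hypothesis g_supp : forall j y, rho < inner y y -> g j y = 0.
Hypotheses (fM : forall i y, 0 <= f i y <= M) (g0 : forall j y, 0 <= g j y).
Arguments uf : clear implicits.
Arguments ug : clear implicits.
Arguments f_supp : clear implicits.
Arguments g_supp : clear implicits.
Arguments fM : clear implicits.
Arguments g0 : clear implicits.
Hypotheses (eps0 : 0 < eps) (eta0 : 0 < eta) (M1 : 1 <= M) (T0 : 0 < T).
Hypothesis init : forall x : dsum E,
  \prod_i f i (dsum_proj E i x) `^ FRBL_c D i <=
  \prod_j (eps + g j (dsum_proj F j (FRBL_Q D x))) `^ FRBL_d D j.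

Let c := FRBL_c D.
Let d := FRBL_d D.
Let Q := FRBL_Q D.
Let U i t (x : dsum E) := heat_ext t (f i) (dsum_proj E i x).
Let G j t (x : dsum E) := eps + heat_ext t (g j) (dsum_proj F j (Q x)).

(** Multiplicative rather than the exponential of [log_ratio], so that it is 0 where some [U]
    vanishes; the two agree at positive times where all [U] are positive. *)
Definition heat_ratio (t : R) (x : dsum E) : R :=
  expR (- eta * t) * (\prod_i U i t x `^ c i) * \prod_j (G j t x)^-1 `^ d j.

Let c0 i : 0 < c i. Proof. exact: FRBL_c_gt0. Qed.
Let d0 j : 0 < d j. Proof. exact: FRBL_d_gt0. Qed.
Let f0 i (y : E i) : 0 <= f i y. Proof. by have /andP[] := fM i y. Qed.
Arguments f0 : clear implicits.
Let U0 i t x : 0 <= U i t x. Proof. by apply: heat_ext_ge0 => y; exact: f0. Qed.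
Let UM i t x : 0 <= t -> U i t x <= M.
Proof. by move=> t0; apply: heat_ext_le => // y; have /andP[] := fM i y. Qed.
Let Ge j t x : eps <= G j t x.
Proof. by rewrite lerDl; apply: heat_ext_ge0 => y; exact: g0. Qed.
Let G0 j t x : 0 < G j t x. Proof. exact: lt_le_trans (Ge j t x). Qed.

Lemma heat_ratio_init x : heat_ratio 0 x <= 1.
Proof.
rewrite /heat_ratio mulr0 expR0 mul1r.
have GP : 0 < \prod_j G j 0 x `^ d j by apply: prodr_gt0 => j _; exact: powR_gt0.
have -> : \prod_j (G j 0 x)^-1 `^ d j = (\prod_j G j 0 x `^ d j)^-1.
  rewrite -prodfV; apply: eq_bigr => j _.
  by rewrite -powR_inv1 ?ltW// -powRrM mulN1r powRN.
rewrite ler_pdivrMr// mul1r.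
under eq_bigr do rewrite /U heat_ext0; under [leRHS]eq_bigr do rewrite /G heat_ext0.
exact: init.
Qed.

(** If |x| is large then some component x_i is large, and its factor falls below 1/W while W bounds
    all the other factors together. Since M >= 1, having M^(c_i) inside W does no harm. *)
Lemma heat_ratio_decay : exists2 L : R, 1 <= L & forall t x, 0 <= t <= T ->
  L <= inner x x -> heat_ratio t x <= 1.
Proof.
pose W := (\prod_i M `^ c i) * \prod_j eps^-1 `^ d j.
have M0 : 0 < M by exact: lt_le_trans M1.
have WM0 : 0 < \prod_i M `^ c i by apply: prodr_gt0 => i _; exact: powR_gt0.
have We0 : 0 < \prod_j eps^-1 `^ d j.
  by apply: prodr_gt0 => j _; apply: powR_gt0; rewrite invr_gt0.
have W0 : 0 < W by exact: mulr_gt0.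
pose kap i := W^-1 `^ (c i)^-1.
have kap0 i : 0 < kap i by apply: powR_gt0; rewrite invr_gt0.
have /choice[s sP] : forall i, exists s : R, forall t x, 0 <= t <= T ->
    s <= inner x x -> heat_ext t (f i) x <= kap i.
  move=> i; exact: (heat_ext_decay (bf i) T0 (kap0 i) (fM i) (f_supp i)).
(* The 1 makes the pigeonhole strict, also when there are no summands, and gives 1 <= L. *)
exists (1 + \sum_i `|s i|); first by rewrite lerDl sumr_ge0.
move=> t x tT sx; have /andP[t0 _] := tT.
have [i si] : exists i, s i <= inner (dsum_proj E i x) (dsum_proj E i x).
  apply: contrapT => /forallNP ns; move: sx; apply/negP; rewrite -ltNge inner_dsum.
  apply: (@le_lt_trans _ _ (\sum_i `|s i|)); last by rewrite ltrDr.
  apply: ler_sum => i _; have := ns i; move=> /negP; rewrite -ltNge => /ltW h.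
  exact: le_trans h (ler_norm _).
have Ui : U i t x `^ c i <= W^-1.
  have -> : W^-1 = kap i `^ c i.
    by rewrite /kap -powRrM mulVf ?gt_eqF// powRr1// invr_ge0 ltW.
  by apply: ge0_ler_powR; rewrite ?nnegrE ?(ltW (c0 i)) ?(ltW (kap0 i))//; exact: sP.
have UP : \prod_i U i t x `^ c i <= W^-1 * \prod_i M `^ c i.
  rewrite (bigD1 i)//= [in leRHS](bigD1 i)//= ler_pM ?powR_ge0//.
    by apply: prodr_ge0 => l _; exact: powR_ge0.
  apply: (@le_trans _ _ (\prod_(l | l != i) M `^ c l)).
    apply: ler_prod => l _; rewrite powR_ge0/=; apply: ge0_ler_powR;
    by rewrite ?nnegrE ?(ltW (c0 l)) ?(ltW M0)// UM.
  rewrite ler_peMl//; first by apply: prodr_ge0 => l _; exact: powR_ge0.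
  by rewrite -(powRr0 M); apply: ler_powR => //; exact: ltW.
have GP : \prod_j (G j t x)^-1 `^ d j <= \prod_j eps^-1 `^ d j.
  apply: ler_prod => j _; rewrite powR_ge0/=; apply: ge0_ler_powR.
  - exact: ltW.
  - by rewrite nnegrE invr_ge0 ltW.
  - by rewrite nnegrE invr_ge0 ltW.
  - by rewrite lef_pV2 ?posrE.
have E1 : expR (- eta * t) <= 1 by rewrite -expR0 ler_expR mulNr oppr_le0 mulr_ge0// ltW.
have UP0 : 0 <= \prod_i U i t x `^ c i by apply: prodr_ge0 => l _; exact: powR_ge0.
have GP0 : 0 <= \prod_j (G j t x)^-1 `^ d j by apply: prodr_ge0 => l _; exact: powR_ge0.
rewrite /heat_ratio -mulrA (le_trans (ler_piMl _ E1))//; first exact: mulr_ge0.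
rewrite (le_trans (ler_pM UP0 GP0 UP GP))//.
by rewrite -mulrA -/W mulVf// gt_eqF.
Qed.

Lemma heat_ratioE t x : 0 < t -> (forall i, 0 < U i t x) ->
  heat_ratio t x = expR (log_ratio D f g eps eta t
    (fun i => dsum_proj E i x) (fun j => dsum_proj F j (Q x))).
Proof.
move=> t0 Up; rewrite /log_ratio !expRD /heat_ratio.
rewrite -[LHS]mulrA [LHS]mulrC; congr (_ * _ * _).
- rewrite expR_sum; apply: eq_bigr => i _.
  by rewrite add0r /powR gt_eqF// /U heat_ext_gt0.
- rewrite mulr_sumr expR_sum; apply: eq_bigr => j _.
  rewrite /powR gt_eqF ?invr_gt0// lnV ?posrE// /G heat_ext_gt0//; congr expR; rewrite /d; ring.
Qed.

Lemma heat_ratio_near_usc (S : Type) (B : set_system S) {FB : Filter B}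
    (tau : S -> R) (X : S -> dsum E) (t0 : R) (x0 : dsum E) : 0 <= t0 ->
  (forall e, 0 < e -> \forall z \near B, 0 <= tau z /\ `|tau z - t0| < e) ->
  (forall e, 0 < e -> \forall z \near B, inner (X z - x0) (X z - x0) < e) ->
  near_usc B (fun z => heat_ratio (tau z) (X z)) (heat_ratio t0 x0).
Proof.
move=> t00 ct cX.
have Xi i e : 0 < e -> \forall z \near B,
    inner (dsum_proj E i (X z) - dsum_proj E i x0) (dsum_proj E i (X z) - dsum_proj E i x0) < e.
  move=> e0; apply: filterS (cX e e0) => z; apply: le_lt_trans.
  by rewrite -linearB; exact: inner_proj_le.
pose K : R := \sum_i c i.
have K0 : 0 <= K by apply: sumr_ge0 => i _; exact: ltW.
(* The geometric inequality doubles as a continuity estimate for the components of Q. *)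
have QK j (u : dsum E) : d j * inner (dsum_proj F j (Q u)) (dsum_proj F j (Q u)) <= K * inner u u.
  apply: (@le_trans _ _ (\sum_j d j * inner (dsum_proj F j (Q u)) (dsum_proj F j (Q u)))).
    rewrite (bigD1 j)//= lerDl sumr_ge0// => l _.
    by rewrite mulr_ge0 ?inner_ge0// ltW.
  apply: (le_trans (geometric_le u geoD)); rewrite mulr_suml; apply: ler_sum => i _.
  by rewrite ler_wpM2l ?(ltW (c0 i))//; exact: inner_proj_le.
have Xj j e : 0 < e -> \forall z \near B,
    inner (dsum_proj F j (Q (X z)) - dsum_proj F j (Q x0))
      (dsum_proj F j (Q (X z)) - dsum_proj F j (Q x0)) < e.
  move=> e0; have K1 : 0 < K + 1 by rewrite ltr_wpDl.
  have e'0 : 0 < d j * e / (K + 1) by rewrite divr_gt0// mulr_gt0.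
  apply: filterS (cX _ e'0) => z; rewrite ltr_pdivlMr// => h.
  rewrite -linearB -(linearB Q) -(ltr_pM2l (d0 j)).
  apply: le_lt_trans (QK j _) _; apply: le_lt_trans h.
  by rewrite mulrC ler_wpM2l ?inner_ge0// lerDl.
have UU i : near_usc B (fun z => U i (tau z) (X z)) (U i t0 x0).
  exact: (heat_ext_near_usc (bf i) (uf i) (f_supp i) t00 ct (Xi i)).
have GG j : near_usc B (fun z => (G j (tau z) (X z))^-1) (G j t0 x0)^-1.
  apply: near_usc_inv => //.
  have bgN : bounded_borel (fun y => - g j y).
    by have := bounded_borelZ (-1) (bg j); under eq_fun do rewrite mulN1r.
  have gsN y : rho < inner y y -> - g j y = 0 by move=> /(g_supp j) ->; rewrite oppr0.
  have H := heat_ext_near_usc bgN (ug j) gsN t00 ct (Xj j).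
  move=> e e0; apply: filterS2 (H FB e e0) (ct e e0) => z + [z0 _].
  by rewrite !heat_extN// /G; lra.
have EE : near_usc B (fun z => expR (- eta * tau z)) (expR (- eta * t0)).
  have ce : {for t0, continuous (fun t : R => expR (- eta * t))}.
    apply: continuous_comp; first exact: mulrl_continuous.
    exact: continuous_expR.
  move=> e e0; have /nbhs_ballP[e1 /= e10 H] : \forall t \near t0,
      `|expR (- eta * t0) - expR (- eta * t)| < e.
    by move/cvgrPdist_lt : ce; apply.
  apply: filterS (ct _ e10) => z [_ zt].
  have := H (tau z); rewrite /ball/= distrC => /(_ zt).
  by rewrite distrC => /ltW/(le_trans (ler_norm _)); rewrite lerBlDl.
apply: near_uscM.
- by move=> z; rewrite mulr_ge0 ?expR_ge0// prodr_ge0// => i _; exact: powR_ge0.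
- by move=> z; apply: prodr_ge0 => j _; exact: powR_ge0.
- by rewrite mulr_ge0 ?expR_ge0// prodr_ge0// => i _; exact: powR_ge0.
- by apply: prodr_ge0 => j _; exact: powR_ge0.
- apply: near_uscM.
  + by move=> z; exact: expR_ge0.
  + by move=> z; apply: prodr_ge0 => i _; exact: powR_ge0.
  + exact: expR_ge0.
  + by apply: prodr_ge0 => i _; exact: powR_ge0.
  + exact: EE.
  + apply: near_usc_prod => [i z|i|i]; [exact: powR_ge0|exact: powR_ge0|].
    by apply: near_usc_powR => //; exact: UU.
- apply: near_usc_prod => [j z|j|j]; [exact: powR_ge0|exact: powR_ge0|].
  apply: near_usc_powR; last exact: GG.
  + by move=> z; rewrite invr_ge0 ltW.
  + by rewrite invr_ge0 ltW.
  + exact: d0.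
Qed.

Lemma heat_ratio_gt0_U t x i : 0 < heat_ratio t x -> 0 < U i t x.
Proof.
move=> r0; rewrite lt_neqAle eq_sym U0 andbT; apply/negP => /eqP Ui; move: r0.
by rewrite /heat_ratio (bigD1 i)//= Ui powR0 ?gt_eqF// mul0r mulr0 mul0r ltxx.
Qed.

Lemma heat_ratio_no_max t x : 0 < t -> t <= T -> 0 < heat_ratio t x ->
  ~ (forall t' x', 0 <= t' <= T -> heat_ratio t' x' <= heat_ratio t x).
Proof.
move=> t0 tT r0 rmax.
have Up i : 0 < U i t x by exact: heat_ratio_gt0_U.
have Hf i : 0 < 0 + heat_flow t (f i) (dsum_proj E i x).
  by have := Up i; rewrite /U heat_ext_gt0// add0r.
have Hg j : 0 < eps + heat_flow t (g j) (dsum_proj F j (Q x)).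
  by have := G0 j t x; rewrite /G heat_ext_gt0.
apply: (log_ratio_no_max geoD bf bg f_supp g_supp eta0 t0 Hf Hg).
- move=> w.
  have pE s i : dsum_proj E i (x + s *: w) = dsum_proj E i x + s *: dsum_proj E i w.
    by rewrite linearD linearZ.
  have pF s j : dsum_proj F j (Q (x + s *: w)) =
      dsum_proj F j (Q x) + s *: dsum_proj F j (Q w).
    by rewrite (linearD Q) (linearZ_LR Q) linearD linearZ.
  have {}pE s := functional_extensionality_dep (pE s).
  have {}pF s := functional_extensionality_dep (pF s).
  have line i (P : E i -> Prop) s : P (dsum_proj E i x + s *: dsum_proj E i w) ->
      P (dsum_proj E i (x + s *: w)).
    by rewrite -[dsum_proj E i (x + s *: w)]/((fun i => dsum_proj E i (x + s *: w)) i) pE.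
  have [del del0 delP] : exists2 del : R, 0 < del & forall s, `|s| <= del ->
      forall i, 0 < U i t (x + s *: w).
    apply: ord_min_radius => i.
    have := heat_taylor_space (dsum_proj E i x) (dsum_proj E i w) t0 (bf i) (f_supp i).
    move=> /(taylor2_gt0 _)[|e e0 eP]; first by have := Hf i; rewrite add0r.
    exists e; first exact: e0.
    move=> s /eP; rewrite /U (heat_ext_gt0 _ _ t0).
    exact: (line i (fun y => is_true (0 < heat_flow t (f i) y))).
  exists del; first exact: del0.
  move=> s /delP Us; have tT' : 0 <= t <= T by rewrite (ltW t0).
  have := rmax t (x + s *: w) tT'.
  by rewrite (heat_ratioE t0 Us) (heat_ratioE t0 Up) ler_expR pE pF.
- have [del del0 delP] : exists2 del : R, 0 < del & forall s, `|s| <= del ->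
      forall i, 0 < U i (t * expR (- s ^+ 2)) x.
    apply: ord_min_radius => i.
    have := heat_taylor_time (dsum_proj E i x) t0 (bf i) (f_supp i).
    move=> /(taylor2_gt0 _)[|e e0 eP]; first by have := Hf i; rewrite add0r.
    exists e; first exact: e0.
    by move=> s /eP; rewrite /U heat_ext_gt0 ?mulr_gt0 ?expR_gt0.
  exists del => // s /delP Us.
  (* t exp(-s^2) <= t <= T: the curve stays in the time slab even when t = T. *)
  have ts : 0 < t * expR (- s ^+ 2) by rewrite mulr_gt0// expR_gt0.
  rewrite -ler_expR -(heat_ratioE ts Us) -(heat_ratioE t0 Up).
  apply: rmax; rewrite (ltW ts)/= (le_trans _ tT)// ler_piMr ?(ltW t0)//.
  by rewrite -expR0 ler_expR oppr_le0 sqr_ge0.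
Qed.

(** By decay, a value above 1 can only occur in a compact box, so the maximum over the box is
    global; the initial bound keeps it away from time 0, and [heat_ratio_no_max] excludes positive
    times. *)
Lemma heat_ratio_le1 x : heat_ratio T x <= 1.
Proof.
rewrite leNgt; apply/negP => r1.
have [L L1 LP] := heat_ratio_decay.
pose A : set (R * 'rV[R]_(dim (dsum E))) := `[0, T]%classic `*`
  [set v : 'rV[R]_(dim (dsum E)) | forall i, `[- L, L]%classic (v ord0 i)].
have cA : compact A.
  apply: compact_setX; first exact: segment_compact.
  by apply: (@rV_compact R _ (fun=> `[- L, L]%classic)) => i; exact: segment_compact.
have outA t y : 0 <= t <= T -> ~ A (t, \row_i tnth (to_coord y) i) -> heat_ratio t y <= 1.
  move=> tT nA; apply: LP => //; rewrite leNgt; apply/negP => yL; apply: nA.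
  split => /=; first by rewrite in_itv.
  (* As L >= 1, a coordinate beyond L has a square beyond L. *)
  move=> i; rewrite mxE in_itv/= -ler_norml leNgt; apply/negP => Li.
  move: yL; rewrite -(to_coordK y) inner_of_coord (bigD1 i)//=.
  apply/negP; rewrite -leNgt.
  apply: (@le_trans _ _ (tnth (to_coord y) i * tnth (to_coord y) i)); last first.
    by rewrite lerDl sumr_ge0// => l _; rewrite -expr2 sqr_ge0.
  rewrite -expr2 -(real_normK (num_real _)); nra.
have Ax : A (T, \row_i tnth (to_coord x) i).
  apply: contrapT => nA; have := outA T x _ nA.
  by rewrite lexx (ltW T0) => /(_ isT); rewrite leNgt r1.
have [|p Ap pmax] := compact_usc_max (u := fun z => heat_ratio z.1 (row_pt z.2)) cA
    (ex_intro _ _ Ax).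
  move=> [t0 v0] [/= + _]; rewrite in_itv/= => /andP[t00 t0T].
  apply: heat_ratio_near_usc => //.
  - move=> e e0; rewrite near_withinE.
    have : \forall z \near (t0, v0), `|z.1 - t0| < e.
      have := @cvg_fst _ _ (nbhs t0) (nbhs v0) (nbhs_filter v0).
      move=> /(_ (fun t => `|t - t0| < e)); apply.
      by apply/nbhs_ballP; exists e => //= t; rewrite /ball/= distrC.
    apply: filterS => z zt [/= + _]; rewrite in_itv/= => /andP[z0 _].
    by split.
  - move=> e e0; rewrite near_withinE.
    have : \forall z \near (t0, v0),
        inner (row_pt z.2 - row_pt v0) (row_pt z.2 - row_pt v0) < e.
      have := @cvg_snd _ _ (nbhs t0) (nbhs v0) (nbhs_filter t0).
      move=> /(_ (fun v => inner (row_pt v - row_pt v0) (row_pt v - row_pt v0) < e)); apply.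
      exact: row_pt_near.
    by apply: filterS => z zv _.
have rp : 1 < heat_ratio p.1 (row_pt p.2).
  by apply: lt_le_trans r1 _; have := pmax _ Ax; rewrite /= row_ptK.
have [/= + _] := Ap; rewrite in_itv/= => /andP[p0 pT].
have tp : 0 < p.1.
  rewrite lt_neqAle p0 andbT eq_sym; apply/negP => /eqP p10.
  by move: rp; rewrite p10 ltNge heat_ratio_init.
apply: (heat_ratio_no_max tp pT (lt_trans ltr01 rp)) => t' x' t'T.
have [At|nA] := pselect (A (t', \row_i tnth (to_coord x') i)).
  by have := pmax _ At; rewrite /= row_ptK.
exact: le_trans (outA _ _ t'T nA) (ltW rp).
Qed.

End MaxPrinciple.

(** [heat_ratio_le1] is used with eps = e, T = t and eta = e / t, so the exponential factor costs
    exactly exp e. In the bound on v one e comes from eps and the other from the outer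
    approximation. *)
Lemma heat_flow_approx_le (R : realType) (k m : nat)
    (E : 'I_k -> euclidean R) (F : 'I_m -> euclidean R) (D : FRBL_datum E F)
    (f : forall i, E i -> R) (g : forall j, F j -> R) (t e : R)
    (X : forall i, E i) (Y : forall j, F j) (x : dsum E) :
  FRBL_geometric D ->
  (forall i x, 0 <= f i x) -> (forall i, lebesgue_integrable (f i)) ->
  (forall j y, 0 <= g j y) -> (forall j, lebesgue_integrable (g j)) ->
  (forall x : dsum E,
     \prod_(i < k) f i (dsum_proj E i x) `^ FRBL_c D i
     <= \prod_(j < m) g j (dsum_proj F j (FRBL_Q D x)) `^ FRBL_d D j) ->
  (forall i, X i = dsum_proj E i x) -> (forall j, Y j = dsum_proj F j (FRBL_Q D x)) ->
  0 < t -> 0 < e <= 1 ->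
  exists (u : 'I_k -> R) (v : 'I_m -> R), [/\
    forall i, 0 <= u i /\ heat_flow t (f i) (X i) - e <= u i,
    forall j, 0 <= v j <= heat_flow t (g j) (Y j) + 2 * e &
    \prod_i u i `^ FRBL_c D i <= expR e * \prod_j v j `^ FRBL_d D j].
Proof.
move=> geoD f0 fI g0 gI fg XE YE t0 /andP[e0 e1].
pose c := FRBL_c D; pose d := FRBL_d D; pose Q := FRBL_Q D.
have c0 i : 0 < c i by exact: FRBL_c_gt0.
have d0 j : 0 < d j by exact: FRBL_d_gt0.
have fA i : exists q : E i -> R, [/\ bounded_borel q, inner_usc q,
    forall y, 0 <= q y <= f i y,
    exists rho : R, forall y, rho < inner y y -> q y = 0 &
    heat_flow t (f i) (X i) <= heat_flow t q (X i) + e].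
  have [h [mh h0 ih fh]] := lebesgue_integrable_heat (X i) t0 (f0 i) (fI i).
  exact: (heat_flow_inner_approx t0 (f0 i) mh ih fh e0).
pose f' i := sval (cid (fA i)).
have f'P i := svalP (cid (fA i)); rewrite -/(f' _) in f'P.
have bf' i : bounded_borel (f' i) by have [] := f'P i.
have f'f i y : 0 <= f' i y <= f i y by have [_ _ H _ _] := f'P i; exact: H.
have /choice[rf rfP] : forall i, exists rho : R, forall y, rho < inner y y -> f' i y = 0.
  by move=> i; have [_ _ _ H _] := f'P i; exact: H.
have /choice[Mf MfP] : forall i, exists C : R, forall y, `|f' i y| <= C.
  by move=> i; have [_ H] := bf' i; exact: H.
pose M := 1 + \sum_i `|Mf i|.
have M1 : 1 <= M by rewrite lerDl sumr_ge0.
have Mp : 0 < M by exact: lt_le_trans M1.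
have f'M i y : 0 <= f' i y <= M.
  have /andP[-> _] := f'f i y; rewrite (le_trans (ler_norm _))//.
  rewrite (le_trans (MfP i y))// (le_trans (ler_norm _))// /M (bigD1 i)//=.
  by rewrite addrCA lerDl addr_ge0// sumr_ge0.
pose WM := \prod_i M `^ c i; pose We := \prod_j e `^ d j.
have WM0 : 0 < WM by apply: prodr_gt0 => i _; exact: powR_gt0.
have We0 : 0 < We by apply: prodr_gt0 => j _; exact: powR_gt0.
(* Where [g j] exceeds the cap [M' j], the product of the [e + g' j] is at least
   [M' j ^ d j * We = WM], which dominates the product of the [f' i]. *)
pose M' j := (WM / We) `^ (d j)^-1.
have M'0 j : 0 <= M' j by exact: powR_ge0.
have M'd j : M' j `^ d j = WM / We.
  by rewrite /M' -powRrM mulVf ?gt_eqF// powRr1// divr_ge0// ltW.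
(* If no f' i vanishes at z, then |z_i|^2 <= |rf i| for all i, and the geometric inequality puts
   (Qz)_j into this ball: g' has to dominate only there. *)
pose rg j := (\sum_i c i * `|rf i|) / d j + 1.
have gA j : exists q : F j -> R, [/\ bounded_borel q, inner_usc (fun y => - q y),
    forall y, 0 <= q y <= M' j,
    (forall y, inner y y < rg j -> Num.min (g j y) (M' j) <= q y) /\
    (exists rho' : R, forall y, rho' < inner y y -> q y = 0) &
    heat_flow t q (Y j) <= heat_flow t (g j) (Y j) + e].
  exact: (heat_flow_outer_approx (Y j) (rg j) t0 (g0 j) (gI j) (M'0 j) e0).
pose g' j := sval (cid (gA j)).
have g'P j := svalP (cid (gA j)); rewrite -/(g' _) in g'P.
have bg' j : bounded_borel (g' j) by have [] := g'P j.
have g'0 j y : 0 <= g' j y by have [_ _ /(_ y)/andP[]] := g'P j.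
have /choice[sg sgP] : forall j, exists rho : R, forall y, rho < inner y y -> g' j y = 0.
  by move=> j; have [_ _ _ [_ H] _] := g'P j; exact: H.
have g'g j y : inner y y < rg j -> Num.min (g j y) (M' j) <= g' j y.
  by have [_ _ _ [H _] _] := g'P j; exact: H.
pose rho := \sum_i `|rf i| + \sum_j `|sg j|.
have f'supp i y : rho < inner y y -> f' i y = 0.
  move=> h; apply: rfP; apply: le_lt_trans h; rewrite (le_trans (ler_norm _))//.
  by rewrite /rho (bigD1 i)//= -addrA lerDl addr_ge0// sumr_ge0.
have g'supp j y : rho < inner y y -> g' j y = 0.
  move=> h; apply: sgP; apply: le_lt_trans h; rewrite (le_trans (ler_norm _))//.
  by rewrite /rho [X in _ + X](bigD1 j)//= addrCA lerDl addr_ge0// sumr_ge0.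
have init z : \prod_i f' i (dsum_proj E i z) `^ c i <=
    \prod_j (e + g' j (dsum_proj F j (Q z))) `^ d j.
  have [[i fi0]|nz] := pselect (exists i, f' i (dsum_proj E i z) = 0).
    rewrite (bigD1 i)//= fi0 powR0 ?gt_eqF// mul0r.
    by apply: prodr_ge0 => j _; exact: powR_ge0.
  have inball j : inner (dsum_proj F j (Q z)) (dsum_proj F j (Q z)) < rg j.
    apply: (@le_lt_trans _ _ ((\sum_i c i * `|rf i|) / d j)); last by rewrite ltrDl.
    rewrite ler_pdivlMr// mulrC.
    apply: (@le_trans _ _ (\sum_j d j * inner (dsum_proj F j (Q z)) (dsum_proj F j (Q z)))).
      rewrite (bigD1 j)//= lerDl sumr_ge0// => l _.
      by rewrite mulr_ge0 ?inner_ge0// ltW.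
    apply: (le_trans (geometric_le z geoD)); apply: ler_sum => i _.
    rewrite ler_wpM2l ?(ltW (c0 i))// (le_trans _ (ler_norm _))//.
    by rewrite leNgt; apply/negP => /rfP fi; apply: nz; exists i.
  have powd j a b : 0 <= a -> a <= b -> a `^ d j <= b `^ d j.
    move=> a0 ab; apply: ge0_ler_powR; rewrite ?nnegrE ?(ltW (d0 j))//.
    exact: le_trans ab.
  have [[j gj]|ng] := pselect (exists j, M' j < g j (dsum_proj F j (Q z))).
    have f'W : \prod_i f' i (dsum_proj E i z) `^ c i <= WM.
      apply: ler_prod => i _; rewrite powR_ge0/=; have /andP[h1 h2] := f'M i (dsum_proj E i z).
      by apply: ge0_ler_powR; rewrite ?nnegrE ?(ltW (c0 i)) ?(ltW Mp).
    apply: (le_trans f'W).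
    have -> : WM = M' j `^ d j * We by rewrite M'd divfK// gt_eqF.
    rewrite (bigD1 j)//=; apply: ler_pM; rewrite ?powR_ge0 ?(ltW We0)//.
      apply: powd => //; rewrite (@le_trans _ _ (g' j (dsum_proj F j (Q z))))//.
        by have := g'g j _ (inball j); rewrite min_r// ltW.
      by rewrite lerDr ltW.
    (* e <= 1 lets the factor e^(d_j) of [We] be dropped. *)
    rewrite /We (bigD1 j)//= (@le_trans _ _ (\prod_(l | l != j) e `^ d l))//.
      rewrite ler_piMl//; first by apply: prodr_ge0 => l _; exact: powR_ge0.
      by have := @powd j e 1 (ltW e0) e1; rewrite powR1.
    apply: ler_prod => l _; rewrite powR_ge0/=; apply: powd; first exact: ltW.
    by rewrite lerDl.
  apply: (@le_trans _ _ (\prod_i f i (dsum_proj E i z) `^ c i)).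
    apply: ler_prod => i _; rewrite powR_ge0/=.
    have /andP[h1 h2] := f'f i (dsum_proj E i z).
    by apply: ge0_ler_powR; rewrite ?nnegrE ?(ltW (c0 i)) ?f0.
  apply: (le_trans (fg z)); apply: ler_prod => j _; rewrite powR_ge0/=.
  apply: powd; first exact: g0.
  apply: (@le_trans _ _ (g' j (dsum_proj F j (Q z)))); last by rewrite lerDr ltW.
  have := g'g j _ (inball j); rewrite min_l// leNgt.
  by apply/negP => h; apply: ng; exists j.
have eta0 : 0 < e / t by rewrite divr_gt0.
have uf' i : inner_usc (f' i) by have [] := f'P i.
have ug' j : inner_usc (fun y => - g' j y) by have [] := g'P j.
exists (fun i => heat_flow t (f' i) (X i)), (fun j => e + heat_flow t (g' j) (Y j)); split.
- move=> i; split; first by apply: heat_flow_ge0 => y; have /andP[] := f'f i y.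
  by rewrite lerBlDr; have [] := f'P i.
- move=> j; have h : 0 <= heat_flow t (g' j) (Y j) by apply: heat_flow_ge0.
  by have [_ _ _ _ h2] := g'P j; apply/andP; split; lra.
- have Gp j : 0 < e + heat_flow t (g' j) (Y j).
    by rewrite ltr_pwDl//; apply: heat_flow_ge0.
  have GP : 0 < \prod_j (e + heat_flow t (g' j) (Y j)) `^ d j.
    by apply: prodr_gt0 => j _; exact: powR_gt0.
  move: (heat_ratio_le1 geoD bf' bg' uf' ug' f'supp g'supp f'M g'0 e0 eta0 M1 t0 init x).
  rewrite /heat_ratio.
  under eq_bigr do rewrite heat_ext_gt0// -XE.
  under [in X in _ * X]eq_bigr do rewrite heat_ext_gt0// -YE.
  have -> : \prod_j (e + heat_flow t (g' j) (Y j))^-1 `^ d j =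
      (\prod_j (e + heat_flow t (g' j) (Y j)) `^ d j)^-1.
    rewrite -prodfV; apply: eq_bigr => j _.
    by rewrite -powR_inv1 ?ltW// -powRrM mulN1r powRN.
  rewrite ler_pdivrMr// mul1r mulNr divfK ?gt_eqF// expRN => h.
  by rewrite -ler_pdivrMl ?expR_gt0.
Qed.

(** * Passage to the limit as the approximation error tends to 0 *)

Theorem theorem1 (R : realType) (k m : nat)
    (E : 'I_k -> euclidean R) (F : 'I_m -> euclidean R) (D : FRBL_datum E F)
    (f : forall i, E i -> R) (g : forall j, F j -> R) :
  FRBL_geometric D ->
  (forall i x, 0 <= f i x) -> (forall i, lebesgue_integrable (f i)) ->
  (forall j y, 0 <= g j y) -> (forall j, lebesgue_integrable (g j)) ->
  (forall x : dsum E,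
     \prod_(i < k) f i (dsum_proj E i x) `^ FRBL_c D i
     <= \prod_(j < m) g j (dsum_proj F j (FRBL_Q D x)) `^ FRBL_d D j) ->
  forall (x : dsum E) (t : R), 0 < t ->
    \prod_(i < k) heat_flow t (f i) (dsum_proj E i x) `^ FRBL_c D i
    <= \prod_(j < m)
         heat_flow t (g j) (dsum_proj F j (FRBL_Q D x)) `^ FRBL_d D j.
Proof.
move=> geoD f0 fI g0 gI fg x t t0.
pose a i := heat_flow t (f i) (dsum_proj E i x).
pose b j := heat_flow t (g j) (dsum_proj F j (FRBL_Q D x)).
have c0 := FRBL_c_gt0 D; have d0 := FRBL_d_gt0 D.
have a0 i : 0 <= a i by apply: heat_flow_ge0; exact: f0.
have b0 j : 0 <= b j by apply: heat_flow_ge0; exact: g0.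
have approx e : 0 < e <= 1 -> exists (u : 'I_k -> R) (v : 'I_m -> R), [/\
    forall i, 0 <= u i /\ a i - e <= u i, forall j, 0 <= v j <= b j + 2 * e &
    \prod_i u i `^ FRBL_c D i <= expR e * \prod_j v j `^ FRBL_d D j].
  move=> e01; exact: (heat_flow_approx_le (X := fun i => dsum_proj E i x)
    (Y := fun j => dsum_proj F j (FRBL_Q D x)) geoD f0 fI g0 gI fg _ _ t0 e01).
rewrite -/(\prod_(i < k) a i `^ _) -/(\prod_(j < m) b j `^ _).
clearbody a b; clear -c0 d0 a0 b0 approx.
(* Outside this trivial case all a_i are positive, so that their powers can be divided out. *)
have [[i ai]|na] := pselect (exists i, a i = 0).
  rewrite (bigD1 i)//= ai powR0 ?gt_eqF// mul0r.
  by apply: prodr_ge0 => j _; exact: powR_ge0.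
have {na} ap i : 0 < a i.
  by rewrite lt_neqAle a0 andbT eq_sym; apply/eqP => ai; apply: na; exists i.
have AP : 0 < \prod_i a i `^ FRBL_c D i by apply: prodr_gt0 => i _; exact: powR_gt0.
(* Equal to a_i - e for small e > 0, yet positive for every e, as [near_usc_inv] requires at all
   points; the absolute value in b_j + 2 |e| plays the same role for powers. *)
pose al i e : R := Num.max (a i - e) (a i / 2).
have al0 i e : 0 < al i e by rewrite lt_max divr_gt0 ?orbT.
have alV : (\prod_i a i `^ FRBL_c D i)^-1 = \prod_i (a i)^-1 `^ FRBL_c D i.
  rewrite -prodfV; apply: eq_bigr => i _.
  by rewrite -powR_inv1 ?(ltW (ap i))// -powRrM mulN1r powRN.
rewrite -[leLHS]mul1r -ler_pdivlMr// alV.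
apply/ler_addgt0Pr => h h0.
have W : near_usc (0 : R)^'+ (fun e => expR e * \prod_j (b j + 2 * `|e|) `^ FRBL_d D j *
    \prod_i (al i e)^-1 `^ FRBL_c D i)
    (1 * \prod_j b j `^ FRBL_d D j * \prod_i (a i)^-1 `^ FRBL_c D i).
  have small e : 0 < e -> \forall s \near (0 : R)^'+, 0 < s /\ s < e.
    by move=> e0; near=> s; split; near: s; [exact: nbhs_right_gt|exact: nbhs_right_lt].
  have b2 j e : 0 <= b j + 2 * `|e| by rewrite addr_ge0// mulr_ge0.
  apply: near_uscM.
  - by move=> e; rewrite mulr_ge0 ?expR_ge0// prodr_ge0// => j _; exact: powR_ge0.
  - by move=> e; apply: prodr_ge0 => i _; exact: powR_ge0.
  - by rewrite mulr_ge0// prodr_ge0// => j _; exact: powR_ge0.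
  - by apply: prodr_ge0 => i _; exact: powR_ge0.
  - apply: near_uscM.
    + by move=> e; exact: expR_ge0.
    + by move=> e; apply: prodr_ge0 => j _; exact: powR_ge0.
    + exact: ler01.
    + by apply: prodr_ge0 => j _; exact: powR_ge0.
    + move=> e e0.
      have m0 : 0 < Num.min (1 / 2) (e / 2) by rewrite lt_min !divr_gt0.
      apply: filterS (small _ m0) => s [s0]; rewrite lt_min => /andP[s1 s2].
      have := @expR_bound1 R s; rewrite ger0_norm ?(ltW s0)// => /(_ (ltW s1)).
      by rewrite ler_norml => /andP[_]; lra.
    + apply: near_usc_prod => [j e|j|j]; [exact: powR_ge0|exact: powR_ge0|].
      apply: near_usc_powR => // e e0.
      have e20 : 0 < e / 2 by rewrite divr_gt0.
      apply: filterS (small _ e20) => s [s0 s1].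
      by rewrite ger0_norm ?(ltW s0)//; lra.
  - apply: near_usc_prod => [i e|i|i]; [exact: powR_ge0|exact: powR_ge0|].
    apply: near_usc_powR => //.
    + by move=> e; rewrite invr_ge0 ltW.
    + by rewrite invr_ge0 ltW.
    + apply: near_usc_inv => // e e0.
      apply: filterS (small _ e0) => s [s0 s1].
      by rewrite lerNl opprD opprK le_max; apply/orP; left; rewrite lerB// ltW.
have : \forall e \near (0 : R)^'+, 0 < e <= 1 /\ forall i, e < a i / 2.
  near=> e; split; first (apply/andP; split; near: e).
  - exact: nbhs_right_gt.
  - exact: nbhs_right_le.
  - near: e; apply: filter_forall => i; apply: nbhs_right_lt.
    by rewrite divr_gt0.
move=> H; have [e [[e01 ea] We]] := filter_ex (filterI H (W h h0)).
rewrite mul1r in We; apply: le_trans We.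
have [u [v [uP vP uv]]] := approx e e01; have /andP[e0 e1] := e01.
have alP : 0 < \prod_i al i e `^ FRBL_c D i by apply: prodr_gt0 => i _; exact: powR_gt0.
have -> : \prod_i (al i e)^-1 `^ FRBL_c D i = (\prod_i al i e `^ FRBL_c D i)^-1.
  rewrite -prodfV; apply: eq_bigr => i _.
  by rewrite -powR_inv1 ?(ltW (al0 i e))// -powRrM mulN1r powRN.
rewrite ler_pdivlMr// mul1r; apply: (@le_trans _ _ (\prod_i u i `^ FRBL_c D i)).
  apply: ler_prod => i _; rewrite powR_ge0/=; have [u0 u1] := uP i.
  apply: ge0_ler_powR; rewrite ?nnegrE ?(ltW (c0 i)) ?(ltW (al0 i e))//.
  by rewrite /al ge_max u1/=; have := ea i; lra.
apply: (le_trans uv); rewrite ler_wpM2l ?expR_ge0//.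
apply: ler_prod => j _; rewrite powR_ge0/=; have /andP[v0 v1] := vP j.
have bv : v j <= b j + 2 * `|e| by rewrite ger0_norm// ltW.
apply: ge0_ler_powR; rewrite ?nnegrE ?(ltW (d0 j))//.
exact: le_trans bv.
Unshelve. all: by end_near. Qed.
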